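(* Let $G\subset GL(V)$, $V=\mathbb{C}^n$, be a finite complex reflection group with degrees $d_1\ge\dots\ge d_n$ such that (i) $d_\alpha>1$ for all $1\le\alpha\le n$, and (ii) there is a set of basic invariants $x^1,\dots,x^n$ (with $\deg x^\alpha=d_\alpha$) such that the discriminant $\Delta\in\mathbb{C}[x]$ is a monic polynomial of degree $n$ as a polynomial in $x^1$. Fix such $x^1,\dots,x^n$, and let $\Gamma_{\alpha\beta}^\gamma, C_{\alpha\beta}^\gamma\in\mathbb{C}[x^2,\dots,x^n]$ be the polynomials defined in the context. Define a connection $\nabla$ and a multiplication $\ast$ on the tangent bundle $TM$ of the orbit space $M$ of $G$ by $$\nabla_{\partial_\alpha}(\partial_\beta)=\sum_{\gamma=1}^n\Gamma_{\alpha\beta}^\gamma\,\partial_\gamma,\qquad \partial_\alpha\ast\partial_\beta=\sum_{\gamma=1}^nC_{\alpha\beta}^\gamma\,\partial_\gamma,\qquad \partial_\alpha=\partial_{x^\alpha}.$$ Then: (1) $\nabla$ is torsion-free and flat. (2) $\ast$ is commutative and associative and its unit is $e=\partial_{x^1}$. (3) $(\nabla,\ast,\frac{1}{d_1}E_{\mathrm{deg}})$ is a polynomial Saito structure defined on the whole orbit space $M$. (4) Its dual almost Saito structure with parameter $r=\frac{1}{d_1}$ is the regular natural almost Saito structure $(\boldsymbol{\nabla}^V,\partial_{x^1})$ for $G$.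
   Context: Saito structure on a complex manifold $M$: a triple $(\nabla,\ast,E)$ of a torsion-free flat connection $\nabla$ on $TM$, an associative commutative $\mathcal{O}_M$-bilinear multiplication $\ast$ on $TM$ with unit vector field $e$, and a vector field $E$, such that for local vector fields $x,y,z$: (SS1) $\nabla_x(y\ast z)-y\ast\nabla_xz-\nabla_y(x\ast z)+x\ast\nabla_yz=[x,y]\ast z$; (SS2) $[E,x\ast y]-[E,x]\ast y-x\ast[E,y]=x\ast y$; (SS3) $\nabla e=0$; (SS4) $\nabla_x\nabla_yE-\nabla_{\nabla_xy}E=0$. Almost Saito structure on $N$ with parameter $r\in\mathbb{C}$: a triple $(\boldsymbol{\nabla},\star,e)$ of a torsion-free flat connection on $TN$, an associative commutative multiplication with unit $E$, and a nonzero vector field $e$, such that (ASS1) $\boldsymbol{\nabla}_x(y\star z)-y\star\boldsymbol{\nabla}_xz-\boldsymbol{\nabla}_y(x\star z)+x\star\boldsymbol{\nabla}_yz=[x,y]\star z$; (ASS2) $[e,x\star y]-[e,x]\star y-x\star[e,y]+e\star x\star y=0$; (ASS3) $\boldsymbol{\nabla}_xE=rx$; (ASS4) $\boldsymbol{\nabla}_x\boldsymbol{\nabla}_ye-\boldsymbol{\nabla}_{\boldsymbol{\nabla}_xy}e+\boldsymbol{\nabla}_{x\star y}e=0$. The pair $(\boldsymbol{\nabla},e)$ is regular if $\mathcal{Q}(x)=\boldsymbol{\nabla}_xe$ is an isomorphism of $\mathcal{T}_N$; then $\star$ is determined by (ASS4): $x\star y=-\mathcal{Q}^{-1}(\boldsymbol{\nabla}_x\boldsymbol{\nabla}_ye)+\boldsymbol{\nabla}_xy$,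 and one writes $(\boldsymbol{\nabla},e)$ for the regular almost Saito structure $(\boldsymbol{\nabla},\star,e)$. The dual almost Saito structure with parameter $r$ of a Saito structure $(\nabla,\ast,E)$ with unit $e$ is $(\boldsymbol{\nabla}^{(0,r)},\star_0,e)$, defined on the open set where $\mathcal{U}_0=E\ast$ is invertible, with $x\star_0y=\mathcal{U}_0^{-1}(x\ast y)$, $\boldsymbol{\nabla}^{(0,r)}_xy=\nabla_xy+r\,x\star_0y-\nabla_{x\star_0y}E$; its unit is $E$. Orbit space: $u^1,\dots,u^n$ are the standard coordinates of $V=\mathbb{C}^n$. A set of basic invariants is a set of homogeneous generators $x^1,\dots,x^n$ of $\mathbb{C}[V]^G$; their degrees $d_1\ge\dots\ge d_n$ are the degrees of $G$; $M=\mathrm{Spec}\,\mathbb{C}[V]^G$. $E_{\mathrm{deg}}=\sum_\alpha d_\alpha x^\alpha\partial_{x^\alpha}$. For each reflection hyperplane $H$ let $L_H$ be a linear form with kernel $H$ and $e_H$ the order of the pointwise stabilizer of $H$ in $G$; $\delta=\prod_HL_H^{e_H}$ is $G$-invariant and is written $\Delta(x)$ as a polynomial in $x$ (the discriminant, defined up to a nonzero constant depending on the choice of the $L_H$); $M_0=M\setminus\{\Delta=0\}$. The natural connection $\boldsymbol{\nabla}^V$ on $TM_0$ is induced from the trivial connection on $TV$ via the orbit map: $\boldsymbol{\nabla}^V_{\partial_\alpha}\partial_\beta=\sum_\gamma\Omega_{\alpha\beta}^\gamma\partial_\gamma$, $\Omega_{\alpha\beta}^\gamma=-\sum_{i,j}\frac{\partial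 u^i}{\partial x^\alpha}\frac{\partial u^j}{\partial x^\beta}\frac{\partial^2x^\gamma}{\partial u^i\partial u^j}\in\mathbb{C}(x)$; $\Omega_\alpha$ is the matrix with $(\gamma,\beta)$ entry $\Omega_{\alpha\beta}^\gamma$. Definition of $\Gamma$ and $C$ (under (i),(ii)): $\Delta\Omega_{\alpha\beta}^\gamma$ is a polynomial in $x$ of degree at most $n$ in $x^1$; $\Gamma_{\alpha\beta}^\gamma\in\mathbb{C}[x^2,\dots,x^n]$ is the coefficient of $(x^1)^n$ in it. With $\Gamma_\alpha=(\Gamma_{\alpha\beta}^\gamma)_{\gamma,\beta}$, the matrix $\Omega_1$ is invertible on $M_0$, and $C_\alpha=\Omega_1^{-1}(\Omega_\alpha-\Gamma_\alpha)$ has entries in $\mathbb{C}[x^2,\dots,x^n]$; $C_{\alpha\beta}^\gamma$ is the $(\gamma,\beta)$ entry of $C_\alpha$. Natural almost Saito structure for $G$: an almost Saito structure $(\boldsymbol{\nabla},\star,e)$ on $M_0$ with $\boldsymbol{\nabla}=\boldsymbol{\nabla}^V$, unit of $\star$ equal to $\frac{1}{d_1}E_{\mathrm{deg}}$ (hence parameter $r=\frac1{d_1}$), and $e$ a nonzero polynomial vector field on $M$ of degree $-d_1$ (grading $\deg x^\alpha=d_\alpha$). Polynomial Saito structure: a Saito structure $(\nabla,\ast,E)$ on $M$ such that there exist $\nabla$-flat coordinates $t^1,\dots,t^n$ forming a set of basic invariants of $G$, and all entries of the matrices of $\partial_{t^\alpha}\ast$ in the basis $\partial_{t^1},\dots,\partial_{t^n}$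 are polynomials in $t$. *)

(* Defs.v *)
From HB Require Import structures.
From mathcomp Require Import all_boot all_order all_algebra.
From mathcomp Require Import finmap complex.
From mathcomp Require Import all_classical all_reals all_analysis.
From mathcomp Require mpoly.
(* The notations of mpoly clash with those of MathComp-Analysis. *)
Import -(notations) mpoly.

Set Implicit Arguments.
Unset Strict Implicit.
Unset Printing Implicit Defensive.

Import Order.TTheory GRing.Theory Num.Theory.
Import numFieldNormedType.Exports.

Local Open Scope ring_scope.
Local Open Scope complex_scope.
Local Open Scope classical_set_scope.

(* [C] is [R[i]]; a point of C^n is a row vector. The tangent bundle is
   trivialised by the coordinate fields. *)

Definition Cn (R : realType) (n : nat) : normedModType R[i] := 'rV[R[i]]_n.

(* All complex partial derivatives d^m f, indexed by multi-indices m, exist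
   and are differentiable. By Cauchy's theorem this is the same as complex
   differentiability on the open set U. *)
Definition holomorphic_on (R : realType) (n : nat) (W : normedModType R[i])
    (U : set 'rV[R[i]]_n) (f : 'rV[R[i]]_n -> W) : Prop :=
  exists F : multinom n -> 'rV[R[i]]_n -> W,
    (forall p, U p -> F (@mnm0 n) p = f p) /\
    (forall m i (p : Cn R n), U p ->
        differentiable (F m) p /\
        'D_(delta_mx 0 i) (F m) p = F (mnm_add m (mnm1 i)) p).

Definition vfield (R : realType) (n : nat) : Type :=
  'rV[R[i]]_n -> 'rV[R[i]]_n.

(* [K a b c] is the coefficient K_{ab}^c: Christoffel symbols of a connection,
   or structure functions of a multiplication. *)
Definition coefs (R : realType) (n : nat) : Type :=
  'I_n -> 'I_n -> 'I_n -> 'rV[R[i]]_n -> R[i].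

Definition holomorphic_coefs (R : realType) (n : nat)
    (U : set 'rV[R[i]]_n) (K : coefs R n) : Prop :=
  forall a b c, @holomorphic_on R n (R[i])^o U (K a b c).

Definition coord_field (R : realType) (n : nat) (a : 'I_n) : vfield R n :=
  fun _ => delta_mx 0 a.

Definition mult (R : realType) (n : nat) (K : coefs R n) (x y : vfield R n) :
    vfield R n :=
  fun p => \row_c \sum_a \sum_b K a b c p * x p 0 a * y p 0 b.

Definition nabla (R : realType) (n : nat) (Gam : coefs R n) (x y : vfield R n) :
    vfield R n :=
  fun p => 'D_(x p) y p + mult Gam x y p.

Definition bracket (R : realType) (n : nat) (x y : vfield R n) : vfield R n :=
  fun p => 'D_(x p) y p - 'D_(y p) x p.

Definition local_field (R : realType) (n : nat) (U W : set 'rV[R[i]]_n)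
    (x : vfield R n) : Prop :=
  [/\ @open (Cn R n) W, W `<=` U & holomorphic_on W x].

Definition torsion_free (R : realType) (n : nat) (U : set 'rV[R[i]]_n)
    (Gam : coefs R n) : Prop :=
  forall W x y p, local_field U W x -> local_field U W y -> W p ->
    nabla Gam x y p - nabla Gam y x p = bracket x y p.

Definition flat (R : realType) (n : nat) (U : set 'rV[R[i]]_n)
    (Gam : coefs R n) : Prop :=
  forall W x y z p, local_field U W x -> local_field U W y ->
    local_field U W z -> W p ->
    nabla Gam x (nabla Gam y z) p - nabla Gam y (nabla Gam x z) p
      - nabla Gam (bracket x y) z p = 0.

Definition mult_commutative (R : realType) (n : nat) (U : set 'rV[R[i]]_n)
    (K : coefs R n) : Prop :=
  forall W x y p, local_field U W x -> local_field U W y -> W p ->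
    mult K x y p = mult K y x p.

Definition mult_associative (R : realType) (n : nat) (U : set 'rV[R[i]]_n)
    (K : coefs R n) : Prop :=
  forall W x y z p, local_field U W x -> local_field U W y ->
    local_field U W z -> W p ->
    mult K x (mult K y z) p = mult K (mult K x y) z p.

Definition mult_unit (R : realType) (n : nat) (U : set 'rV[R[i]]_n)
    (K : coefs R n) (e : vfield R n) : Prop :=
  forall W x p, local_field U W x -> W p -> mult K e x p = x p.

(* The Saito structure (nabla, *, E) on U, with e the unit of *. *)
Record saito_structure (R : realType) (n : nat) (U : set 'rV[R[i]]_n)
    (Gam K : coefs R n) (e E : vfield R n) : Prop := SaitoStructure {
  ss_open : @open (Cn R n) U;
  ss_hol_conn : holomorphic_coefs U Gam;
  ss_hol_mult : holomorphic_coefs U K;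
  ss_hol_e : holomorphic_on U e;
  ss_hol_E : holomorphic_on U E;
  ss_torsion_free : torsion_free U Gam;
  ss_flat : flat U Gam;
  ss_commutative : mult_commutative U K;
  ss_associative : mult_associative U K;
  ss_unit : mult_unit U K e;
  ss1 : forall W x y z p, local_field U W x -> local_field U W y ->
    local_field U W z -> W p ->
    nabla Gam x (mult K y z) p - mult K y (nabla Gam x z) p
      - nabla Gam y (mult K x z) p + mult K x (nabla Gam y z) p
    = mult K (bracket x y) z p;
  ss2 : forall W x y p, local_field U W x -> local_field U W y -> W p ->
    bracket E (mult K x y) p - mult K (bracket E x) y p
      - mult K x (bracket E y) p
    = mult K x y p;
  ss3 : forall W x p, local_field U W x -> W p -> nabla Gam x e p = 0;
  ss4 : forall W x y p, local_field U W x -> local_field U W y -> W p ->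
    nabla Gam x (nabla Gam y E) p - nabla Gam (nabla Gam x y) E p = 0
}.

(* The almost Saito structure (nabla, star, e) on U with parameter r, with E
   the unit of star. *)
Record almost_saito_structure (R : realType) (n : nat) (U : set 'rV[R[i]]_n)
    (r : R[i]) (Gam S : coefs R n) (E e : vfield R n) : Prop :=
    AlmostSaitoStructure {
  ass_open : @open (Cn R n) U;
  ass_hol_conn : holomorphic_coefs U Gam;
  ass_hol_mult : holomorphic_coefs U S;
  ass_hol_E : holomorphic_on U E;
  ass_hol_e : holomorphic_on U e;
  ass_e_neq0 : exists2 p, U p & e p != 0;
  ass_torsion_free : torsion_free U Gam;
  ass_flat : flat U Gam;
  ass_commutative : mult_commutative U S;
  ass_associative : mult_associative U S;
  ass_unit : mult_unit U S E;
  ass1 : forall W x y z p, local_field U W x -> local_field U W y ->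
    local_field U W z -> W p ->
    nabla Gam x (mult S y z) p - mult S y (nabla Gam x z) p
      - nabla Gam y (mult S x z) p + mult S x (nabla Gam y z) p
    = mult S (bracket x y) z p;
  ass2 : forall W x y p, local_field U W x -> local_field U W y -> W p ->
    bracket e (mult S x y) p - mult S (bracket e x) y p
      - mult S x (bracket e y) p + mult S e (mult S x y) p = 0;
  ass3 : forall W x p, local_field U W x -> W p ->
    nabla Gam x E p = r *: x p;
  ass4 : forall W x y p, local_field U W x -> local_field U W y -> W p ->
    nabla Gam x (nabla Gam y e) p - nabla Gam (nabla Gam x y) e p
      + nabla Gam (mult S x y) e p = 0
}.

(* x |-> nabla_x e is O-linear, so it is an isomorphism of the tangent sheaf
   iff it is bijective on each tangent space. *)
Definition regular (R : realType) (n : nat) (U : set 'rV[R[i]]_n)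
    (Gam : coefs R n) (e : vfield R n) : Prop :=
  forall p, U p ->
    bijective (fun v : 'rV[R[i]]_n => nabla Gam (fun _ => v) e p).

(* Tangent vectors are rows: E * v = v *m mult_mx K E p. *)
Definition mult_mx (R : realType) (n : nat) (K : coefs R n) (E : vfield R n)
    (p : 'rV[R[i]]_n) : 'M[R[i]]_n :=
  \matrix_b mult K E (@coord_field R n b) p.

Definition invertible_locus (R : realType) (n : nat) (K : coefs R n)
    (E : vfield R n) : set 'rV[R[i]]_n :=
  [set p | mult_mx K E p \in unitmx].

Definition dual_mult (R : realType) (n : nat) (K : coefs R n) (E : vfield R n) :
    coefs R n :=
  fun a b c p =>
    (mult K (@coord_field R n a) (@coord_field R n b) p
       *m invmx (mult_mx K E p)) 0 c.

Definition dual_conn (R : realType) (n : nat) (r : R[i]) (Gam K : coefs R n)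
    (E : vfield R n) : coefs R n :=
  fun a b c p =>
    let da := @coord_field R n a in
    let db := @coord_field R n b in
    let da_star_db := mult (dual_mult K E) da db in
    (nabla Gam da db p + r *: da_star_db p - nabla Gam da_star_db E p) 0 c.

(* A matrix g acts on V = C^n by u |-> g *m u, u a column vector. *)

Definition reflection (R : realType) (n : nat) (g : 'M[R[i]]_n) : bool :=
  \rank (g - 1%:M) == 1%N.

Record reflection_group (R : realType) (n : nat) (G : {fset 'M[R[i]]_n}) :
    Prop := ReflectionGroup {
  rg_unit : forall g, g \in G -> g \in unitmx;
  rg_1 : 1%:M \in G;
  rg_mul : forall g h, g \in G -> h \in G -> g *m h \in G;
  rg_inv : forall g, g \in G -> invmx g \in G;
  rg_generated : forall g, g \in G ->
    exists2 s : seq 'M[R[i]]_n,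
      all (fun h => (h \in G) && reflection h) s
      & g = \big[mulmx/1%:M]_(h <- s) h
}.

Definition linear_form (R : realType) (n : nat) (l : 'rV[R[i]]_n) :
    mpoly n R[i] :=
  \sum_j l 0 j *: mpolyX R[i] (mnm1 j).

Definition G_invariant (R : realType) (n : nat) (G : {fset 'M[R[i]]_n})
    (f : mpoly n R[i]) : Prop :=
  forall g, g \in G ->
    comp_mpoly [tuple linear_form (row i g) | i < n] f = f.

(* Homogeneous generators x^1, ..., x^n of C[V]^G. *)
Record basic_invariants (R : realType) (n : nat) (G : {fset 'M[R[i]]_n})
    (x : n.-tuple (mpoly n R[i])) : Prop := BasicInvariants {
  bi_homog : forall a, exists k, tnth x a \is ishomog1 k (@mdeg n);
  bi_invariant : forall a, G_invariant G (tnth x a);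
  bi_generate : forall f, G_invariant G f ->
    exists P : mpoly n R[i], f = comp_mpoly x P
}.

(* [Ls] is a list of linear forms L_H, exactly one for each reflection
   hyperplane H of G; distinct forms are pairwise non-proportional. *)
Record hyperplane_forms (R : realType) (n : nat) (G : {fset 'M[R[i]]_n})
    (Ls : seq 'rV[R[i]]_n) : Prop := HyperplaneForms {
  hf_hyperplane : forall l, l \in Ls ->
    exists g, [/\ g \in G, reflection g
      & forall u : 'cV[R[i]]_n, l *m u = 0 <-> g *m u = u];
  hf_all : forall g, g \in G -> reflection g ->
    exists2 l, l \in Ls
      & forall u : 'cV[R[i]]_n, l *m u = 0 <-> g *m u = u;
  hf_distinct : pairwise (fun l l' => ~~ (l == l')%MS) Ls
}.

(* Order of the pointwise stabilizer of ker l. *)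
Definition stabilizer_order (R : realType) (n : nat) (G : {fset 'M[R[i]]_n})
    (l : 'rV[R[i]]_n) : nat :=
  #|` [fset g in G |
        `[< forall u : 'cV[R[i]]_n, l *m u = 0 -> g *m u = u >]]|%fset.

Definition discriminant_V (R : realType) (n : nat) (G : {fset 'M[R[i]]_n})
    (Ls : seq 'rV[R[i]]_n) : mpoly n R[i] :=
  \prod_(l <- Ls) linear_form l ^+ stabilizer_order G l.

(* A set of basic invariants x identifies M = Spec C[V]^G with C^n;
   below, elements of [mpoly n R[i]] are polynomials in u or in x. The
   coordinate x^1 has index [ord0], so n is a successor where x^1 is singled
   out. *)

Definition poly_eval (R : realType) (n : nat) (P : mpoly n R[i])
    (p : 'rV[R[i]]_n) : R[i] :=
  meval (fun a => p 0 a) P.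

(* The coefficient of (x^1)^k in P, as a polynomial in x^2, ..., x^n. *)
Definition coef_x1 (R : realType) (n' : nat) (k : nat)
    (P : mpoly n'.+1 R[i]) : mpoly n'.+1 R[i] :=
  \sum_(m <- msupp P | m ord0 == k)
     mcoeff m P *: mpolyX R[i] (mnm_sub m (mnm_muln (mnm1 ord0) k)).

Definition monic_in_x1 (R : realType) (n' : nat) (k : nat)
    (P : mpoly n'.+1 R[i]) : Prop :=
  (forall m, m \in msupp P -> (m ord0 <= k)%N) /\ coef_x1 k P = 1.

(* The matrix (d x^c / d u^i)_{c, i}. *)
Definition jacobian (R : realType) (n : nat) (x : n.-tuple (mpoly n R[i])) :
    'M[mpoly n R[i]]_n :=
  \matrix_(c, i) mderiv i (tnth x c).

(* - sum_{i,j} (du^i/dx^a) (du^j/dx^b) d^2 x^c / du^i du^j, in C(u). *)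
Definition Omega_V (R : realType) (n : nat) (x : n.-tuple (mpoly n R[i]))
    (a b c : 'I_n) : {fraction (mpoly n R[i])} :=
  let dudx := invmx (map_mx (@tofrac _) (jacobian x)) in
  - \sum_i \sum_j
      dudx i a * dudx j b * tofrac (mderiv i (mderiv j (tnth x c))).

(* The element of C(x) whose image under the inclusion C(x) -> C(u) is
   [Omega_V]. *)
Definition Omega (R : realType) (n : nat) (x : n.-tuple (mpoly n R[i]))
    (a b c : 'I_n) : {fraction (mpoly n R[i])} :=
  xget 0 [set F | exists P Q : mpoly n R[i],
    [/\ comp_mpoly x Q != 0, F = tofrac P / tofrac Q
      & tofrac (comp_mpoly x P) / tofrac (comp_mpoly x Q)
        = Omega_V x a b c]].

Definition Delta_Omega (R : realType) (n : nat) (x : n.-tuple (mpoly n R[i]))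
    (Delta : mpoly n R[i]) (a b c : 'I_n) : mpoly n R[i] :=
  xget 0 [set P | tofrac P = tofrac Delta * Omega x a b c].

Definition Gamma_poly (R : realType) (n' : nat)
    (x : n'.+1.-tuple (mpoly n'.+1 R[i])) (Delta : mpoly n'.+1 R[i])
    (a b c : 'I_n'.+1) : mpoly n'.+1 R[i] :=
  coef_x1 n'.+1 (Delta_Omega x Delta a b c).

Definition Omega_mx (R : realType) (n : nat) (x : n.-tuple (mpoly n R[i]))
    (a : 'I_n) : 'M[{fraction (mpoly n R[i])}]_n :=
  \matrix_(c, b) Omega x a b c.

Definition Gamma_mx (R : realType) (n' : nat)
    (x : n'.+1.-tuple (mpoly n'.+1 R[i])) (Delta : mpoly n'.+1 R[i])
    (a : 'I_n'.+1) : 'M[{fraction (mpoly n'.+1 R[i])}]_n'.+1 :=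
  \matrix_(c, b) tofrac (Gamma_poly x Delta a b c).

(* The polynomial C_{ab}^c: the (c, b) entry of
   Omega_1^-1 (Omega_a - Gamma_a). *)
Definition C_poly (R : realType) (n' : nat)
    (x : n'.+1.-tuple (mpoly n'.+1 R[i])) (Delta : mpoly n'.+1 R[i])
    (a b c : 'I_n'.+1) : mpoly n'.+1 R[i] :=
  xget 0 [set P | tofrac P =
    (invmx (Omega_mx x ord0) *m (Omega_mx x a - Gamma_mx x Delta a)) c b].

Definition poly_coefs (R : realType) (n : nat)
    (K : 'I_n -> 'I_n -> 'I_n -> mpoly n R[i]) : coefs R n :=
  fun a b c => poly_eval (K a b c).

(* The value at p of a rational function which is regular at p. *)
Definition frac_eval (R : realType) (n : nat)
    (F : {fraction (mpoly n R[i])}) (p : 'rV[R[i]]_n) : R[i] :=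
  xget 0 [set z | exists P Q : mpoly n R[i],
    [/\ poly_eval Q p != 0, F = tofrac P / tofrac Q
      & z = poly_eval P p / poly_eval Q p]].

Definition natural_conn (R : realType) (n : nat)
    (x : n.-tuple (mpoly n R[i])) : coefs R n :=
  fun a b c => frac_eval (Omega x a b c).

(* M_0, the complement of the discriminant. *)
Definition M0 (R : realType) (n : nat) (Delta : mpoly n R[i]) :
    set 'rV[R[i]]_n :=
  [set p | poly_eval Delta p != 0].

(* (1/d_1) E_deg. *)
Definition Euler_field (R : realType) (n' : nat) (d : 'I_n'.+1 -> nat) :
    vfield R n'.+1 :=
  fun p => \row_a ((d a)%:R / (d ord0)%:R * p 0 a).

(* e is a polynomial vector field on M, of degree k for the grading
   deg x^a = d a: the coefficient of d/dx^c has degree d c + k. *)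
Definition poly_field_of_degree (R : realType) (n : nat) (d : 'I_n -> nat)
    (k : int) (e : vfield R n) : Prop :=
  exists eps : 'I_n -> mpoly n R[i],
    (forall p, e p = \row_c poly_eval (eps c) p) /\
    (forall c m, m \in msupp (eps c) ->
       (\sum_a d a * m a)%N%:Z = (d c)%:Z + k).

Definition natural_almost_saito (R : realType) (n' : nat)
    (x : n'.+1.-tuple (mpoly n'.+1 R[i])) (d : 'I_n'.+1 -> nat)
    (Delta : mpoly n'.+1 R[i]) (Gam S : coefs R n'.+1)
    (e : vfield R n'.+1) : Prop :=
  [/\ almost_saito_structure (M0 Delta) (d ord0)%:R^-1 Gam S
        (@Euler_field R n' d) e,
      forall a b c p, M0 Delta p -> Gam a b c p = natural_conn x a b c p
    & poly_field_of_degree d (- (d ord0)%:Z) e].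

(* For coordinates t on M given as polynomials T in x, the field
   d/dt^c in the basis of the d/dx^a. *)
Definition coord_field_of (R : realType) (n : nat)
    (T : n.-tuple (mpoly n R[i])) (c : 'I_n) : vfield R n :=
  fun p => (col c (invmx (map_mx (fun P => poly_eval P p) (jacobian T))))^T.

Definition flat_coordinates (R : realType) (n : nat) (Gam : coefs R n)
    (T : n.-tuple (mpoly n R[i])) : Prop :=
  (forall p, map_mx (fun P => poly_eval P p) (jacobian T) \in unitmx) /\
  (forall a b p,
     nabla Gam (coord_field_of T a) (coord_field_of T b) p = 0).

Definition polynomial_mult (R : realType) (n : nat) (K : coefs R n)
    (T : n.-tuple (mpoly n R[i])) : Prop :=
  exists A : 'I_n -> 'I_n -> 'I_n -> mpoly n R[i], forall a b p,
    mult K (coord_field_of T a) (coord_field_of T b) p =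
    \sum_c poly_eval (A a b c) (\row_j poly_eval (tnth T j) p)
             *: coord_field_of T c p.

Definition polynomial_saito_structure (R : realType) (n : nat)
    (G : {fset 'M[R[i]]_n}) (x : n.-tuple (mpoly n R[i]))
    (Gam K : coefs R n) (e E : vfield R n) : Prop :=
  saito_structure setT Gam K e E /\
  exists T : n.-tuple (mpoly n R[i]),
    [/\ basic_invariants G [tuple comp_mpoly x (tnth T a) | a < n],
        flat_coordinates Gam T
      & polynomial_mult K T].

(* Main.v *)
(** Since the averaged hermitian form makes G unitary, each reflection hyperplane l = 0
    has a cyclic stabilizer of some order e, and differentiating invariants shows that
    the vectors Omega_{ab} have, along l = 0, only a pole of order e whose coefficient is
    a multiple of one fixed vector. Hence Delta Omega is polynomial in x, and so is
    Delta times any determinant of n vectors Omega_{ab} + (polynomial).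

    Flatness of nabla^V, the identity nabla^V_x E_deg = x and homogeneity are then
    polynomial identities, whose leading coefficients in x_1 show that Gamma_1 = 0 and that
    N = r - nabla E is, up to weights, triangular with diagonal entries (1 - d_a) / d_1;
    its determinant is thus a nonzero constant. Cramer's rule and the
    determinant bound make C_a = Omega_1^-1 (Omega_a - Gamma_a) polynomial and free of
    x_1. With U = E*, one has Omega_1 U = N and det U = Delta.
    As Gamma, C, N do not involve x_1 while U = x_1 + (terms free of x_1), comparing
    powers of x_1 in the flatness of nabla^V yields flatness of nabla, [U, C_a] = 0,
    [C_a, C_b] = 0 and the symmetry of nabla C, which are the Saito axioms.

    The flat connection nabla has weight-homogeneous polynomial coefficients, so the
    homogeneous Poincare lemma gives flat coordinates t^a = x^a + (terms in x^b with
    d_b < d_a); this triangular change of variables is polynomially invertible. *)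

Require Import Defs.
From HB Require Import structures.
From mathcomp Require Import all_boot all_order all_algebra.
From mathcomp Require Import perm finmap complex.
From mathcomp Require Import all_classical all_reals all_analysis.
From mathcomp Require Import ring lra zify.
From mathcomp Require mpoly.
Import -(notations) mpoly.
Set Implicit Arguments.
Unset Strict Implicit.
Unset Printing Implicit Defensive.
Import Order.TTheory GRing.Theory Num.Theory.
Import numFieldNormedType.Exports.
Local Open Scope ring_scope.

(** The obstacle is that a determinant of n columns Omega_{ab} has a priori a pole of order n along
    Delta, so Cramer's rule alone would give C_a only up to powers of Delta. With polar parts
    proportional to one vector, the polar matrix is a perturbation of rank one and a single Delta
    clears the determinant, whatever columns are chosen. For the columns Omega_{0b} a degree count
    in x_0 shows that the determinant is exactly a nonzero constant over Delta; numerator and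
    denominator in Cramer's rule then have the same pole.

    Identities are kept polynomial: the unknowns are [P a b c], that is Delta Omega_{ab}^c, and a
    relation between them is pulled back to u. This is injective because the Jacobian determinant of
    x is nonzero, and there Omega becomes minus the Hessian of x^c.

    Two determinants have to be nonzero: that of N, where d_a > 1 enters, and that of 1 - N, with
    diagonal entries (d_0 + d_a - 1) / d_0, from which the commutation of U and C_a follows. Indices
    start at 0, so x_0 is the distinguished variable x^1. *)

Notation "''x_' i" := (mpolyX _ (mnm1 i)) (at level 8, i at level 2, format "''x_' i") : ring_scope.

(** * Chain rule, linear substitutions, divisibility by a linear form *)

Lemma mpoly_ring_ind (K : nzRingType) (n : nat) (P : mpoly n K -> Prop) :
  (forall c, P (mpolyC n c)) -> (forall i, P 'x_i) ->
  (forall p q, P p -> P q -> P (p + q)) -> (forall p q, P p -> P q -> P (p * q)) ->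
  forall p, P p.
Proof.
move=> hC hX hD hmul; apply: mpolyind; first by rewrite -mpolyC0.
move=> c m p _ _ hp; apply: hD => //.
rewrite -mul_mpolyC; apply (hmul) => //.
rewrite mpolyXE_id; apply: (big_ind P) => [|p1 q1|i _]; first exact: hC.
  exact: hmul.
by elim: (m i) => [|k IH]; [exact: hC | rewrite exprS; apply: hmul].
Qed.

Lemma mderivX1 (K : nzRingType) (n : nat) (i j : 'I_n) :
  mderiv i ('x_j : mpoly n K) = (i == j)%:R.
Proof.
rewrite mderivX mnm1E eq_sym; case: eqP => [->|_]; last by rewrite scale0r.
rewrite scale1r [mnm_sub _ _](_ : _ = @mnm0 n) ?mpolyX0 //.
by apply/mnmP => k; rewrite mnmBE mnm0E subnn.
Qed.

Lemma comp_mpolyXi (K : nzRingType) (n k : nat) (x : n.-tuple (mpoly k K)) i :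
  comp_mpoly x 'x_i = tnth x i.
Proof. by rewrite comp_mpolyXU -tnth_nth. Qed.

Lemma mderiv_comp (K : comNzRingType) (n k : nat) (x : n.-tuple (mpoly k K)) i Q :
  mderiv i (comp_mpoly x Q) = \sum_a comp_mpoly x (mderiv a Q) * mderiv i (tnth x a).
Proof.
elim/mpoly_ring_ind: Q => [c|j|p q hp hq|p q hp hq].
- rewrite comp_mpolyC mderivC big1 // => a _.
  by rewrite mderivC comp_mpoly0 mul0r.
- rewrite comp_mpolyXi (bigD1 j) //= big1 ?addr0.
    by rewrite mderivX1 eqxx comp_mpoly1 mul1r.
  by move=> a /negPf ne; rewrite mderivX1 ne comp_mpoly0 mul0r.
- rewrite comp_mpolyD mderivD hp hq -big_split /=.
  by apply: eq_bigr => a _; rewrite mderivD comp_mpolyD mulrDl.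
- rewrite rmorphM /= mderivM hp hq mulr_suml mulr_sumr -big_split /=.
  apply: eq_bigr => a _; rewrite mderivM rmorphD !rmorphM /=; ring.
Qed.

Lemma comp_mpoly_comp (K : comNzRingType) (n k l : nat) (x : n.-tuple (mpoly k K))
    (y : k.-tuple (mpoly l K)) Q :
  comp_mpoly y (comp_mpoly x Q) = comp_mpoly [tuple comp_mpoly y (tnth x a) | a < n] Q.
Proof.
elim/mpoly_ring_ind: Q => [c|j|p q hp hq|p q hp hq].
- by rewrite !comp_mpolyC.
- by rewrite !comp_mpolyXi tnth_mktuple.
- by rewrite !comp_mpolyD hp hq.
- by rewrite !rmorphM /= hp hq.
Qed.

(** Over any ring; over R[i] it unfolds to [linear_form], as [grp_invariant] below does to
    [G_invariant]. *)
Definition lin (K : nzRingType) (n : nat) (l : 'rV[K]_n) : mpoly n K :=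
  \sum_j l 0 j *: 'x_j.

Definition act (K : nzRingType) (n : nat) (g : 'M[K]_n) (f : mpoly n K) : mpoly n K :=
  comp_mpoly [tuple lin (row i g) | i < n] f.

Section Act.
Variables (K : idomainType) (n : nat).
Implicit Types (g h : 'M[K]_n) (l : 'rV[K]_n) (v : 'cV[K]_n) (f : mpoly n K).

Lemma lin_is_linear : linear (@lin K n).
Proof.
move=> a l l'; rewrite /lin scaler_sumr -big_split /=; apply: eq_bigr => j _.
by rewrite !mxE scalerDl scalerA.
Qed.
HB.instance Definition _ := GRing.isLinear.Build K 'rV[K]_n (mpoly n K) _ (@lin K n) lin_is_linear.

HB.instance Definition _ g := GRing.RMorphism.copy (act g) (comp_mpoly [tuple lin (row i g) | i < n]).

Lemma actD g : {morph act g : f f' / f + f'}. Proof. exact: rmorphD. Qed.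
Lemma actM g : {morph act g : f f' / f * f'}. Proof. exact: rmorphM. Qed.
Lemma actZ g c f : act g (c *: f) = c *: act g f. Proof. exact: comp_mpolyZ. Qed.
Lemma actX g i : act g 'x_i = lin (row i g).
Proof. by rewrite /act comp_mpolyXi tnth_mktuple. Qed.
Lemma actC g c : act g (mpolyC n c) = mpolyC n c. Proof. exact: comp_mpolyC. Qed.

Lemma act_lin g l : act g (lin l) = lin (l *m g).
Proof.
rewrite /act {1}/lin linear_sum /=.
rewrite mulmx_sum_row linear_sum /=; apply: eq_bigr => j _.
by rewrite comp_mpolyZ comp_mpolyXi tnth_mktuple linearZ.
Qed.

Lemma act_act g h f : act g (act h f) = act (h *m g) f.
Proof.
rewrite {1}/act comp_mpoly_comp /act; congr comp_mpoly; apply: eq_from_tnth => i.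
by rewrite !tnth_mktuple -/(act g _) act_lin row_mul.
Qed.

Lemma act1 f : act 1%:M f = f.
Proof.
rewrite -[RHS]comp_mpoly_id /act; congr comp_mpoly; apply: eq_from_tnth => i.
rewrite !tnth_mktuple row1 /lin (bigD1 i) //= big1 ?addr0 => [|j /negPf ne].
  by rewrite mxE !eqxx scale1r.
by rewrite mxE ne andbF scale0r.
Qed.

Lemma lin_eq0 l : (lin l == 0) = (l == 0).
Proof.
apply/eqP/eqP => [|->]; last by rewrite linear0.
move=> h; apply/rowP => i; rewrite mxE.
have /(congr1 (mcoeff (mnm1 i))) := h.
rewrite /lin linear_sum /= mcoeff0 (bigD1 i) //= big1 ?addr0 => [|j ne].
  by rewrite mcoeffZ mcoeffXU eqxx mulr1.
by rewrite mcoeffZ mcoeffXU (negPf ne) mulr0.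
Qed.

Lemma mderiv_lin i l : mderiv i (lin l) = mpolyC n (l 0 i).
Proof.
rewrite /lin linear_sum /= (bigD1 i) //= big1 ?addr0 => [|j ne].
  by rewrite mderivZ mderivX1 eqxx -mul_mpolyC mulr1.
by rewrite mderivZ mderivX1 eq_sym (negPf ne) scaler0.
Qed.

Definition dderiv v f : mpoly n K := \sum_i v i 0 *: mderiv i f.

Lemma dderiv_act g v f : dderiv v (act g f) = act g (dderiv (g *m v) f).
Proof.
rewrite /dderiv [RHS]linear_sum /=.
under eq_bigr => i _ do rewrite mderiv_comp scaler_sumr.
rewrite exchange_big /=; apply: eq_bigr => a _.
rewrite /act [RHS]comp_mpolyZ mxE scaler_suml; apply: eq_bigr => i _.
rewrite tnth_mktuple mderiv_lin mxE mulrC mul_mpolyC scalerA.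
by rewrite mulrC.
Qed.

Definition ldvd l f := exists f', f = lin l * f'.

(** The substitution u |-> u + w l(u) is the identity on the hyperplane l = 0, so it changes f by a
    multiple of l; the cofactor is built along the ring operations. *)
Lemma ldvd_sub_act l (w : 'cV[K]_n) f : ldvd l (f - act (1%:M + w *m l) f).
Proof.
elim/mpoly_ring_ind: f => [c|i|p q [p' hp] [q' hq]|p q [p' hp] [q' hq]].
- by exists 0; rewrite actC subrr mulr0.
- exists (mpolyC n (- w i 0)); rewrite actX linearD /= row1 row_mul linearD /=.
  rewrite (_ : lin (delta_mx 0 i) = 'x_i) ?opprD ?addrA ?subrr ?add0r; last first.
    rewrite -[RHS](act1 'x_i) actX row1 //.
  rewrite (_ : row i w *m l = w i 0 *: l); last first.
    by apply/rowP => j; rewrite !mxE big_ord1 !mxE.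
  by rewrite linearZ /= mulrC mul_mpolyC scaleNr.
- exists (p' + q'); rewrite actD opprD addrACA hp hq; ring.
- exists (p * q' + p' * act (1%:M + w *m l) q); rewrite actM.
  rewrite (_ : p * q - _ = p * (q - act (1%:M + w *m l) q) + (p - act (1%:M + w *m l) p) * act (1%:M + w *m l) q); last by ring.
  rewrite hp hq; ring.
Qed.

Lemma ldvdP l v f : l *m v = 1%:M -> ldvd l f <-> act (1%:M - v *m l) f = 0.
Proof.
move=> lv; split => [[f' ->]|h].
  by rewrite actM act_lin mulmxBr mulmxA lv mulmx1 mul1mx subrr linear0 mul0r.
have := ldvd_sub_act l (- v) f.
by rewrite mulNmx h subr0.
Qed.

Lemma ldvdM l v f f' : l *m v = 1%:M -> ldvd l (f * f') -> ldvd l f \/ ldvd l f'.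
Proof.
move=> lv; rewrite !(ldvdP _ lv) actM => /eqP; rewrite mulf_eq0.
by case/orP => /eqP; [left|right].
Qed.

Lemma ldvd_lin l v l' : l *m v = 1%:M -> ldvd l (lin l') -> l' = (l' *m v) *m l.
Proof.
move=> lv; rewrite (ldvdP _ lv) act_lin => /eqP; rewrite lin_eq0.
by rewrite mulmxBr mulmx1 subr_eq0 -mulmxA => /eqP.
Qed.

End Act.

(** * Fractions regular along a hyperplane, and an integrality criterion *)

Section LocalRing.
Variables (K : fieldType) (n : nat) (F : fieldType).
Variable iota : {rmorphism mpoly n K -> F}.
Hypothesis iota_inj : injective iota.
Variable l : 'rV[K]_n.
Hypothesis l_neq0 : l != 0.
Implicit Types (z : F).

Lemma ex_dual_vec : exists v : 'cV[K]_n, l *m v = 1%:M.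
Proof.
case/rV0Pn: l_neq0 => i hi; exists ((l 0 i)^-1 *: delta_mx i 0).
rewrite -scalemxAr -[l *m _]trmxK trmx_mul trmx_delta -rowE.
by apply/matrixP => a b; rewrite !mxE !ord1 eqxx mulVf.
Qed.

Lemma ldvd_prime f f' : ldvd l (f * f') -> ldvd l f \/ ldvd l f'.
Proof. by case: ex_dual_vec => v lv; apply: ldvdM lv. Qed.

Lemma ldvd1 : ~ ldvd l 1.
Proof.
case: ex_dual_vec => v lv; rewrite (ldvdP _ lv) /act rmorph1 => /eqP.
by rewrite oner_eq0.
Qed.

Lemma ldvd_neq0 f : ~ ldvd l f -> f != 0.
Proof. by move=> h; apply/eqP => f0; apply: h; exists 0; rewrite f0 mulr0. Qed.

Lemma iota_eq0 f : (iota f == 0) = (f == 0).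
Proof. by rewrite -(inj_eq iota_inj) rmorph0. Qed.

(* [z] has no pole along [l = 0] *)
Definition reg z := exists a b, ~ ldvd l b /\ z = iota a / iota b.

Lemma reg_iota f : reg (iota f).
Proof. by exists f, 1; split; [exact: ldvd1 | rewrite rmorph1 divr1]. Qed.

Lemma iota_ldvd f : ~ ldvd l f -> iota f != 0 .
Proof. by move=> h; rewrite iota_eq0; apply: ldvd_neq0. Qed.

Lemma regD z z' : reg z -> reg z' -> reg (z + z').
Proof.
move=> [a [b [hb ->]]] [c [d [hd ->]]]; exists (a * d + c * b), (b * d); split.
  by move/ldvd_prime => [].
by rewrite rmorphD !rmorphM addf_div ?iota_ldvd.
Qed.

Lemma regM z z' : reg z -> reg z' -> reg (z * z').
Proof.
move=> [a [b [hb ->]]] [c [d [hd ->]]]; exists (a * c), (b * d); split.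
  by move/ldvd_prime => [].
by rewrite !rmorphM mulf_div.
Qed.

Lemma reg0 : reg 0. Proof. by rewrite -(rmorph0 iota); apply: reg_iota. Qed.
Lemma reg1 : reg 1. Proof. by rewrite -(rmorph1 iota); apply: reg_iota. Qed.
Lemma regN z : reg z -> reg (- z).
Proof. by move=> hz; rewrite -mulN1r -(rmorph1 iota) -rmorphN; apply: regM => //; apply: reg_iota. Qed.
Lemma regB z z' : reg z -> reg z' -> reg (z - z').
Proof. by move=> hz hz'; apply: regD => //; apply: regN. Qed.

Lemma reg_sum (I : finType) (f : I -> F) : (forall i, reg (f i)) -> reg (\sum_i f i).
Proof. by move=> h; apply: (big_ind reg) => // [|*]; [exact: reg0 | exact: regD]. Qed.

Lemma reg_prod (I : finType) (f : I -> F) : (forall i, reg (f i)) -> reg (\prod_i f i).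
Proof. by move=> h; apply: (big_ind reg) => // [|*]; [exact: reg1 | exact: regM]. Qed.

Lemma reg_det m (A : 'M[F]_m) : (forall i j, reg (A i j)) -> reg (\det A).
Proof.
move=> h; apply: reg_sum => s; apply: regM; last exact: reg_prod.
by rewrite -signr_odd; case: (odd _); rewrite ?expr0 ?expr1; [apply: regN|]; exact: reg1.
Qed.

(** If z = a / b and z l = f, then a l = f b; the prime l does not divide b, so it divides f and
    cancels. *)
Lemma reg_div_lin z : reg z -> (exists f, z * iota (lin l) = iota f) -> exists f, z = iota f.
Proof.
move=> [a [b [hb ->]]] [f hf].
have bn := iota_ldvd hb.
have ln : iota (lin l) != 0  by rewrite iota_eq0 lin_eq0.
have : a * lin l = f * b.
  by apply: iota_inj; rewrite !rmorphM -hf mulrAC divfK.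
move=> e; have /ldvd_prime [[q qe]|//] : ldvd l (f * b) by exists a; rewrite -e mulrC.
exists q; rewrite qe in e.
have e' : a = q * b.
  have l0 : lin l != 0 by rewrite lin_eq0.
  by apply: (mulfI l0); rewrite mulrC e mulrA.
by rewrite e' rmorphM mulfK.
Qed.
End LocalRing.

(** The linear factors of the denominator are removed one by one. Integrality below is always
    obtained in this way: an explicit denominator made of linear forms, then a local study along
    each hyperplane. *)
Lemma integral_of_reg (K F : fieldType) n (iota : {rmorphism mpoly n K -> F}) (z : F) (s : seq 'rV[K]_n) :
  injective iota ->
  all (fun l => l != 0) s -> (exists f, z * iota (\prod_(l <- s) lin l) = iota f) ->
  (forall l, l != 0 -> reg iota l z) -> exists f, z = iota f.
Proof.
move=> ii; elim: s => [_ [f hf] _|l s IH /= /andP[l0 s0] [f hf] hz].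
  by exists f; rewrite -hf big_nil rmorph1 mulr1.
apply: IH => //; apply: (reg_div_lin ii l0).
  apply: regM => //; [exact: hz | exact: reg_iota].
by exists f; rewrite -hf big_cons -!mulrA -rmorphM [lin l * _]mulrC.
Qed.

Lemma mxBE (R : zmodType) m k (A B : 'M[R]_(m, k)) i j : (A - B) i j = A i j - B i j.
Proof. by rewrite !mxE. Qed.

Lemma mxDE (R : nmodType) m k (A B : 'M[R]_(m, k)) i j : (A + B) i j = A i j + B i j.
Proof. by rewrite mxE. Qed.

Lemma mxNE (R : zmodType) m k (A : 'M[R]_(m, k)) i j : (- A) i j = - A i j.
Proof. by rewrite mxE. Qed.

Lemma mxZE (R : pzRingType) m k (x : R) (A : 'M[R]_(m, k)) i j : (x *: A) i j = x * A i j.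
Proof. by rewrite mxE. Qed.

Lemma mx0E (R : nmodType) m k i j : (0 : 'M[R]_(m, k)) i j = 0.
Proof. by rewrite mxE. Qed.

(** Noncommutative identities are proved as linear ones: [mx_expandE] expands products into
    monomials, [mx_entryE] passes to one entry, and [ring] treats the entries of the monomials as
    atoms. *)
Definition mx_entryE := (mxBE, mxDE, mxNE, mxZE, mx0E).

Definition mx_expandE := (mulmxDl, mulmxDr, mulmxBl, mulmxBr, mulNmx, mulmxN, mul1mx, mulmx1,
  mul0mx, mulmx0, mulmxA).

Lemma map_poly_MXaddC (R S : nzRingType) (f : {additive R -> S}) (p : {poly R}) c :
  map_poly f (p * 'X + c%:P) = map_poly f p * 'X + (f c)%:P.
Proof.
apply/polyP => -[|k]; rewrite coef_map !coefD !coefMX !coefC /= ?add0r ?addr0 //.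
by rewrite coef_map.
Qed.

Lemma derivation_horner (A : comNzRingType) (D : {additive A -> A})
    (D_M : forall a b, D (a * b) = D a * b + a * D b) (p : {poly A}) a :
  D p.[a] = (map_poly D p).[a] + p^`().[a] * D a.
Proof.
elim/poly_ind: p => [|p c IH].
  by rewrite horner0 raddf0 map_poly0 deriv0 !horner0 mul0r addr0.
rewrite map_poly_MXaddC derivMXaddC !hornerMXaddC hornerD hornerMX.
by rewrite raddfD D_M IH; ring.
Qed.

(** * Reflection groups and poles along hyperplanes *)

Section Group.
Variables (K : numClosedFieldType) (n : nat) (G : seq 'M[K]_n).
Hypotheses (G_uniq : uniq G) (G1 : 1%:M \in G)
  (GM : forall g h, g \in G -> h \in G -> g *m h \in G)
  (GU : forall g, g \in G -> g \in unitmx)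
  (GV : forall g, g \in G -> invmx g \in G).
Implicit Types (l : 'rV[K]_n) (g : 'M[K]_n) (v w u : 'cV[K]_n).

Lemma perm_mulG g : g \in G -> perm_eq [seq g *m h | h <- G] G.
Proof.
move=> gG; apply: uniq_perm => // [|h].
  by rewrite map_inj_uniq // => a b /(congr1 (mulmx (invmx g))); rewrite !mulKmx ?GU.
apply/mapP/idP => [[k kG ->]|hG]; first exact: GM.
by exists (invmx g *m h); [apply: GM => //; apply: GV | rewrite mulKVmx ?GU].
Qed.

Definition orb (f : 'rV[K]_n) : seq 'rV[K]_n := undup [seq f *m g | g <- G].

Lemma orbP f h : reflect (exists2 g, g \in G & h = f *m g) (h \in orb f).
Proof. by rewrite mem_undup; apply: mapP. Qed.

Lemma orb_id f : f \in orb f.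
Proof. by apply/orbP; exists 1%:M; rewrite ?mulmx1. Qed.

Lemma perm_orb f g : g \in G -> perm_eq [seq h *m g | h <- orb f] (orb f).
Proof.
move=> gG; apply: uniq_perm; rewrite ?undup_uniq //.
  rewrite map_inj_uniq ?undup_uniq // => a b /(congr1 (mulmx^~ (invmx g))).
  by rewrite !mulmxK ?GU.
move=> h; apply/mapP/orbP => [[k /orbP[g' g'G ->] ->]|[g' g'G ->]].
  by exists (g' *m g); rewrite ?mulmxA // GM.
exists (f *m (g' *m invmx g)); last by rewrite -!mulmxA mulVmx ?GU // mulmx1.
by apply/orbP; exists (g' *m invmx g); rewrite // GM // GV.
Qed.

(** The derivative, at its root f, of the polynomial whose roots are the orbit of f; it is nonzero
    because the orbit is listed without repetition. *)
Definition orb_diff (f : 'rV[K]_n) : mpoly n K := \prod_(h <- orb f | h != f) lin (f - h).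

Lemma orb_diff_neq0 f : orb_diff f != 0.
Proof.
rewrite /orb_diff prodf_seq_neq0; apply/allP => h _; apply/implyP => ne.
by rewrite lin_eq0 subr_eq0 eq_sym.
Qed.

Definition grp_invariant (f : mpoly n K) := forall g, g \in G -> act g f = f.

Variable x : n.-tuple (mpoly n K).
Hypothesis x_inv : forall a, grp_invariant (tnth x a).
Hypothesis x_gen : forall f, grp_invariant f -> exists P, f = comp_mpoly x P.

(* Differentiate the G-invariant polynomial with roots the orbit of [f] at its root [f]. *)
Lemma orb_diff_jac f : exists B : 'I_n -> mpoly n K,
  forall i, orb_diff f * mpolyC n (f 0 i) = \sum_a B a * mderiv i (tnth x a).
Proof.
pose p : {poly mpoly n K} := \prod_(h <- orb f) ('X - (lin h)%:P).
have pE : p = ('X - (lin f)%:P) * \prod_(h <- orb f | h != f) ('X - (lin h)%:P).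
  by rewrite /p (bigD1_seq f) ?orb_id ?undup_uniq.
have p0 : p.[lin f] = 0 by rewrite pE !hornerE subrr mul0r.
have p1 : p^`().[lin f] = orb_diff f.
  rewrite pE derivM !hornerE subrr mul0r addr0 derivXsubC !hornerE horner_prod.
  by apply: eq_bigr => h _; rewrite !hornerE linearB.
have inv k : grp_invariant p`_k.
  move=> g gG; rewrite -coef_map /= /p rmorph_prod /=.
  rewrite -[in RHS](perm_big _ (perm_orb f gG)) /= big_map.
  apply: (congr1 (fun q : {poly mpoly n K} => q`_k)); apply: eq_bigr => h _.
  by rewrite rmorphB /= map_polyX map_polyC /= act_lin.
have [P hP] := fin_all_exists (fun k : 'I_(size p) => x_gen (inv k)).
exists (fun a => - \sum_(k < size p) comp_mpoly x (mderiv a (P k)) * lin f ^+ k) => i.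
have := derivation_horner (@mderivM _ _ i) p (lin f).
rewrite /= p0 mderiv0 p1 mderiv_lin => /esym/eqP; rewrite addrC addr_eq0 => /eqP ->.
rewrite (@horner_coef_wide _ (size p)) ?size_poly // -sumrN.
under [RHS]eq_bigr => a _ do rewrite mulNr mulr_suml -sumrN.
rewrite exchange_big /=; apply: eq_bigr => k _.
rewrite coef_map_id0 ?mderiv0 // hP mderiv_comp sumrN mulr_suml; congr (- _).
by apply: eq_bigr => a _; rewrite mulrAC.
Qed.

Definition jac : 'M[mpoly n K]_n := \matrix_(c, i) mderiv i (tnth x c).

(** For f running through the coordinate forms, [orb_diff_jac] exhibits a diagonal matrix with
    nonzero entries as a multiple of the Jacobian matrix. *)
Lemma jac_det_neq0 : \det jac != 0.
Proof.
have [B hB] := fin_all_exists (fun i : 'I_n => orb_diff_jac (delta_mx 0 i)).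
have E : (\matrix_(i, a) B i a) *m jac = diag_mx (\row_i orb_diff (delta_mx 0 i)).
  apply/matrixP => i j; rewrite !mxE.
  under eq_bigr => a _ do rewrite !mxE.
  rewrite -hB !mxE eqxx /= eq_sym; case: eqP => [->|_]; rewrite ?mulr1n ?mulr0n /=.
    by rewrite mpolyC1 mulr1.
  by rewrite mpolyC0 mulr0.
apply/eqP => d0; have := congr1 determinant E.
rewrite det_mulmx d0 mulr0 det_diag => /esym/eqP; apply/negP.
by apply/prodf_neq0 => i _; rewrite mxE orb_diff_neq0.
Qed.

Lemma mderiv_eq0_const (Q : mpoly n K) : (forall a, mderiv a Q = 0) -> exists c, Q = mpolyC n c.
Proof.
move=> h; exists (mcoeff (@mnm0 n) Q); apply/mpolyP => m; rewrite mcoeffC.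
case: (eqVneq m (@mnm0 n)) => [->|ne]; first by rewrite mulr1.
have [i mi] : exists i, m i != 0%N.
  apply/existsP; apply: contraR ne => /existsPn h0; apply/eqP/mnmP => i.
  by rewrite mnm0E; apply/eqP; have := h0 i; rewrite negbK.
have /(congr1 (mcoeff (mnm_sub m (mnm1 i)))) := h i.
rewrite mcoeff0 mcoeff_deriv submK ?lep1mP // => /eqP.
by rewrite mulrn_eq0 /= => /eqP ->; rewrite mulr0.
Qed.

Lemma msize_mderiv (Q : mpoly n K) i k :
  (mmeasure mdeg Q <= k.+1)%N -> (mmeasure mdeg (mderiv i Q) <= k)%N.
Proof.
move=> hQ; rewrite msizeE; apply/bigmax_leqP_seq => m hm _.
have mQ : mnm_add m (mnm1 i) \in msupp Q.
  move: hm; rewrite !mcoeff_msupp mcoeff_deriv; apply: contraNneq => ->.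
  by rewrite mul0rn.
have := leq_trans (msize_mdeg_lt mQ) hQ.
by rewrite mdegD mdeg1 addn1.
Qed.

Lemma row_mul_jac_eq0 (r : 'I_n -> mpoly n K) :
  (forall i, \sum_a r a * mderiv i (tnth x a) = 0) -> forall a, r a = 0.
Proof.
move=> h a; pose R := \row_a r a.
have e : R *m jac = 0.
  by apply/rowP => i; rewrite !mxE -[RHS](h i); apply: eq_bigr => b _; rewrite !mxE.
have /(congr1 (mulmx^~ (\adj jac))) := e.
rewrite -mulmxA mul_mx_adj mul0mx mul_mx_scalar => /rowP /(_ a).
rewrite !mxE => /eqP; rewrite mulf_eq0 => /orP[|/eqP //].
by rewrite (negPf jac_det_neq0).
Qed.

(** Jacobian criterion: a relation Q(x) = 0 differentiates to sum_a (d_a Q)(x) d_i x^a = 0, so every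
    d_a Q is a relation of lower degree. By induction they vanish, so Q is constant, hence 0. *)
Lemma comp_mpoly_inj : injective (comp_mpoly x).
Proof.
suff H k : forall Q, (mmeasure mdeg Q <= k)%N -> comp_mpoly x Q = 0 -> Q = 0.
  move=> P Q e; apply/eqP; rewrite -subr_eq0; apply/eqP; apply: H (leqnn _) _.
  by rewrite comp_mpolyB e subrr.
elim: k => [|k IH] Q hQ h0.
  by apply/eqP; rewrite -msize_poly_eq0 -leqn0.
have [c hc] : exists c, Q = mpolyC n c.
  apply: mderiv_eq0_const => a; apply: IH; first exact: msize_mderiv.
  apply: (row_mul_jac_eq0 (r := fun a => comp_mpoly x (mderiv a Q))) => i.
  by rewrite -mderiv_comp h0 mderiv0.
by move: h0; rewrite hc comp_mpolyC.
Qed.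

Lemma comp_mpoly_invariant P : grp_invariant (comp_mpoly x P).
Proof.
move=> g gG; rewrite /act comp_mpoly_comp; congr comp_mpoly; apply: eq_from_tnth => a.
by rewrite tnth_mktuple; apply: x_inv.
Qed.

Definition conjT (l : 'rV[K]_n) : 'cV[K]_n := \col_i (l 0 i)^*.

(** [l' *m hvec l] is the averaged hermitian product of l' and l, the sum over g of <l' g, l g>;
    [hvec_mulG] expresses its invariance. *)
Definition hvec (l : 'rV[K]_n) : 'cV[K]_n := \sum_(g <- G) g *m conjT (l *m g).

Lemma hvec_mulG l g : g \in G -> g *m hvec (l *m g) = hvec l.
Proof.
move=> gG; rewrite /hvec mulmx_sumr -[RHS](perm_big _ (perm_mulG gG)) /= big_map.
by apply: eq_bigr => h _; rewrite !mulmxA.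
Qed.

Lemma hvecD l l' : hvec (l + l') = hvec l + hvec l'.
Proof.
rewrite /hvec -big_split /=; apply: eq_bigr => g _.
rewrite mulmxDl -mulmxDr; congr (_ *m _); apply/colP => i.
by rewrite !mxE rmorphD.
Qed.

Lemma hvecZ c l : hvec (c *: l) = Num.conj c *: hvec l.
Proof.
rewrite /hvec scaler_sumr; apply: eq_bigr => g _.
rewrite -scalemxAl [RHS]scalemxAr; congr (_ *m _); apply/colP => i.
by rewrite !mxE rmorphM.
Qed.

Lemma row_mul_conj (l l' : 'rV[K]_n) :
  (l *m conjT l') 0 0 = Num.conj ((l' *m conjT l) 0 0).
Proof.
rewrite !mxE rmorph_sum /=; apply: eq_bigr => i _.
by rewrite !mxE rmorphM /= conjCK mulrC.
Qed.

Lemma hvec_herm l l' : (l *m hvec l') 0 0 = Num.conj ((l' *m hvec l) 0 0).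
Proof.
rewrite /hvec !mulmx_sumr !summxE rmorph_sum; apply: eq_bigr => g _.
by rewrite !mulmxA row_mul_conj.
Qed.

Lemma hvec_gt0 l : l != 0 -> 0 < (l *m hvec l) 0 0.
Proof.
move=> l0; have ge0 (r : 'rV[K]_n) : 0 <= (r *m conjT r) 0 0.
  by rewrite mxE; apply: sumr_ge0 => i _; rewrite !mxE mul_conjC_ge0.
rewrite /hvec mulmx_sumr summxE (bigD1_seq _ G1 G_uniq) /= !mul1mx mulmx1.
apply: ltr_wpDr.
  by apply: sumr_ge0 => g _; rewrite mulmxA.
rewrite lt_neqAle ge0 andbT eq_sym; case/rV0Pn: l0 => i li.
rewrite mxE psumr_neq0 => [|j _]; last by rewrite !mxE mul_conjC_ge0.
by apply/hasP; exists i; rewrite ?mem_index_enum // !mxE /= mul_conjC_gt0.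
Qed.

Definition dvec l : 'cV[K]_n := ((l *m hvec l) 0 0)^-1 *: hvec l.

Lemma mul_dvec l : l != 0 -> l *m dvec l = 1%:M.
Proof.
move=> l0; rewrite /dvec -scalemxAr; have := hvec_gt0 l0.
have := mx11_scalar (l *m hvec l); set c := _ 0 0 => -> c0.
by rewrite scale_scalar_mx mulVf // gt_eqF.
Qed.

Lemma orth_dvec l (f : 'rV[K]_n) : l != 0 -> f *m dvec l = 0 -> f *m hvec l = 0.
Proof.
move=> l0 /eqP; rewrite /dvec -scalemxAr scaler_eq0 invr_eq0 gt_eqF ?hvec_gt0 //=.
by move/eqP.
Qed.

(* [g] is unitary for the averaged hermitian form, for which [dvec l] spans the
   orthogonal complement of [ker l]; hence f and f + c l have equal norms. *)
Lemma unitary_shift l (f : 'rV[K]_n) g c : l != 0 -> g \in G -> f *m dvec l = 0 -> f *m g = f + c *: l -> c = 0.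
Proof.
move=> l0 gG /(orth_dvec l0) fl fg.
have lf : (l *m hvec f) 0 0 = 0 by rewrite hvec_herm fl mxE conjC0.
have : (f *m hvec f) 0 0 = ((f *m g) *m hvec (f *m g)) 0 0.
  by rewrite -mulmxA hvec_mulG.
have E d : ((f + c *: l) *m (hvec f + d *: hvec l)) 0 0 = (f *m hvec f) 0 0
    + d * (f *m hvec l) 0 0 + c * (l *m hvec f) 0 0 + c * d * (l *m hvec l) 0 0.
  rewrite mulmxDl !mulmxDr -!scalemxAr -!scalemxAl.
  move: (f *m _) (f *m _) (l *m _) (l *m _) => A B C D.
  by rewrite !mxE; ring.
have z0 : (0 : 'M[K]_1) 0 0 = 0 by rewrite mxE.
rewrite fg hvecD hvecZ E lf fl z0 !mulr0 !addr0 => /esym/eqP.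
rewrite -subr_eq0 addrAC subrr add0r.
rewrite !mulf_eq0 conjC_eq0 (gt_eqF (hvec_gt0 l0)) orbF orbb.
by move/eqP.
Qed.

(** For l nonzero the second factor is a projection onto l = 0, so this decidable condition says
    that g fixes the hyperplane pointwise ([stabP]). *)
Definition stab l : seq 'M[K]_n :=
  [seq g <- G | (g - 1%:M) *m (1%:M - dvec l *m l) == 0].

Section Stab.
Variable l : 'rV[K]_n.
Hypothesis l0 : l != 0.
Let v := dvec l.
Let lv : l *m v = 1%:M := mul_dvec l0.
Let pr := 1%:M - v *m l.

Lemma pr_v : pr *m v = 0.
Proof. by rewrite mulmxBl mul1mx -mulmxA lv mulmx1 subrr. Qed.
Lemma l_pr : l *m pr = 0.
Proof. by rewrite mulmxBr mulmx1 mulmxA lv mul1mx subrr. Qed.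
Lemma pr_l_eq0 (f : 'rV[K]_n) : f *m pr = 0 -> f = (f *m v) 0 0 *: l.
Proof.
rewrite mulmxBr mulmx1 mulmxA; have := mx11_scalar (f *m v); set c := _ 0 0 => ->.
by rewrite mul_scalar_mx => /subr0_eq.
Qed.
Lemma pr_v_id (f : 'rV[K]_n) : f *m v = 0 -> f *m pr = f.
Proof. by move=> fv; rewrite mulmxBr mulmx1 mulmxA fv mul0mx subr0. Qed.

Lemma stabP g : reflect (g \in G /\ forall u : 'cV[K]_n, l *m u = 0 -> g *m u = u) (g \in stab l).
Proof.
rewrite mem_filter; apply: (iffP andP) => [[/eqP h gG]|[gG h]]; split => //.
  move=> u lu; have : (g - 1%:M) *m (1%:M - v *m l) *m u = 0 by rewrite h mul0mx.
  have e : (1%:M - v *m l) *m u = u by rewrite mulmxBl mul1mx -mulmxA lu mulmx0 subr0.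
  by rewrite -mulmxA e mulmxBl mul1mx => /subr0_eq.
apply/eqP/matrixP => i j.
have := h (col j pr); rewrite !colE !mulmxA l_pr mul0mx => /(_ erefl) e.
rewrite mulmxBl mul1mx; have := congr1 (fun M : 'cV_n => M i 0) e.
by rewrite -!colE mxE [RHS]mxE => h1; rewrite [LHS]mxE h1 !mxE subrr.
Qed.

(** An element of the stabilizer changes a form by a multiple of l, and unitarity makes this
    multiple vanish when f(v) = 0. Hence g preserves the splitting of V into l = 0 and the line of
    v. *)
Lemma stab_fix g (f : 'rV[K]_n) : g \in stab l -> f *m v = 0 -> f *m g = f.
Proof.
rewrite mem_filter => /andP[/eqP h gG] fv.
have e : f *m (g - 1%:M) = (f *m (g - 1%:M) *m v) 0 0 *: l.
  by apply: pr_l_eq0; rewrite -mulmxA h mulmx0.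
have fg : f *m g = f + (f *m (g - 1%:M) *m v) 0 0 *: l.
  by rewrite -e mulmxBr mulmx1 addrC subrK.
by rewrite fg (unitary_shift l0 gG fv fg) scale0r addr0.
Qed.

(** The eigenvalue of g on v and on l ([stab_v], [l_stab]); by [stabE] it determines g in the
    stabilizer. *)
Definition chi g : K := (l *m g *m v) 0 0.

Lemma pr_stab g : g \in stab l -> pr *m g = pr.
Proof.
move=> gs; apply/row_matrixP => i; rewrite row_mul stab_fix //.
by rewrite -row_mul pr_v row0.
Qed.

Lemma stab_pr g : g \in stab l -> g *m pr = pr.
Proof.
by rewrite mem_filter => /andP[/eqP + _]; rewrite mulmxBl mul1mx => /subr0_eq.
Qed.

Lemma stab_v g : g \in stab l -> g *m v = chi g *: v.
Proof.
move=> gs; have : pr *m g *m v = 0 by rewrite pr_stab // pr_v.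
rewrite mulmxBl mul1mx mulmxBl => /subr0_eq ->; rewrite -!mulmxA [l *m _]mx11_scalar.
by rewrite mulmxA mul_mx_scalar.
Qed.

Lemma l_stab g : g \in stab l -> l *m g = chi g *: l.
Proof. by move=> gs; apply: pr_l_eq0; rewrite -mulmxA stab_pr // l_pr. Qed.

Lemma stabE g : g \in stab l -> g = pr + chi g *: (v *m l).
Proof.
move=> gs; rewrite -{1}(mulmx1 g) -[X in g *m X](subrK (v *m l)) mulmxDr stab_pr //.
by rewrite mulmxA stab_v // scalemxAl.
Qed.

Lemma chi_inj : {in stab l &, injective chi}.
Proof. by move=> g h gs hs e; rewrite (stabE gs) (stabE hs) e. Qed.

Lemma stab_uniq : uniq (stab l). Proof. exact: filter_uniq. Qed.

Lemma stab1 : 1%:M \in stab l.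
Proof. by rewrite mem_filter G1 subrr mul0mx eqxx. Qed.

(** Otherwise the values of [chi], pairwise distinct, would all be k-th roots of unity, and there
    are more than k of them. Cyclicity of the stabilizer enters only in this form. *)
Lemma chi_expn_neq1 k : (0 < k < size (stab l))%N -> exists2 g, g \in stab l & chi g ^+ k != 1.
Proof.
move=> /andP[k0 ks]; apply/hasP; apply: contraTT ks => /hasPn h; rewrite -leqNgt.
have -> : size (stab l) = size (map chi (stab l)) by rewrite size_map.
apply: max_unity_roots => //.
  apply/allP => _ /mapP[g gs ->]; rewrite unity_rootE.
  by have := h g gs; rewrite negbK.
by rewrite map_inj_in_uniq ?stab_uniq //; apply: chi_inj.
Qed.

(** On l = 0 the hypothesis reads chi(g)^k f = f, and some chi(g)^k differs from 1, so f vanishes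
    there. The quotient f / l satisfies the hypothesis for k + 1, and the division is repeated until
    k reaches the order of the stabilizer. *)
Lemma skew_ldvd k f : (0 < k)%N -> (forall g, g \in stab l -> chi g ^+ k *: act g f = f) ->
  exists f', f = lin l ^+ (size (stab l) - k) * f'.
Proof.
move e: (size _ - k)%N => j; elim: j k e f => [|j IH] k e f k0 h.
  by exists f; rewrite expr0 mul1r.
have [g gs ne] : exists2 g, g \in stab l & chi g ^+ k != 1.
  by apply: chi_expn_neq1; rewrite k0 /=; lia.
have [f' fE] : ldvd l f.
  apply/(ldvdP _ lv); have := congr1 (act pr) (h g gs).
  rewrite actZ act_act stab_pr // => /eqP.
  rewrite -subr_eq0 -{2}[act pr f]scale1r -scalerBl mscalerI subr_eq0 (negPf ne) /=.
  by move/eqP.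
have ln : lin l != 0 by rewrite lin_eq0.
have [f'' f''E] : exists f'' : mpoly n K, f' = lin l ^+ j * f''.
  apply: (IH k.+1) => //; first by lia.
  move=> g' g's; apply: (mulfI ln); rewrite -fE -[RHS](h g' g's) fE actM act_lin l_stab //.
  by rewrite linearZ /= -!scalerAr -!scalerAl scalerA exprSr.
by exists f''; rewrite fE f''E exprS mulrA.
Qed.
End Stab.

(** The row lies on the moment curve (1, s, s^2, ...): each w gives a nonzero polynomial in s, and s
    avoids the roots of their product. *)
Lemma generic_row (ws : seq 'cV[K]_n) : all (fun w => w != 0) ws ->
  exists f : 'rV[K]_n, all (fun w => (f *m w) 0 0 != 0) ws.
Proof.
move=> h; pose q (w : 'cV[K]_n) : {poly K} := \poly_(i < n) (if insub i is Some j then w j 0 else 0).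
have qE (w : 'cV[K]_n) s : (q w).[s] = ((\row_i s ^+ (val i)) *m w) 0 0.
  rewrite horner_poly mxE; apply: eq_bigr => i _.
  by rewrite valK mxE mulrC.
have q0 (w : 'cV[K]_n) : w != 0 -> q w != 0.
  case/cV0Pn => i wi; apply: contraNneq wi => /polyP /(_ i).
  by rewrite coef_poly ltn_ord valK coef0 => ->.
have Q0 : \prod_(w <- ws) q w != 0.
  by rewrite prodf_seq_neq0; apply/allP => w /(allP h); apply: q0.
have [s] := closed_nonrootP _ Q0.
rewrite /root horner_prod prodf_seq_neq0 => /allP hs.
by exists (\row_i s ^+ (val i)); apply/allP => w ww; rewrite -qE; apply: hs.
Qed.

(** * Poles of the connection along a hyperplane *)

Section Poles.
Variables (F : fieldType) (iota : {rmorphism mpoly n K -> F}).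
Hypothesis ii : injective iota.

Definition Jinv : 'M[F]_n := invmx (map_mx iota jac).

Lemma jac_unit : map_mx iota jac \in unitmx.
Proof. by rewrite unitmxE unitfE det_map_mx iota_eq0 // jac_det_neq0. Qed.

(** [Jinv i a] is du^i/dx^a, so this is the derivative of the linear function f with respect to
    x^a. *)
Definition xi (f : 'rV[K]_n) a : F := \sum_i iota (mpolyC n (f 0 i)) * Jinv i a.

Lemma xiD f f' a : xi (f + f') a = xi f a + xi f' a.
Proof.
rewrite /xi -big_split /=; apply: eq_bigr => i _.
by rewrite !mxE mpolyCD rmorphD mulrDl.
Qed.

Lemma xiZ c f a : xi (c *: f) a = iota (mpolyC n c) * xi f a.
Proof.
rewrite /xi mulr_sumr; apply: eq_bigr => i _.
by rewrite !mxE mpolyCM rmorphM mulrA.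
Qed.

(** Multiplying [orb_diff_jac] by the inverse Jacobian matrix gives an explicit product of linear
    forms as a denominator. *)
Lemma xi_orb f : exists B : 'I_n -> mpoly n K, forall a, iota (orb_diff f) * xi f a = iota (B a).
Proof.
have [B hB] := orb_diff_jac f; exists B => a.
rewrite /xi mulr_sumr.
under eq_bigr => i _ do rewrite mulrA -rmorphM hB rmorph_sum mulr_suml /=.
rewrite exchange_big /=.
have E b : \sum_i iota (B b * mderiv i (tnth x b)) * Jinv i a = iota (B b) * (b == a)%:R.
  have := congr1 (fun M : 'M[_]_n => M b a) (mulmxV jac_unit); rewrite -/Jinv !mxE => <-.
  by rewrite mulr_sumr; apply: eq_bigr => i _; rewrite !mxE rmorphM mulrA.
under eq_bigr => b _ do rewrite E.
by rewrite (bigD1 a) //= eqxx mulr1 big1 ?addr0 // => b /negPf ->; rewrite mulr0.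
Qed.

Definition OmegaV a b c : F :=
  - \sum_i \sum_j Jinv i a * Jinv j b * iota (mderiv i (mderiv j (tnth x c))).

Section AtHyperplane.
Variable l : 'rV[K]_n.
Hypothesis l0 : l != 0.
Let v := dvec l.
Let lv : l *m v = 1%:M := mul_dvec l0.
Let pr := 1%:M - v *m l.
Let lpr : l *m pr = 0 := l_pr l0.
Let prv : pr *m v = 0 := pr_v l0.

Lemma prod_lin_val (s : seq 'rV[K]_n) : all (fun r => r != 0) s ->
  exists2 b, ~ ldvd l b & \prod_(r <- s) lin r = lin l ^+ count (fun r => r *m pr == 0) s * b.
Proof.
elim: s => [_|r s IH /= /andP[r0 /IH[b hb e]]].
  by exists 1; [exact: ldvd1 | rewrite big_nil expr0 mulr1].
rewrite big_cons e; case: eqP => [rp|rp]; last first.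
  exists (lin r * b); last by rewrite add0n mulrCA.
  case/ldvd_prime => // hl; apply: rp.
  have := congr1 (mulmx^~ pr) (ldvd_lin lv hl).
  by rewrite -[X in _ = X -> _]mulmxA lpr mulmx0.
exists (mpolyC n ((r *m v) 0 0) * b); last first.
  rewrite {1}(pr_l_eq0 rp) linearZ /= exprD expr1 -mul_mpolyC.
  by rewrite [X in X * _ = _]mulrC mulrACA.
case/ldvd_prime => //; rewrite (ldvdP _ lv) actC => /eqP; rewrite mpolyC_eq0 => /eqP c0.
by move: r0; rewrite (pr_l_eq0 rp) c0 scale0r eqxx.
Qed.

Lemma orb_diff_val f (m := count (fun h => (h != f) && ((f - h) *m pr == 0)) (orb f)) :
  exists2 b, ~ ldvd l b & orb_diff f = lin l ^+ m * b.
Proof.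
have [|b hb e] := @prod_lin_val [seq f - h | h <- orb f & h != f].
  by apply/allP => _ /mapP[h + ->]; rewrite mem_filter subr_eq0 eq_sym => /andP[].
exists b => //; rewrite /orb_diff -big_filter.
rewrite big_map in e; rewrite e count_map count_filter; congr (lin l ^+ _ * b).
by apply: eq_count => h /=; rewrite andbC.
Qed.

Lemma reg_of_mul b c z : ~ ldvd l b -> iota b * z = iota c -> reg iota l z.
Proof.
move=> hb e; exists c, b; split => //.
by rewrite -e mulrC mulKf // iota_eq0 // (ldvd_neq0 hb).
Qed.

(** If h = f g lies in the orbit and f - h is proportional to l, then h = f by [unitary_shift]; so
    no factor of [orb_diff f] is a multiple of l. *)
Lemma reg_xi_orth f a : f *m v = 0 -> reg iota l (xi f a).
Proof.
move=> fv; have [b hb e] := orb_diff_val f; have [B hB] := xi_orb f.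
apply: (reg_of_mul hb (c := B a)); rewrite -hB e.
rewrite (_ : count _ _ = 0%N) ?expr0 ?mul1r //; apply/eqP.
rewrite -leqn0 leqNgt -has_count; apply/hasPn => h /orbP[g gG ->].
rewrite negb_and negbK; case: eqP => //= fg; apply/negP => /eqP hp.
have e1 : f *m g = f + - ((f - f *m g) *m v) 0 0 *: l.
  by rewrite scaleNr -pr_l_eq0 // opprB addrC subrK.
by apply: fg; rewrite e1 (unitary_shift l0 gG fv e1) scale0r addr0.
Qed.

(** For f in general position, f - f g is proportional to l only for g in the stabilizer, so
    [orb_diff f] has order at most e - 1 along l = 0, e being the order of the stabilizer. The form
    l is a combination of f and [f *m pr], and the latter falls under [reg_xi_orth]. *)
Lemma reg_xi_dir a : reg iota l (iota (lin l) ^+ (size (stab l)).-1 * xi l a).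
Proof.
pose e := size (stab l).
(* The nonzero columns of (1 - g) pr: if f vanishes on none of them, (f - f g) pr = 0 forces (1 - g)
   pr = 0. Adding v to the list makes f(v) nonzero. *)
pose wit (g : 'M[K]_n) := [seq w <- [seq col j ((1%:M - g) *m pr) | j <- enum 'I_n] | w != 0].
pose ws := v :: flatten [seq wit g | g <- G].
have v0 : v != 0.
  by apply/eqP => v0; move/eqP: lv; rewrite v0 mulmx0 eq_sym oner_eq0.
have [|f /= /andP[fv /allP fws]] := @generic_row ws.
  rewrite /= v0; apply/allP => w /flattenP[_ /mapP[g _ ->]].
  by rewrite mem_filter => /andP[].
have f_stab g : g \in G -> (f - f *m g) *m pr = 0 -> g \in stab l.
  move=> gG h; rewrite mem_filter gG andbT -oppr_eq0 -mulNmx opprB.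
  suff cj j : col j ((1%:M - g) *m pr) = 0.
    by apply/eqP/matrixP => i j; have /colP/(_ i) := cj j; rewrite [in LHS]mxE => ->; rewrite !mxE.
  apply/eqP/negPn/negP => w0.
  have : col j ((1%:M - g) *m pr) \in flatten [seq wit g | g <- G].
    apply/flattenP; exists (wit g); first exact: map_f.
    rewrite mem_filter w0 /=; apply: (map_f (fun j => col j ((1%:M - g) *m pr))).
    by rewrite mem_enum.
  have e1 : f *m (1%:M - g) = f - f *m g by rewrite mulmxBr mulmx1.
  have e2 : f *m ((1%:M - g) *m pr) = 0 by rewrite mulmxA e1 h.
  by move/fws; rewrite colE mulmxA e2 mul0mx mxE eqxx.
have [b hb ob] := orb_diff_val f; set m := count _ _ in ob.
have me : (m <= e.-1)%N.
  rewrite /m -size_filter.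
  have -> : e.-1 = size [seq f *m g | g <- rem 1%:M (stab l)].
    by rewrite size_map size_rem ?stab1.
  apply: uniq_leq_size; first by rewrite filter_uniq // undup_uniq.
  move=> h; rewrite mem_filter => /andP[/andP[hf /eqP hp] /orbP[g gG hg]].
  apply/mapP; exists g => //; rewrite (rem_filter _ (stab_uniq l)) mem_filter /=.
  rewrite f_stab -?hg // andbT; apply: contraNneq hf => g1.
  by rewrite hg g1 mulmx1.
have [B hB] := xi_orb f.
have regf : reg iota l (iota (lin l) ^+ e.-1 * xi f a).
  apply: (reg_of_mul hb (c := lin l ^+ (e.-1 - m) * B a)).
  rewrite rmorphM -hB ob !rmorphM !rmorphXn /= -{1}(subnK me) exprD.
  by move: (iota b) (_ ^+ (e.-1 - m)) (_ ^+ m) (xi f a) => p q r t; ring.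
have regp : reg iota l (xi (f *m pr) a).
  by apply: reg_xi_orth; rewrite -mulmxA prv mulmx0.
have lE : l = ((f *m v) 0 0)^-1 *: (f + (- 1) *: (f *m pr)).
  rewrite scaleN1r mulmxBr mulmx1 opprB addrC subrK mulmxA.
  have := mx11_scalar (f *m v); move: fv; set c := _ 0 0 => c0 ->.
  by rewrite mul_scalar_mx scalerA mulVf // scale1r.
have -> : xi l a = iota (mpolyC n ((f *m v) 0 0)^-1)
    * (xi f a + iota (mpolyC n (-1)) * xi (f *m pr) a).
  by rewrite -xiZ -xiD -xiZ -lE.
rewrite mulrCA mulrDr.
apply: regM => //; first exact: reg_iota.
apply: regD => //; rewrite -rmorphXn.
apply: regM => //; first exact: reg_iota.
by apply: regM => //; exact: reg_iota.
Qed.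

Let e := size (stab l).

Lemma e_gt0 : (0 < e)%N.
Proof. by rewrite /e; case: (stab l) (stab1 l). Qed.

Lemma dderivZl a (w : 'cV[K]_n) f : dderiv (a *: w) f = a *: dderiv w f.
Proof. by rewrite /dderiv scaler_sumr; apply: eq_bigr => i _; rewrite !mxE scalerA. Qed.

Lemma dderivZr a (w : 'cV[K]_n) f : dderiv w (a *: f) = a *: dderiv w f.
Proof.
by rewrite /dderiv scaler_sumr; apply: eq_bigr => i _; rewrite mderivZ !scalerA mulrC.
Qed.

(** The vector v is an eigenvector of g, so a derivative along v raises the exponent of the
    character by one. *)
Lemma dderiv_skew g f k : g \in stab l -> chi l g ^+ k *: act g f = f ->
  chi l g ^+ k.+1 *: act g (dderiv v f) = dderiv v f.
Proof.
move=> gs h; rewrite -{2}h dderivZr dderiv_act stab_v // dderivZl actZ scalerA.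
by rewrite exprSr.
Qed.

(** The invariant x^c keeps exponent 0 after a derivative along w, which the stabilizer fixes, and
    gets exponent 1 from v; [skew_ldvd] applies with k = 1. *)
Lemma dderiv2_orth c (w : 'cV[K]_n) : l *m w = 0 ->
  exists h, dderiv v (dderiv w (tnth x c)) = lin l ^+ e.-1 * h.
Proof.
move=> lw; rewrite -subn1; apply: skew_ldvd => // g gs; apply: dderiv_skew => //.
have [gG gw] := elimT (stabP l0 g) gs.
by rewrite scale1r -{2}(x_inv c gG) dderiv_act gw.
Qed.

(** Two derivatives along v give exponent 2, hence divisibility by l^(e-2); the extra factor l on
    the left keeps the formula meaningful for e = 1. *)
Lemma dderiv2_dir c : exists y, lin l * dderiv v (dderiv v (tnth x c)) = lin l ^+ e.-1 * y.
Proof.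
have [|y ->] := skew_ldvd (k := 2) (f := dderiv v (dderiv v (tnth x c))) l0 isT.
  move=> g gs; do 2![apply: dderiv_skew => //]; rewrite scale1r.
  by case: (elimT (stabP l0 g) gs) => gG _; apply: x_inv.
rewrite -/e mulrA -exprS; case: e e_gt0 => [//|[|e'] _ /=].
  by exists (lin l * y); rewrite expr0 mul1r expr1.
by exists y; rewrite !subSS subn0.
Qed.

Let A a := xi l a.
Let Z a i := xi (row i pr) a.

Lemma xi_sum (I : finType) (f : I -> 'rV[K]_n) a : xi (\sum_i f i) a = \sum_i xi (f i) a.
Proof.
apply: (big_morph (xi^~ a)) => [f1 f2|]; first exact: xiD.
by rewrite -(scale0r (0 : 'rV[K]_n)) xiZ mpolyC0 rmorph0 mul0r.
Qed.

Lemma Jinv_split i a : Jinv i a = iota (mpolyC n (v i 0)) * A a + Z a i.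
Proof.
rewrite /A /Z -xiZ -xiD.
have -> : v i 0 *: l + row i pr = delta_mx 0 i.
  rewrite rowE mulmxBr mulmx1 mulmxA -rowE.
  have -> : row i v *m l = v i 0 *: l by apply/rowP => j; rewrite !mxE big_ord1 !mxE.
  by rewrite addrC subrK.
rewrite /xi (bigD1 i) //= big1 ?addr0 => [|j ne].
  by rewrite mxE !eqxx mpolyC1 rmorph1 mul1r.
by rewrite mxE (negPf ne) andbF mpolyC0 rmorph0 mul0r.
Qed.

Lemma Z_pr a i : Z a i = \sum_k iota (mpolyC n (pr i k)) * Z a k.
Proof.
rewrite /Z; have {1}-> : row i pr = \sum_k pr i k *: row k pr.
  have {1}<- : row i pr *m pr = row i pr by rewrite pr_v_id // -row_mul prv row0.
  by rewrite mulmx_sum_row; apply: eq_bigr => k _; rewrite mxE.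
by rewrite xi_sum; apply: eq_bigr => k _; rewrite xiZ.
Qed.

Lemma reg_Z a i : reg iota l (Z a i).
Proof. by apply: reg_xi_orth; rewrite -row_mul prv row0. Qed.

Lemma iota_dderiv2 (w w' : 'cV[K]_n) f : iota (dderiv w (dderiv w' f)) =
  \sum_i \sum_j iota (mpolyC n (w i 0)) * iota (mpolyC n (w' j 0)) * iota (mderiv i (mderiv j f)).
Proof.
rewrite /dderiv rmorph_sum; apply: eq_bigr => i _.
rewrite -mul_mpolyC rmorphM (raddf_sum (mderiv i)) /= rmorph_sum mulr_sumr.
by apply: eq_bigr => j _; rewrite mderivZ -mul_mpolyC /= rmorphM mulrA.
Qed.

(** Each du^i/dx^a splits as v_i A_a plus a part tangential to l = 0. Of the resulting terms, only
    the one with two normal factors can have a pole. *)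
Lemma OmegaV_split a b c (H := fun i j => iota (mderiv i (mderiv j (tnth x c)))) :
  OmegaV a b c = - (A a * A b * iota (dderiv v (dderiv v (tnth x c)))
    + \sum_k A a * Z b k * iota (dderiv v (dderiv (col k pr) (tnth x c)))
    + \sum_k A b * Z a k * iota (dderiv v (dderiv (col k pr) (tnth x c)))
    + \sum_i \sum_j Z a i * Z b j * H i j).
Proof.
pose V i := iota (mpolyC n (v i 0)).
have cross a' b' : \sum_k A a' * Z b' k * iota (dderiv v (dderiv (col k pr) (tnth x c)))
    = \sum_i \sum_j A a' * V i * Z b' j * H i j.
  under [RHS]eq_bigr => i _ do under eq_bigr => j _ do rewrite Z_pr mulr_sumr mulr_suml.
  transitivity (\sum_k \sum_i A a' * Z b' k * \sum_j V i * iota (mpolyC n (col k pr j 0)) * H i j).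
    by apply: eq_bigr => k _; rewrite iota_dderiv2 mulr_sumr.
  rewrite exchange_big /=; apply: eq_bigr => i _.
  under eq_bigr => k _ do rewrite mulr_sumr.
  rewrite exchange_big /=; apply: eq_bigr => j _; apply: eq_bigr => k _.
  rewrite /V /H [col k pr j 0]mxE.
  by move: (A a') (Z b' k) (iota _) (iota _) (iota _) => p q r s t; ring.
rewrite /OmegaV; congr (- _); rewrite !cross.
rewrite [X in _ + X + _](_ : _ = \sum_i \sum_j A b * V j * Z a i * H i j); last first.
  rewrite exchange_big /=; apply: eq_bigr => i _; apply: eq_bigr => j _.
  by rewrite /H mderiv_comm.
rewrite iota_dderiv2 mulr_sumr -!big_split /=; apply: eq_bigr => i _.
rewrite mulr_sumr -!big_split /=; apply: eq_bigr => j _.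
rewrite (Jinv_split i a) (Jinv_split j b) -/(V i) -/(V j) -/(H i j).
by move: (V i) (V j) (A a) (A b) (Z a i) (Z b j) (H i j) => p q r s t u w; ring.
Qed.

Lemma reg_A a : reg iota l (iota (lin l) ^+ e.-1 * A a).
Proof. exact: reg_xi_dir. Qed.

Lemma Lneq0 : iota (lin l) != 0.
Proof. by rewrite iota_eq0 // lin_eq0. Qed.

(* The polar parts of the vectors [Omega_{ab}] along [l = 0] are all multiples of one
   vector, so an n-rowed determinant of them has at most a simple pole in l^e. *)
Lemma OmegaV_polar : exists (y : 'I_n -> F) (s : 'I_n -> 'I_n -> F),
  [/\ forall c, reg iota l (y c), forall a b, reg iota l (s a b)
    & forall a b c, reg iota l (OmegaV a b c - s a b * y c / iota (lin l) ^+ e)].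
Proof.
have [y hy] := fin_all_exists dderiv2_dir.
pose L := iota (lin l).
(* Orders along l = 0: 2 (e - 1) from the two factors A, minus e - 2 from the second derivative of
   x^c along v, leaves e. *)
pose s a b := (L ^+ e.-1 * A a) * (L ^+ e.-1 * A b).
exists (fun c => - iota (y c)), s; split => [c|a b|a b c].
- by apply: regN => //; apply: reg_iota.
- by apply: regM => //; apply: reg_A.
rewrite OmegaV_split.
have -> : s a b * - iota (y c) / L ^+ e = - (A a * A b * iota (dderiv v (dderiv v (tnth x c)))).
  have Le : L ^+ e = L * L ^+ e.-1 by rewrite -exprS prednK ?e_gt0.
  have hc : L * iota (dderiv v (dderiv v (tnth x c))) = L ^+ e.-1 * iota (y c).
    by rewrite -rmorphM hy rmorphM rmorphXn.
  rewrite mulrN mulNr; congr (- _); rewrite Le /s.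
  apply: (mulIf (x := L * L ^+ e.-1)); first by rewrite mulf_neq0 ?expf_neq0 ?Lneq0.
  rewrite divfK; last by rewrite mulf_neq0 ?expf_neq0 ?Lneq0.
  move: hc; move: (L ^+ e.-1) (iota (dderiv _ _)) (iota (y c)) (A a) (A b) => p q r t u hc.
  have -> : p * t * (p * u) * r = t * u * p * (p * r) by ring.
  by rewrite -hc; ring.
have cr a' b' : reg iota l (\sum_k A a' * Z b' k * iota (dderiv v (dderiv (col k pr) (tnth x c)))).
  apply: reg_sum => // k.
  have [|h ->] := @dderiv2_orth c (col k pr); first by rewrite colE mulmxA lpr mul0mx.
  rewrite rmorphM rmorphXn /= (_ : _ * _ = (L ^+ e.-1 * A a') * (Z b' k * iota h)).
    by apply: regM => //; [exact: reg_A | apply: regM => //; [exact: reg_Z | exact: reg_iota]].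
  by rewrite -/L; move: (L ^+ _) (A a') (Z b' k) (iota h) => p q r t; ring.
have rZ : reg iota l (\sum_i \sum_j Z a i * Z b j * iota (mderiv i (mderiv j (tnth x c)))).
  apply: reg_sum => // i; apply: reg_sum => // j; apply: regM => //; last exact: reg_iota.
  by apply: regM => //; exact: reg_Z.
move: (cr a b) (cr b a) rZ; move: (_ * _ * _) (\sum_k _) (\sum_k _) (\sum_i _) => p q r t hq hr ht.
rewrite opprK (_ : _ + _ = - (q + r + t)); last by ring.
by apply: regN => //; apply: regD => //; apply: regD.
Qed.

Lemma OmegaV_reg a b c : e = 1%N -> reg iota l (OmegaV a b c).
Proof.
move=> e1; have rJ i d : reg iota l (Jinv i d).
  rewrite Jinv_split; apply: regD => //; last exact: reg_Z.
  apply: regM => //; first exact: reg_iota.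
  by have := reg_A d; rewrite e1 expr0 mul1r.
apply: regN => //; apply: reg_sum => // i; apply: reg_sum => // j.
by apply: regM => //; [apply: regM | exact: reg_iota].
Qed.
End AtHyperplane.

Variable delta : mpoly n K.
Hypothesis delta_div : forall l, l != 0 -> (1 < size (stab l))%N ->
  exists q, delta = lin l ^+ size (stab l) * q.

(** All hyperplanes are treated uniformly: D = l^e when the stabilizer is nontrivial, and D = 1 with
    zero polar part when it is trivial. *)
Lemma OmegaV_local l : l != 0 -> exists (D q : mpoly n K) (y : 'I_n -> F) (s : 'I_n -> 'I_n -> F),
  [/\ delta = D * q, D != 0, forall c, reg iota l (y c), forall a b, reg iota l (s a b)
    & forall a b c, reg iota l (OmegaV a b c - s a b * y c / iota D)].
Proof.
move=> l0; case: (ltnP 1 (size (stab l))) => he.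
  have [q hq] := delta_div l0 he; have [y [s [hy hs h]]] := OmegaV_polar l0.
  exists (lin l ^+ size (stab l)), q, y, s; split => //.
    by rewrite expf_neq0 // lin_eq0.
  by move=> a b c; rewrite rmorphXn; apply: h.
have e1 : size (stab l) = 1%N by apply/eqP; rewrite eqn_leq he e_gt0.
exists 1, delta, (fun=> 0), (fun _ _ => 0); split; rewrite ?mul1r ?oner_neq0 //.
- by move=> _; exact: reg0.
- by move=> _ _; exact: reg0.
- by move=> a b c; rewrite !mul0r subr0; apply: OmegaV_reg.
Qed.
End Poles.

(** * Integrality of Delta Omega and of determinants, descent to invariants *)

Section Integrality.
Variables (F : fieldType) (iota : {rmorphism mpoly n K -> F}).
Hypothesis ii : injective iota.
Variable delta : mpoly n K.
Hypothesis delta_div : forall l, l != 0 -> (1 < size (stab l))%N ->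
  exists q, delta = lin l ^+ size (stab l) * q.
Local Notation OmegaV := (OmegaV iota).

Definition denom (L : mpoly n K) :=
  exists2 s : seq 'rV[K]_n, all (fun l => l != 0) s & L = \prod_(l <- s) lin l.

Lemma denomM L L' : denom L -> denom L' -> denom (L * L').
Proof.
move=> [s hs ->] [s' hs' ->]; exists (s ++ s'); first by rewrite all_cat hs.
by rewrite big_cat.
Qed.

Lemma denom1 : denom 1.
Proof. by exists [::]; rewrite ?big_nil. Qed.

Lemma denomX L k : denom L -> denom (L ^+ k).
Proof.
move=> hL; elim: k => [|k IH]; first by rewrite expr0; exact: denom1.
by rewrite exprS; apply: denomM.
Qed.

Lemma denom_orb_diff f : denom (orb_diff f).
Proof.
exists [seq f - h | h <- orb f & h != f]; last by rewrite big_map big_filter.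
by apply/allP => _ /mapP[h + ->]; rewrite mem_filter subr_eq0 eq_sym => /andP[].
Qed.

Lemma integral_of_denom z L : denom L -> (exists f, z * iota L = iota f) ->
  (forall l, l != 0 -> reg iota l z) -> exists f, z = iota f.
Proof. by move=> [s hs ->] h hz; apply: (integral_of_reg ii hs). Qed.

Lemma Jinv_denom : exists L (N : 'I_n -> 'I_n -> mpoly n K), denom L /\
  forall i a, Jinv iota i a * iota L = iota (N i a).
Proof.
have h (i : 'I_n) : exists B : 'I_n -> mpoly n K,
    forall a, iota (orb_diff (delta_mx 0 i)) * Jinv iota i a = iota (B a).
  have [B hB] := xi_orb ii (delta_mx 0 i); exists B => a; rewrite -hB; congr (_ * _).
  rewrite /xi (bigD1 i) //= big1 ?addr0 => [|j ne].
    by rewrite mxE !eqxx mpolyC1 rmorph1 mul1r.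
  by rewrite mxE (negPf ne) andbF mpolyC0 rmorph0 mul0r.
have [B hB] := fin_all_exists h.
exists (\prod_i orb_diff (delta_mx 0 i)),
  (fun i a => B i a * \prod_(j | j != i) orb_diff (delta_mx 0 j)); split.
  by apply: (big_ind denom) => [||i _]; [exact: denom1 | exact: denomM | exact: denom_orb_diff].
move=> i a; rewrite (bigD1 i) //= !rmorphM /= -hB.
by move: (Jinv _ _ _) (iota _) (iota _) => p q r; ring.
Qed.

Lemma OmegaV_denom : exists L (N : 'I_n -> 'I_n -> 'I_n -> mpoly n K), denom L /\
  forall a b c, OmegaV a b c * iota L = iota (N a b c).
Proof.
have [L [N [dL hN]]] := Jinv_denom.
exists (L * L), (fun a b c => - \sum_i \sum_j N i a * N j b * mderiv i (mderiv j (tnth x c))).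
split; first exact: denomM.
move=> a b c; rewrite /OmegaV mulNr rmorphN; congr (- _).
rewrite mulr_suml rmorph_sum; apply: eq_bigr => i _.
rewrite mulr_suml rmorph_sum; apply: eq_bigr => j _.
rewrite !rmorphM /= -!hN.
by move: (Jinv _ i a) (Jinv _ j b) (iota _) (iota _) => p q r t; ring.
Qed.

Lemma delta_OmegaV a b c : exists f, iota delta * OmegaV a b c = iota f.
Proof.
have [L [N [dL hN]]] := OmegaV_denom.
apply: (integral_of_denom dL); first by exists (delta * N a b c); rewrite -mulrA hN rmorphM.
move=> l l0; have [D [q [y [s [dE D0 hy hs h]]]]] := OmegaV_local ii delta_div l0.
rewrite -[OmegaV a b c](subrK (s a b * y c / iota D)) mulrDr; apply: regD => //.
  by apply: regM => //; exact: reg_iota.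
rewrite (_ : _ * _ = iota q * (s a b * y c)); last first.
  have D0' : iota D != 0 by rewrite iota_eq0.
  by rewrite dE rmorphM /=; move: (iota D) D0' (iota q) (s a b) (y c) => p p0 r z w; field.
by apply: regM => //; [exact: reg_iota | apply: regM].
Qed.

(** Schur complement: the bordered matrix involves no inverse of D, so its determinant is regular as
    soon as D, N, y and s are. *)
Lemma det_rank_one m (N : 'M[F]_m) (y : 'cV[F]_m) (s : 'rV[F]_m) (D : F) : D != 0 ->
  D * \det (N + D^-1 *: (y *m s)) = \det (block_mx (D%:M : 'M[F]_1) (- s) y N).
Proof.
move=> D0; have -> : block_mx (D%:M : 'M[F]_1) (- s) y N =
    block_mx 1%:M 0 (D^-1 *: y) 1%:M *m block_mx D%:M (- s) 0 (N + D^-1 *: (y *m s)).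
  rewrite mulmx_block !mul1mx !mul0mx !addr0 mul_mx_scalar scalerA mulfV // scale1r.
  by rewrite mulmxN -scalemxAl addrC addrK.
by rewrite det_mulmx det_lblock det_ublock !det1 !mul1r det_scalar1.
Qed.

(** Along l = 0 the matrix is a regular one plus y s / D, whatever the columns; [det_rank_one] asks
    for one factor D, which [delta] provides. The polynomials q make room for columns of Omega_a -
    Gamma_a. *)
Lemma delta_det_OmegaV (al be : 'I_n -> 'I_n) (q : 'I_n -> 'I_n -> mpoly n K) :
  exists f, iota delta * \det (\matrix_(c, j) (OmegaV (al j) (be j) c - iota (q c j))) = iota f.
Proof.
set M := \matrix_(c, j) _.
have [L [N [dL hN]]] := OmegaV_denom.
apply: (integral_of_denom (denomX n dL)).
  exists (delta * \det (\matrix_(c, j) (N (al j) (be j) c - q c j * L))).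
  rewrite -mulrA rmorphM rmorphXn /= [X in _ * X]mulrC -detZ -det_map_mx; congr (_ * \det _).
  by apply/matrixP => i j; rewrite !mxE rmorphB rmorphM -hN /=; ring.
move=> l l0; have [D [p [y [s [dE D0 hy hs h]]]]] := OmegaV_local ii delta_div l0.
have D0' : iota D != 0 by rewrite iota_eq0.
pose N1 : 'M[F]_n := \matrix_(c, j) (OmegaV (al j) (be j) c - s (al j) (be j) * y c / iota D - iota (q c j)).
have -> : M = N1 + (iota D)^-1 *: ((\col_c y c) *m (\row_j s (al j) (be j))).
  apply/matrixP => c j; rewrite !mxE big_ord1 !mxE.
  by move: (OmegaV _ _ _) (s _ _) (y c) (iota D)^-1 (iota _) => *; ring.
rewrite dE rmorphM [iota D * _]mulrC -mulrA det_rank_one //.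
apply: regM => //; first exact: reg_iota.
apply: reg_det => // i j; rewrite mxE; case: splitP => k _; rewrite mxE; case: splitP => k' _.
- rewrite !mxE; case: (_ == _); rewrite ?mulr1n ?mulr0n; [exact: reg_iota | exact: reg0].
- by rewrite !mxE; apply: regN.
- by rewrite !mxE.
- by rewrite !mxE; apply: regB => //; exact: reg_iota.
Qed.

(** The definition multiplied twice by the Jacobian matrix of x. Symmetry, weights, flatness and the
    Euler identity of Delta Omega are all derived from this form. *)
Lemma OmegaV_rel i j c : \sum_a \sum_b iota (mderiv i (tnth x a)) * iota (mderiv j (tnth x b)) * OmegaV a b c
  = - iota (mderiv i (mderiv j (tnth x c))).
Proof.
have E k p : \sum_a iota (mderiv k (tnth x a)) * Jinv iota p a = (p == k)%:R.
  have := congr1 (fun M : 'M[_]_n => M p k) (mulVmx (jac_unit ii)).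
  rewrite -/(Jinv iota) !mxE => <-; apply: eq_bigr => a _.
  by rewrite !mxE mulrC.
pose H p q := iota (mderiv p (mderiv q (tnth x c))).
transitivity (- \sum_p \sum_q (p == i)%:R * (q == j)%:R * H p q).
  under [in RHS]eq_bigr => p _ do under eq_bigr => q _ do rewrite -(E i p) -(E j q).
  rewrite -sumrN.
  transitivity (\sum_a \sum_b \sum_p \sum_q - (iota (mderiv i (tnth x a)) * Jinv iota p a *
     (iota (mderiv j (tnth x b)) * Jinv iota q b) * H p q)).
    apply: eq_bigr => a _; apply: eq_bigr => b _.
    rewrite /OmegaV mulrN mulr_sumr -sumrN; apply: eq_bigr => p _.
    rewrite mulr_sumr -sumrN; apply: eq_bigr => q _; congr (- _); rewrite -/(H p q).
    by move: (iota _) (iota _) (Jinv _ _ _) (Jinv _ _ _) (H p q) => *; ring.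
  under eq_bigr => a _ do (rewrite exchange_big /=; under eq_bigr => p _ do rewrite exchange_big).
  rewrite exchange_big /=; apply: eq_bigr => p _.
  rewrite -sumrN exchange_big /=; apply: eq_bigr => q _.
  rewrite big_distrlr /= mulr_suml -sumrN; apply: eq_bigr => a _.
  by rewrite mulr_suml -sumrN.
congr (- _); rewrite (bigD1 i) //= [X in _ + X]big1 ?addr0 => [|p /negPf ne]; last first.
  by rewrite big1 // => q _; rewrite ne !mul0r.
rewrite (bigD1 j) //= [X in _ + X]big1 ?addr0 => [|q /negPf ne]; last first.
  by rewrite ne mulr0 mul0r.
by rewrite !eqxx !mul1r.
Qed.
End Integrality.

Lemma hess_uniq (h : 'I_n -> 'I_n -> mpoly n K) :
  (forall i j, \sum_a \sum_b mderiv i (tnth x a) * mderiv j (tnth x b) * h a b = 0) ->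
  forall a b, h a b = 0.
Proof.
move=> H a b; apply: (row_mul_jac_eq0 (r := h a)) => j; move: a.
apply: (row_mul_jac_eq0 (r := fun a => \sum_b h a b * mderiv j (tnth x b))) => i.
rewrite -[RHS](H i j); apply: eq_bigr => a _; rewrite mulr_suml; apply: eq_bigr => b' _.
by ring.
Qed.

Lemma mderiv_act_sum g f i : mderiv i (act g f) = \sum_k mpolyC n (g k i) * act g (mderiv k f).
Proof.
rewrite mderiv_comp; apply: eq_bigr => k _.
by rewrite tnth_mktuple mderiv_lin mxE mulrC.
Qed.

(** The Hessian of the invariant x^c and the products of Jacobian entries transform under g in the
    same way, so g f solves the same linear system as f; [hess_uniq] gives uniqueness. *)
Lemma hess_invariant (delta : mpoly n K) (f : 'I_n -> 'I_n -> mpoly n K) c : grp_invariant delta ->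
  (forall i j, \sum_a \sum_b mderiv i (tnth x a) * mderiv j (tnth x b) * f a b
     = - (delta * mderiv i (mderiv j (tnth x c)))) ->
  forall a b, grp_invariant (f a b).
Proof.
move=> dinv H a b g gG; apply/eqP; rewrite -subr_eq0; apply/eqP.
apply: (hess_uniq (h := fun a b => act g (f a b) - f a b)) => i j.
transitivity (\sum_a \sum_b mderiv i (tnth x a) * mderiv j (tnth x b) * act g (f a b)
  - \sum_a \sum_b mderiv i (tnth x a) * mderiv j (tnth x b) * f a b).
  rewrite -sumrB; apply: eq_bigr => a' _; rewrite -sumrB; apply: eq_bigr => b' _.
  by rewrite mulrBr.
rewrite H; apply/eqP; rewrite subr_eq0; apply/eqP.
transitivity (\sum_p \sum_q mpolyC n (g p i) * mpolyC n (g q j) *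
   act g (\sum_a \sum_b mderiv p (tnth x a) * mderiv q (tnth x b) * f a b)).
  transitivity (\sum_a \sum_b \sum_p \sum_q mpolyC n (g p i) * mpolyC n (g q j) *
     (act g (mderiv p (tnth x a)) * act g (mderiv q (tnth x b)) * act g (f a b))).
    apply: eq_bigr => a' _; apply: eq_bigr => b' _.
    rewrite -{1}(x_inv a' gG) -{1}(x_inv b' gG) !mderiv_act_sum big_distrlr /= mulr_suml.
    apply: eq_bigr => p _; rewrite mulr_suml; apply: eq_bigr => q _.
    by move: (mpolyC _ _) (mpolyC _ _) (act _ _) (act _ _) (act _ _) => *; ring.
  under eq_bigr => a' _ do (rewrite exchange_big /=; under eq_bigr => p _ do rewrite exchange_big).
  rewrite exchange_big /=; apply: eq_bigr => p _.
  rewrite exchange_big /=; apply: eq_bigr => q _.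
  rewrite (rmorph_sum (act g)) mulr_sumr /=; apply: eq_bigr => a' _.
  rewrite [in RHS](rmorph_sum (act g)) mulr_sumr /=; apply: eq_bigr => b' _.
  by rewrite !actM.
transitivity (- (delta * \sum_p \sum_q mpolyC n (g p i) * mpolyC n (g q j) *
   act g (mderiv p (mderiv q (tnth x c))))).
  rewrite mulr_sumr -sumrN; apply: eq_bigr => p _; rewrite mulr_sumr -sumrN; apply: eq_bigr => q _.
  by rewrite H rmorphN /= actM (dinv g gG); ring.
congr (- (_ * _)); rewrite -{2}(x_inv c gG) mderiv_comm mderiv_act_sum.
rewrite (raddf_sum (mderiv j)); apply: eq_bigr => p _.
rewrite /= mderivM mderivC mul0r add0r mderiv_act_sum mulr_sumr; apply: eq_bigr => q _.
by rewrite mulrA mderiv_comm.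
Qed.

(** As a quotient of invariants q is invariant, hence a polynomial in x. *)
Lemma descent P D q : D != 0 -> comp_mpoly x P = q * comp_mpoly x D -> exists Q, P = Q * D.
Proof.
move=> D0 e; have cD : comp_mpoly x D != 0.
  by apply/eqP => h; move/eqP: D0; apply; apply: comp_mpoly_inj; rewrite h comp_mpoly0.
have [Q hQ] : exists Q, q = comp_mpoly x Q.
  apply: x_gen => g gG; apply: (mulIf cD).
  by rewrite -{1}(comp_mpoly_invariant D gG) -actM -e comp_mpoly_invariant.
by exists Q; apply: comp_mpoly_inj; rewrite rmorphM /= -hQ.
Qed.
End Group.

Opaque mpoly_mul mpoly_add mpoly_opp mpoly_scale mpolyX mderiv comp_mpoly map_poly.

(** * The distinguished variable x_0 *)

Section MainVariable.
Variables (K : numFieldType) (n' : nat).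
Local Notation n := n'.+1.
Local Notation Pol := (mpoly n K).

Definition psi_var (a : 'I_n) : {poly Pol} := if a == ord0 then 'X else ('x_a)%:P.
(* [psi] rewrites a polynomial as a polynomial in [x_0]; its coefficients stay in [Pol],
   not involving [x_0], so that they can be compared with the original ones. *)
Definition psi : Pol -> {poly Pol} := mmap (polyC \o @mpolyC n K) psi_var.
HB.instance Definition _ := GRing.RMorphism.copy psi (mmap (polyC \o @mpolyC n K) psi_var).

Lemma psiD f g : psi (f + g) = psi f + psi g. Proof. exact: rmorphD. Qed.
Lemma psiM f g : psi (f * g) = psi f * psi g. Proof. exact: rmorphM. Qed.
Lemma psi0 : psi 0 = 0. Proof. exact: rmorph0. Qed.
Lemma psiB f g : psi (f - g) = psi f - psi g. Proof. exact: rmorphB. Qed.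
Lemma psi_sum (I : finType) (f : I -> Pol) : psi (\sum_i f i) = \sum_i psi (f i).
Proof. exact: rmorph_sum. Qed.
Lemma psiC c : psi (mpolyC n c) = (mpolyC n c)%:P.
Proof. by rewrite /psi mmapC. Qed.

Lemma psi_X a : psi 'x_a = psi_var a.
Proof. by rewrite /psi mmapX mmap1U. Qed.

Lemma psi0X : psi 'x_(ord0) = 'X. Proof. by rewrite psi_X. Qed.
Lemma psi_Xneq a : a != ord0 -> psi 'x_a = ('x_a)%:P.
Proof. by rewrite psi_X /psi_var => /negPf ->. Qed.

Lemma psiE f : psi f = \sum_(m <- msupp f)
  (mcoeff m f *: mpolyX K (mnm_sub m (mnm_muln (mnm1 ord0) (m ord0))))%:P * 'X^(m ord0).
Proof.
rewrite /psi /mmap; apply: eq_bigr => m _ /=.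
rewrite -mul_mpolyC polyCM -mulrA; congr (_ * _).
rewrite /mmap1 (bigD1 ord0) //= /psi_var eqxx mulrC; congr (_ * _).
rewrite [in RHS]mpolyXE_id [in RHS](bigD1 ord0) //= mnmBE mulmnE mnm1E eqxx mul1n subnn expr0 mul1r.
rewrite rmorph_prod; apply: eq_bigr => i i0.
by rewrite (negPf i0) mnmBE mulmnE mnm1E eq_sym (negPf i0) mul0n subn0 rmorphXn.
Qed.

Opaque psi.

Lemma psi_horner f : (psi f).['x_(ord0)] = f.
Proof.
elim/mpoly_ring_ind: f => [c|a|p q hp hq|p q hp hq].
- by rewrite psiC hornerC.
- by rewrite psi_X /psi_var; case: eqP => [->|_]; rewrite ?hornerX ?hornerC.
- by rewrite psiD hornerD; congr (_ + _).
- by rewrite psiM hornerM; congr (_ * _).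
Qed.

Lemma psi_const f c : psi f = c%:P -> f = c.
Proof. by move=> e; rewrite -(psi_horner f) e hornerC. Qed.

Lemma map_mderivM a (p q : {poly Pol}) :
  map_poly (mderiv a) (p * q) = map_poly (mderiv a) p * q + p * map_poly (mderiv a) q.
Proof.
apply/polyP => k; rewrite coef_map /= coefD !coefM (raddf_sum (mderiv a)) -big_split /=.
by apply: eq_bigr => i _; rewrite mderivM !coef_map.
Qed.

Lemma psi_mderiv a f : a != ord0 -> psi (mderiv a f) = map_poly (mderiv a) (psi f).
Proof.
move=> a0; elim/mpoly_ring_ind: f => [c|b|p q hp hq|p q hp hq].
- by rewrite mderivC psiC map_polyC /= mderivC rmorph0.
- rewrite mderivX1 rmorph_nat psi_X /psi_var; case: (eqVneq b ord0) => [->|b0].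
    rewrite (negPf a0); apply/polyP => k; rewrite coef_map coefX coefC /= -mpolyC_nat mderivC.
    by case: k.
  by rewrite map_polyC /= mderivX1 rmorph_nat.
- by rewrite mderivD !psiD (raddfD (map_poly (mderiv a))) /= hp hq.
- by rewrite mderivM psiD !psiM hp hq map_mderivM.
Qed.

Lemma psi_mderiv0 f : psi (mderiv ord0 f) = (psi f)^`().
Proof.
elim/mpoly_ring_ind: f => [c|b|p q hp hq|p q hp hq].
- by rewrite mderivC psiC derivC rmorph0.
- rewrite mderivX1 rmorph_nat psi_X /psi_var eq_sym; case: eqP => _.
    by rewrite derivX.
  by rewrite derivC.
- by rewrite mderivD !psiD hp hq derivD.
- by rewrite mderivM psiD !psiM hp hq derivM.
Qed.

Lemma mderiv0_coef_psi f k : mderiv ord0 (psi f)`_k = 0.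
Proof.
elim/mpoly_ring_ind: f k => [c|b|p q hp hq|p q hp hq] k.
- by rewrite psiC coefC; case: k => [|k] /=; rewrite ?mderivC ?mderiv0.
- rewrite psi_X /psi_var; case: (eqVneq b ord0) => [_|b0].
    by rewrite coefX -mpolyC_nat mderivC.
  by rewrite coefC; case: k => [|k] /=; rewrite ?mderiv0 // mderivX1 eq_sym (negPf b0).
- by rewrite psiD coefD mderivD; apply: etrans (congr2 _ (hp k) (hq k)) (addr0 _).
- rewrite psiM coefM (raddf_sum (mderiv ord0)) big1 // => i _ /=.
  by rewrite mderivM hp hq mul0r mulr0 addr0.
Qed.

Lemma coef_psi f k : (psi f)`_k = \sum_(m <- msupp f | m ord0 == k)
  mcoeff m f *: mpolyX K (mnm_sub m (mnm_muln (mnm1 ord0) k)).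
Proof.
rewrite psiE coef_sum [RHS]big_mkcond /=; apply: eq_bigr => m _.
rewrite coefCM coefXn eq_sym; case: eqP => [<-|_]; by rewrite ?mulr1 ?mulr0.
Qed.

Lemma size_psi_le f k : (forall m, m \in msupp f -> (m ord0 <= k)%N) -> (size (psi f) <= k.+1)%N.
Proof.
move=> h; apply/leq_sizeP => j hj; rewrite coef_psi big_seq_cond big1 // => m /andP[/h].
by move=> h1 /eqP h2; move: hj; rewrite -h2 ltnNge h1.
Qed.

Lemma coefM_top (A : nzRingType) (p q : {poly A}) i j : (size p <= i.+1)%N -> (size q <= j.+1)%N ->
  (p * q)`_(i + j) = p`_i * q`_j.
Proof.
move=> hp hq; have hi : (i < (i + j).+1)%N by lia.
rewrite coefM (bigD1 (Ordinal hi)) //= addKn big1 ?addr0 // => k ne.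
have [ki|ki] := ltnP i k; first by rewrite (leq_sizeP _ _ hp) ?mul0r.
have : (j < i + j - k)%N.
  move: ne; rewrite -val_eqE /= => ne; move: ki; rewrite leq_eqVlt (negPf ne) /=; lia.
by move=> h; rewrite (leq_sizeP _ _ hq) ?mulr0.
Qed.

Lemma sizeM_top (A : nzRingType) (p q : {poly A}) i j : (size p <= i.+1)%N -> (size q <= j.+1)%N ->
  (size (p * q)%R <= (i + j).+1)%N.
Proof. by move=> hp hq; apply: leq_trans (size_polyMleq _ _) _; lia. Qed.

Lemma coef_prod_top (A : comNzRingType) (I : Type) (r : seq I) (F : I -> {poly A}) k :
  (forall i, (size (F i) <= k.+1)%N) ->
  (size (\prod_(i <- r) F i)%R <= (size r * k).+1)%N /\
  (\prod_(i <- r) F i)`_(size r * k) = \prod_(i <- r) (F i)`_k.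
Proof.
move=> h; elim: r => [|i r [IH1 IH2]]; first by rewrite !big_nil size_poly1 coef1.
by rewrite !big_cons mulSn coefM_top // IH2; split => //; apply: sizeM_top.
Qed.

Lemma coef_det_top (A : comNzRingType) m (M : 'M[{poly A}]_m) k :
  (forall i j, (size (M i j) <= k.+1)%N) ->
  (size (\det M)%R <= (m * k).+1)%N /\ (\det M)`_(m * k) = \det (\matrix_(i, j) (M i j)`_k).
Proof.
move=> h; have E (s : 'S_m) := coef_prod_top (index_enum 'I_m) (F := fun i => M i (s i)) (fun i => h i (s i)).
have sz : size (index_enum 'I_m) = m by rewrite -[RHS]card_ord cardT enumT.
rewrite sz in E; split.
  apply: leq_trans (size_sum _ _ _) _; apply/bigmax_leqP => s _.
  by rewrite -signr_odd; case: odd; rewrite ?expr0 ?expr1 ?mulN1r ?mul1r ?size_polyN; case: (E s).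
rewrite /determinant coef_sum; apply: eq_bigr => s _.
have -> : (-1) ^+ s = ((-1) ^+ s)%:P :> {poly A} by rewrite rmorphXn rmorphN rmorph1.
rewrite coefCM (E s).2; congr (_ * _); apply: eq_bigr => i _; by rewrite mxE.
Qed.
Lemma psi_coef (f : Pol) j : psi (psi f)`_j = ((psi f)`_j)%:P.
Proof.
elim/mpoly_ring_ind: f j => [c|b|p q hp hq|p q hp hq] j.
- by rewrite psiC coefC; case: j => [|j] /=; rewrite ?psiC // rmorph0.
- rewrite psi_X /psi_var; case: (eqVneq b ord0) => [_|b0].
    by rewrite coefX rmorph_nat -polyC_natr.
  rewrite coefC; case: j => [|j] /=; first by rewrite psi_Xneq.
  by rewrite rmorph0.
- by rewrite psiD coefD psiD polyCD; apply: (congr2 _ (hp j) (hq j)).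
- rewrite psiM coefM psi_sum rmorph_sum /=; apply: eq_bigr => i _.
  by rewrite psiM polyCM; apply: (congr2 _ (hp i) (hq _)).
Qed.

(** By [coef_psi] this is [coef_x1]. *)
Definition cf k (f : Pol) : Pol := (psi f)`_k.

Lemma cfZ k c f : cf k (c *: f) = c *: cf k f.
Proof. by rewrite /cf -mul_mpolyC psiM psiC coefCM mul_mpolyC. Qed.
Lemma cf0 k : cf k 0 = 0. Proof. by rewrite /cf psi0 coef0. Qed.
Lemma cfB k f g : cf k (f - g) = cf k f - cf k g.
Proof. by rewrite /cf psiB coefB. Qed.
Lemma cf_sum k (I : finType) (f : I -> Pol) : cf k (\sum_i f i) = \sum_i cf k (f i).
Proof. by rewrite /cf psi_sum coef_sum. Qed.
Lemma cf_X0 k f : cf k.+1 ('x_ord0 * f) = cf k f.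
Proof. by rewrite /cf psiM psi0X coefXM. Qed.
Lemma cf_Xneq k a f : a != ord0 -> cf k ('x_a * f) = 'x_a * cf k f.
Proof. by move=> a0; rewrite /cf psiM psi_Xneq // coefCM. Qed.
Lemma cf_mderiv k a f : a != ord0 -> cf k (mderiv a f) = mderiv a (cf k f).
Proof. by move=> a0; rewrite /cf psi_mderiv // coef_map. Qed.
Lemma cf_X0_mderiv0 k f : cf k ('x_ord0 * mderiv ord0 f) = k%:R *: cf k f.
Proof.
rewrite /cf psiM psi0X psi_mderiv0 coefXM coef_deriv.
by case: k => [|k] /=; rewrite ?scale0r // scaler_nat.
Qed.
Lemma mderiv0_cf k f : mderiv ord0 (cf k f) = 0.
Proof. exact: mderiv0_coef_psi. Qed.
Lemma psi_cf k f : psi (cf k f) = (cf k f)%:P.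
Proof. exact: psi_coef. Qed.

Definition cfdeg k f := (size (psi f) <= k.+1)%N.

Lemma cfdegP k f : (forall m, m \in msupp f -> (m ord0 <= k)%N) -> cfdeg k f.
Proof. exact: size_psi_le. Qed.
Lemma cf_big k j f : cfdeg k f -> (k < j)%N -> cf j f = 0.
Proof. by move=> h kj; rewrite /cf nth_default // (leq_trans h). Qed.
Lemma cfdegM k j f g : cfdeg k f -> cfdeg j g -> cfdeg (k + j) (f * g).
Proof. by move=> h1 h2; rewrite /cfdeg psiM; apply: sizeM_top. Qed.
Lemma cfM k j f g : cfdeg k f -> cfdeg j g -> cf (k + j) (f * g) = cf k f * cf j g.
Proof. by move=> h1 h2; rewrite /cf psiM; apply: coefM_top. Qed.
Lemma cfdegB k f g : cfdeg k f -> cfdeg k g -> cfdeg k (f - g).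
Proof.
move=> h1 h2; rewrite /cfdeg psiB; apply: leq_trans (size_polyD _ _) _.
by rewrite geq_max size_polyN; apply/andP; split; [exact: h1 | exact: h2].
Qed.
Lemma cfdegS k f : cfdeg k.+1 f -> cf k.+1 f = 0 -> cfdeg k f.
Proof.
move=> h e; apply/leq_sizeP => j; rewrite leq_eqVlt => /orP[/eqP <-|hj]; first exact: e.
by apply: (cf_big h).
Qed.
Lemma cfdeg_cf k j f : cfdeg j (cf k f).
Proof. by rewrite /cfdeg psi_cf (leq_trans (size_polyC_leq1 _)). Qed.
Lemma cfdeg_ex f : exists k, cfdeg k f.
Proof. by exists (size (psi f)); rewrite /cfdeg leqnSn. Qed.
Lemma cfdeg_le k j f : (k <= j)%N -> cfdeg k f -> cfdeg j f.
Proof. by move=> kj h; apply: leq_trans h _; rewrite ltnS. Qed.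
Lemma cfdeg_mderiv a k f : a != ord0 -> cfdeg k f -> cfdeg k (mderiv a f).
Proof.
by move=> a0 h; rewrite /cfdeg psi_mderiv //; apply: leq_trans (size_poly _ _) h.
Qed.
Lemma cfdeg0 f : cfdeg 0 f -> f = cf 0 f.
Proof.
move=> h; apply: psi_const; rewrite /cf; apply/polyP => -[|k]; rewrite coefC //=.
by rewrite nth_default // (leq_trans h).
Qed.
Lemma cf_det m (M : 'M[Pol]_m) k : (forall i j, cfdeg k (M i j)) ->
  cf (m * k) (\det M) = \det (map_mx (cf k) M) /\ cfdeg (m * k) (\det M).
Proof.
move=> h; rewrite /cf /cfdeg -[psi _]det_map_mx.
have [|h1 h2] := @coef_det_top _ m (map_mx psi M) k; first by move=> i j; rewrite mxE; exact: h.
split => //; rewrite h2; congr (\det _); apply/matrixP => i j; by rewrite !mxE.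
Qed.
(** D^j is monic of degree j k in x_0, so the same bound on the degree of Q D^j forces Q to be free
    of x_0 and equal to the top coefficient. *)
Lemma cf_monic_quot k (D Q : Pol) c : cfdeg k D -> cf k D = 1 -> forall j, cfdeg (j * k) (Q * D ^+ j) ->
  cf (j * k) (Q * D ^+ j) = c -> Q = c.
Proof.
move=> hD eD j; have hDj i : cfdeg (i * k) (D ^+ i) /\ cf (i * k) (D ^+ i) = 1.
  elim: i => [|i [IH1 IH2]].
    by rewrite expr0 /cfdeg /cf rmorph1 size_poly1 coef1.
  by rewrite exprS mulSn; split; [apply: cfdegM | rewrite cfM // eD IH2 mulr1].
have [hd he] := hDj j; move=> h1 h2.
have h0 : cfdeg 0 Q.
  have [q] := cfdeg_ex Q; elim: q => [//|q IH] hq; apply: IH; apply: cfdegS => //.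
  rewrite -[LHS]mulr1 -he -cfM //; apply: (cf_big h1).
  by rewrite addSn ltnS leq_addl.
by rewrite (cfdeg0 h0) -h2 -[(j * k)%N]add0n cfM // he mulr1.
Qed.

Opaque cf cfdeg.

End MainVariable.

(** * Symmetry, weights, flatness and Euler identity of Delta Omega *)

Lemma cancel3 (V : zmodType) (a b c : V) : a + b - c - a - b = - c.
Proof. by rewrite addrAC [a + b - c - b]addrAC addrK addrAC subrr add0r. Qed.

Lemma shuffle7 (V : zmodType) (x a b c e f g : V) :
  a - b - (c - e) - (f - g) = x + a - c - f - (x + b - e - g).
Proof.
rewrite !opprD !opprK [RHS](AC (4*4) (((((((1*5)*2)*6)*3)*7)*4)*8)) /=.
by rewrite subrr add0r !addrA.
Qed.

Section Structure.
Variables (K : numFieldType) (n' : nat).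
Local Notation n := n'.+1.
Local Notation Pol := (mpoly n K).
Variables (x : n.-tuple Pol) (P : 'I_n -> 'I_n -> 'I_n -> Pol) (Delta : Pol) (d : 'I_n -> nat).
Hypotheses (x_jac : forall r : 'I_n -> Pol,
    (forall i, \sum_a r a * mderiv i (tnth x a) = 0) -> forall a, r a = 0)
  (x_inj : injective (comp_mpoly x)).

Definition euler (f : Pol) : Pol := \sum_i 'x_i * mderiv i f.
Definition weuler (f : Pol) : Pol := \sum_a (d a)%:R *: ('x_a * mderiv a f).
Definition wt (m : multinom n) : nat := \sum_a d a * m a.

(** The coefficient of du^i du^j in the pullback of sum W_ab dx^a dx^b. It determines W
    ([hsum_uniq]), so identities for [P] are checked in u, where [rel] turns [P] into a Hessian. *)
Definition hsum (W : 'I_n -> 'I_n -> Pol) i j : Pol :=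
  \sum_a \sum_b mderiv i (tnth x a) * mderiv j (tnth x b) * comp_mpoly x (W a b).

Lemma eulerM f g : euler (f * g) = euler f * g + f * euler g.
Proof.
rewrite /euler mulr_suml mulr_sumr -big_split; apply: eq_bigr => i _ /=.
by rewrite mderivM; ring.
Qed.

Lemma euler_is_linear : linear euler.
Proof.
move=> c f g; rewrite /euler scaler_sumr -big_split; apply: eq_bigr => i _ /=.
by rewrite mderivD mderivZ mulrDr -scalerAr.
Qed.
HB.instance Definition _ := GRing.isLinear.Build K Pol Pol _ euler euler_is_linear.

Lemma weuler_is_linear : linear weuler.
Proof.
move=> c f g; rewrite /weuler scaler_sumr -big_split; apply: eq_bigr => i _ /=.
by rewrite mderivD mderivZ mulrDr -scalerAr scalerDr !scalerA mulrC.
Qed.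
HB.instance Definition _ := GRing.isLinear.Build K Pol Pol _ weuler weuler_is_linear.

Lemma euler_mderiv j f : euler (mderiv j f) = mderiv j (euler f) - mderiv j f.
Proof.
rewrite /euler (raddf_sum (mderiv j)) /=.
under [in RHS]eq_bigr => i _ do rewrite mderivM mderivX1.
have e : \sum_i (j == i)%:R * mderiv i f = mderiv j f.
  rewrite (bigD1 j) //= eqxx mul1r big1 ?addr0 // => i /negPf ne.
  by rewrite eq_sym ne mul0r.
rewrite big_split /= e [X in X - _]addrC addrK; apply: eq_bigr => i _.
by rewrite mderiv_comm.
Qed.

Hypothesis x_euler : forall a, euler (tnth x a) = (d a)%:R *: tnth x a.

Lemma euler_comp f : euler (comp_mpoly x f) = comp_mpoly x (weuler f).
Proof.
rewrite /weuler (raddf_sum (comp_mpoly x)) /euler /=.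
under eq_bigr => i _ do rewrite mderiv_comp mulr_sumr.
rewrite exchange_big /=; apply: eq_bigr => a _.
rewrite comp_mpolyZ rmorphM /= comp_mpolyXi scalerAl -x_euler /euler mulr_suml.
by apply: eq_bigr => i _; ring.
Qed.

Lemma euler_mderiv_x i a : euler (mderiv i (tnth x a)) = ((d a)%:R - 1) *: mderiv i (tnth x a).
Proof. by rewrite euler_mderiv x_euler mderivZ scalerBl scale1r. Qed.

Lemma euler_hsum W i j : euler (hsum W i j) =
  hsum (fun a b => weuler (W a b) + ((d a)%:R + (d b)%:R - 2) *: W a b) i j.
Proof.
rewrite /hsum (raddf_sum euler) /=; apply: eq_bigr => a _.
rewrite (raddf_sum euler) /=; apply: eq_bigr => b _.
rewrite !eulerM !euler_mderiv_x euler_comp comp_mpolyD comp_mpolyZ -!mul_mpolyC.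
by rewrite !(mpolyCB, mpolyCD, mpolyC1, mpolyC_nat); ring.
Qed.

Lemma hsum_uniq W : (forall i j, hsum W i j = 0) -> forall a b, W a b = 0.
Proof.
move=> H a b; apply: x_inj; rewrite comp_mpoly0; move: b.
apply: (x_jac (r := fun b => comp_mpoly x (W a b))) => j; move: a.
apply: (x_jac (r := fun a => \sum_b comp_mpoly x (W a b) * mderiv j (tnth x b))) => i.
rewrite -[RHS](H i j); apply: eq_bigr => a _; rewrite mulr_suml; apply: eq_bigr => b' _.
by ring.
Qed.

Lemma hsumB W W' i j : hsum (fun a b => W a b - W' a b) i j = hsum W i j - hsum W' i j.
Proof.
rewrite /hsum -sumrB; apply: eq_bigr => a _; rewrite -sumrB; apply: eq_bigr => b _.
by rewrite comp_mpolyB mulrBr.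
Qed.

Lemma hsumZ k W i j : hsum (fun a b => k *: W a b) i j = k *: hsum W i j.
Proof.
rewrite /hsum scaler_sumr; apply: eq_bigr => a _; rewrite scaler_sumr; apply: eq_bigr => b _.
by rewrite comp_mpolyZ scalerAr.
Qed.

Hypothesis rel : forall c i j,
  hsum (fun a b => P a b c) i j = - (comp_mpoly x Delta * mderiv i (mderiv j (tnth x c))).
Variable w0 : nat.
Hypothesis Delta_euler : euler (comp_mpoly x Delta) = w0%:R *: comp_mpoly x Delta.

Lemma P_sym a b c : P a b c = P b a c.
Proof.
apply/eqP; rewrite -subr_eq0; apply/eqP.
apply: (hsum_uniq (W := fun a b => P a b c - P b a c)) => i j; rewrite hsumB.
rewrite [X in _ - X](_ : _ = hsum (fun a b => P a b c) j i).
  by rewrite !rel mderiv_comm subrr.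
rewrite /hsum exchange_big /=; apply: eq_bigr => a' _; apply: eq_bigr => b' _.
by ring.
Qed.

(** In u, delta times the Hessian of x^c has degree w0 + d_c - 2, and the factors d_i x^a and d_j
    x^b have degrees d_a - 1 and d_b - 1. *)
Lemma P_weight a b c :
  weuler (P a b c) = (w0%:R + (d c)%:R - (d a)%:R - (d b)%:R) *: P a b c.
Proof.
apply/eqP; rewrite -subr_eq0; apply/eqP.
pose V a b := weuler (P a b c) + ((d a)%:R + (d b)%:R - 2) *: P a b c.
rewrite -[RHS](hsum_uniq (W := fun a b => V a b - (w0%:R + (d c)%:R - 2) *: P a b c) _ a b).
  rewrite /V -!mul_mpolyC !(mpolyCB, mpolyCD); ring.
move=> i j; rewrite hsumB hsumZ -euler_hsum rel raddfN /= eulerM Delta_euler.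
rewrite euler_mderiv (euler_mderiv j) x_euler !(mderivD, mderivN) !mderivZ.
by rewrite -!mul_mpolyC !(mpolyCB, mpolyCD, mpolyC_nat); ring.
Qed.

Lemma weuler_monom m : weuler (mpolyX K m) = (wt m)%:R *: mpolyX K m.
Proof.
rewrite /weuler /wt natr_sum scaler_suml; apply: eq_bigr => a _.
rewrite mderivX -scalerAr scalerA natrM -mpolyXD.
case: (posnP (m a)) => [->|ma]; first by rewrite !mulr0 !scale0r.
by rewrite addmC submK // lep1mP -lt0n.
Qed.

Lemma weuler_coeff f m : mcoeff m (weuler f) = (wt m)%:R * mcoeff m f.
Proof.
rewrite [f]mpolyE (raddf_sum weuler) /= !(raddf_sum (mcoeff m)) mulr_sumr /=.
apply: eq_bigr => k _; rewrite linearZ /= weuler_monom !mcoeffZ mcoeffX.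
by case: eqP => [->|_]; rewrite ?mulr0 // !mulr1 mulrC.
Qed.

Lemma weight_supp f (p q : nat) m : weuler f = (p%:R - q%:R) *: f -> m \in msupp f ->
  (wt m + q = p)%N.
Proof.
move=> h mf; have := congr1 (mcoeff m) h; rewrite weuler_coeff mcoeffZ => /mulIf e.
have {}e : (wt m)%:R = p%:R - q%:R :> K by apply: e; rewrite -mcoeff_msupp.
by apply/eqP; rewrite -(eqr_nat K) natrD e subrK.
Qed.

Lemma P_supp a b c m : m \in msupp (P a b c) -> (wt m + (d a + d b) = w0 + d c)%N.
Proof. by apply: weight_supp; rewrite P_weight !natrD opprD addrA. Qed.

Lemma wt_ge (m : multinom n) a : (d a * m a <= wt m)%N.
Proof. by rewrite /wt (bigD1 a) //= leq_addr. Qed.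

Local Notation mx W a := (\matrix_(c, b) W a b c : 'M[Pol]_n).
Definition dmx i (M : 'M[Pol]_n) : 'M[Pol]_n := map_mx (mderiv i) M.
Definition cx (M : 'M[Pol]_n) : 'M[Pol]_n := map_mx (comp_mpoly x) M.

Lemma dmxD i M M' : dmx i (M + M') = dmx i M + dmx i M'.
Proof. by apply/matrixP => c b; rewrite !mxE mderivD. Qed.
Lemma dmxN i M : dmx i (- M) = - dmx i M.
Proof. by apply/matrixP => c b; rewrite !mxE mderivN. Qed.
Lemma dmxZ i f M : dmx i (f *: M) = mderiv i f *: M + f *: dmx i M.
Proof. by apply/matrixP => c b; rewrite !mxE mderivM. Qed.
Lemma dmxM i M M' : dmx i (M *m M') = dmx i M *m M' + M *m dmx i M'.
Proof.
apply/matrixP => c b; rewrite !mxE (raddf_sum (mderiv i)) -big_split; apply: eq_bigr => k _ /=.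
by rewrite !mxE mderivM.
Qed.
Lemma dmx_sum i (I : finType) (F : I -> 'M[Pol]_n) : dmx i (\sum_k F k) = \sum_k dmx i (F k).
Proof.
apply: (big_morph (dmx i)); first exact: dmxD.
by apply/matrixP => c b; rewrite !mxE mderiv0.
Qed.

Lemma dmx_cx i M : dmx i (cx M) = \sum_b mderiv i (tnth x b) *: cx (dmx b M).
Proof.
apply/matrixP => c e; rewrite summxE !mxE mderiv_comp; apply: eq_bigr => b _.
by rewrite !mxE mulrC.
Qed.

Definition bsum (W : 'I_n -> 'I_n -> 'M[Pol]_n) i j : 'M[Pol]_n :=
  \sum_a \sum_b (mderiv i (tnth x a) * mderiv j (tnth x b)) *: cx (W a b).

Lemma bsumE W i j c e : bsum W i j c e = hsum (fun a b => W a b c e) i j.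
Proof.
rewrite /bsum summxE; apply: eq_bigr => a _; rewrite summxE; apply: eq_bigr => b _.
by rewrite !mxE.
Qed.

Lemma bsum_uniq W : (forall i j, bsum W i j = 0) -> forall a b, W a b = 0.
Proof.
move=> H a b; apply/matrixP => c e; rewrite [RHS]mxE.
by apply: (hsum_uniq (W := fun a b => W a b c e)) => i j; rewrite -bsumE H mxE.
Qed.

Lemma bsumB W W' i j : bsum (fun a b => W a b - W' a b) i j = bsum W i j - bsum W' i j.
Proof. by apply/matrixP => c e; rewrite bsumE mxBE !bsumE -hsumB; do 2![apply: eq_bigr => ? _]; rewrite mxBE. Qed.

Lemma bsum_swap W i j : bsum W j i = bsum (fun a b => W b a) i j.
Proof.
rewrite /bsum exchange_big /=; apply: eq_bigr => a _; apply: eq_bigr => b _.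
by rewrite mulrC.
Qed.

Lemma bsumZ f W i j : comp_mpoly x f *: bsum W i j = bsum (fun a b => f *: W a b) i j.
Proof.
rewrite /bsum scaler_sumr; apply: eq_bigr => a _; rewrite scaler_sumr; apply: eq_bigr => b _.
by apply/matrixP => c e; rewrite !mxE rmorphM /=; ring.
Qed.

Definition Pm a := mx P a.
(** Delta times the matrix of the covariant derivative along d/du^i, in the frame d/dx. *)
Definition Pt i : 'M[Pol]_n := \sum_a mderiv i (tnth x a) *: cx (Pm a).
Definition xjac : 'M[Pol]_n := \matrix_(c, i) mderiv i (tnth x c).
Local Notation del := (comp_mpoly x Delta).

(** The columns of [xjac] are the fields d/du^j in the frame d/dx; the relation says that they are
    parallel. *)
Lemma Pt_jac i : Pt i *m xjac = - (del *: dmx i xjac).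
Proof.
apply/matrixP => c j; rewrite !mxE -rel /hsum exchange_big /=; apply: eq_bigr => b _.
rewrite /Pt summxE mulr_suml; apply: eq_bigr => a _.
by rewrite !mxE; ring.
Qed.

Lemma jac_cancel (M : 'M[Pol]_n) : M *m xjac = 0 -> M = 0.
Proof.
move=> h; apply/matrixP => c a; rewrite [RHS]mxE.
apply: (x_jac (r := fun a => M c a)) => i.
have := congr1 (fun A : 'M[_]_n => A c i) h; rewrite [LHS]mxE [RHS]mxE => h2; rewrite -[RHS]h2.
by apply: eq_bigr => b _; rewrite !mxE.
Qed.

Lemma jac_cancel_eq (M M' : 'M[Pol]_n) : M *m xjac = M' *m xjac -> M = M'.
Proof.
by move=> h; apply/eqP; rewrite -subr_eq0; apply/eqP/jac_cancel; rewrite mulmxBl h subrr.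
Qed.

Lemma Pt_mul i j : Pt i *m Pt j = bsum (fun a b => Pm a *m Pm b) i j.
Proof.
rewrite /Pt mulmx_suml; apply: eq_bigr => a _; rewrite mulmx_sumr; apply: eq_bigr => b _.
by rewrite -scalemxAl -scalemxAr scalerA /cx map_mxM.
Qed.

Lemma ddel_Pt i j : mderiv j del *: Pt i = bsum (fun a b => mderiv b Delta *: Pm a) i j.
Proof.
rewrite /Pt scaler_sumr; apply: eq_bigr => a _; rewrite mderiv_comp scaler_suml.
apply: eq_bigr => b _; apply/matrixP => c e; rewrite !mxE rmorphM /=; ring.
Qed.

(** Up to sign, this is Delta^2 times the curvature of Pm / Delta. With Omega_i = Pt_i / delta,
    [T i j] is delta^2 (d_j Omega_i - Omega_i Omega_j); on the parallel frame [xjac] it gives -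
    delta^2 d_j d_i xjac, which is symmetric. In T i j - T j i the second derivatives of x drop
    out. *)
Lemma Pm_flat a b : Delta *: (dmx b (Pm a) - dmx a (Pm b))
  - (Pm a *m Pm b - Pm b *m Pm a) - (mderiv b Delta *: Pm a - mderiv a Delta *: Pm b) = 0.
Proof.
pose W a b := Delta *: (dmx b (Pm a) - dmx a (Pm b))
  - (Pm a *m Pm b - Pm b *m Pm a) - (mderiv b Delta *: Pm a - mderiv a Delta *: Pm b).
apply: (bsum_uniq (W := W)) => i j.
pose T i j := del *: dmx j (Pt i) - Pt i *m Pt j - mderiv j del *: Pt i.
have TJ k l : T k l *m xjac = - ((del * del) *: dmx l (dmx k xjac)).
  have := congr1 (fun M => del *: dmx l M) (Pt_jac k) => h.
  have hl : del *: dmx l xjac = - (Pt l *m xjac) by rewrite Pt_jac opprK.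
  have hk : del *: dmx k xjac = - (Pt k *m xjac) by rewrite Pt_jac opprK.
  have {}h : del *: dmx l (Pt k) *m xjac = Pt k *m Pt l *m xjac + mderiv l del *: (Pt k *m xjac)
      - (del * del) *: dmx l (dmx k xjac).
    have e : del *: (mderiv l del *: dmx k xjac) = - (mderiv l del *: (Pt k *m xjac)).
      by rewrite scalerA mulrC -scalerA hk scalerN.
    move: h; rewrite dmxM dmxN dmxZ scalerDr [del *: (Pt k *m _)]scalemxAr hl mulmxN mulmxA.
    rewrite scalemxAl => /(canRL (subrK _)) ->.
    by rewrite scalerN scalerDr e scalerA opprD opprK addrC addrA.
  by rewrite /T !mulmxBl h -scalemxAl cancel3.
have Tsym : T i j = T j i.
  have e : dmx j (dmx i xjac) = dmx i (dmx j xjac).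
    by apply/matrixP => c e; rewrite !mxE mderiv_comm.
  apply: jac_cancel_eq; apply: etrans (TJ i j) _; apply: etrans _ (esym (TJ j i)).
  by rewrite e.
have Pd k l : dmx l (Pt k) = \sum_a mderiv l (mderiv k (tnth x a)) *: cx (Pm a)
    + bsum (fun a b => dmx b (Pm a)) k l.
  rewrite /Pt dmx_sum /bsum -big_split; apply: eq_bigr => a' _ /=.
  rewrite dmxZ dmx_cx; congr (_ + _); rewrite scaler_sumr; apply: eq_bigr => b' _.
  by rewrite scalerA.
have : T i j - T j i = 0 by rewrite Tsym subrr.
rewrite /T !Pd !Pt_mul !ddel_Pt !scalerDr !bsumZ.
rewrite [bsum _ j i]bsum_swap [bsum (fun a b => Pm a *m Pm b) j i]bsum_swap.
rewrite [bsum (fun a b => mderiv b Delta *: Pm a) j i]bsum_swap.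
under [in X in _ - X]eq_bigr => a' _ do rewrite mderiv_comm.
move=> h; rewrite -[RHS]h /W !bsumB.
rewrite -bsumZ bsumB scalerBr !bsumZ.
exact: shuffle7.
Qed.

Lemma P_flat a b c k : Delta * (mderiv b (P a k c) - mderiv a (P b k c))
  - \sum_i (P a i c * P b k i - P b i c * P a k i)
  - (mderiv b Delta * P a k c - mderiv a Delta * P b k c) = 0.
Proof.
have := congr1 (fun M : 'M[_]_n => M c k) (Pm_flat a b).
rewrite [RHS]mxE => h; rewrite -[RHS]h.
rewrite [RHS]mxE; congr (_ + _); last by rewrite !mxE.
rewrite [RHS]mxE; congr (_ + _); first by rewrite !mxE.
rewrite !mxE -sumrB; congr (- _); apply: eq_bigr => i _.
by rewrite !mxE.
Qed.

(** This encodes that nabla^V of E_deg is the identity. In u, E_deg is the Euler field; contracting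
    [rel] with u^i gives delta (1 - d_c) d_j x^c, since d_j x^c has degree d_c - 1. *)
Lemma P_euler b c : \sum_a (d a)%:R *: ('x_a * P a b c) = ((b == c)%:R * (1 - (d c)%:R)) *: Delta.
Proof.
apply: x_inj; move: b; pose r b := comp_mpoly x (\sum_a (d a)%:R *: ('x_a * P a b c)
  - ((b == c)%:R * (1 - (d c)%:R)) *: Delta).
suff H : forall b, r b = 0 by move=> b; apply/eqP; rewrite -subr_eq0 -comp_mpolyB -/(r b) H.
apply: x_jac => j.
transitivity (\sum_i 'x_i * hsum (fun a b => P a b c) i j
   - (1 - (d c)%:R) *: (del * mderiv j (tnth x c))).
  rewrite /r; under eq_bigr => b _ do rewrite comp_mpolyB mulrBl.
  rewrite sumrB; congr (_ - _).
    under [RHS]eq_bigr => i _ do rewrite /hsum mulr_sumr.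
    rewrite [RHS]exchange_big /=.
    under [RHS]eq_bigr => a _ do (under eq_bigr => i _ do rewrite mulr_sumr; rewrite exchange_big /=).
    rewrite [RHS]exchange_big /=; apply: eq_bigr => b _.
    rewrite (raddf_sum (comp_mpoly x)) mulr_suml; apply: eq_bigr => a _ /=.
    rewrite comp_mpolyZ rmorphM /= comp_mpolyXi scalerAl -x_euler /euler !mulr_suml.
    by apply: eq_bigr => i _; ring.
  rewrite (bigD1 c) //= eqxx mul1r big1 ?addr0 => [|b /negPf ne].
    by rewrite comp_mpolyZ scalerAl.
  by rewrite ne mul0r scale0r comp_mpoly0 mul0r.
under eq_bigr => i _ do rewrite rel mulrN mulrCA.
rewrite sumrN -mulr_sumr -/(euler (mderiv j (tnth x c))) euler_mderiv_x.
by rewrite -!mul_mpolyC !(mpolyCB, mpolyC1); ring.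
Qed.

Hypotheses (d_sort : forall a b : 'I_n, (a <= b)%N -> (d b <= d a)%N) (d_gt1 : forall a, (1 < d a)%N).
Hypotheses (Delta_supp : forall m, m \in msupp Delta -> (m ord0 <= n)%N)
  (Delta_monic : cf n Delta = 1).

Lemma d_gt0 a : (0 < d a)%N. Proof. exact: ltn_trans (d_gt1 a). Qed.
Lemma d_le0 a : (d a <= d ord0)%N. Proof. exact: d_sort. Qed.

Lemma cf_weight (f : Pol) w j : weuler f = w *: f ->
  weuler (cf j f) = (w - (d ord0 * j)%:R) *: cf j f.
Proof.
move=> h; have := congr1 (cf j) h; rewrite cfZ => h2; rewrite scalerBl -h2.
rewrite /weuler cf_sum (bigD1 ord0) //= mderiv0_cf mulr0 scaler0 add0r.
rewrite [X in _ = X - _](bigD1 ord0) //= cfZ cf_X0_mderiv0 scalerA natrM.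
rewrite addrAC subrr add0r; apply: eq_bigr => a a0.
by rewrite cfZ cf_Xneq // cf_mderiv.
Qed.

Lemma Delta_weuler : weuler Delta = w0%:R *: Delta.
Proof. by apply: x_inj; rewrite -euler_comp Delta_euler comp_mpolyZ. Qed.

(** The leading coefficient 1 of Delta has weight 0, and taking the coefficient of x_0^n lowers the
    weight w0 by n d_0. *)
Lemma w0E : w0 = (n * d ord0)%N.
Proof.
have := cf_weight n Delta_weuler; rewrite Delta_monic.
rewrite -mpolyC1 /weuler big1 => [|a _]; last by rewrite mderivC mulr0 scaler0.
move/esym/eqP; rewrite mscalerI mpolyC_eq0 oner_eq0 orbF subr_eq0 eqr_nat => /eqP ->.
by rewrite mulnC.
Qed.

Lemma cfdeg_Delta : cfdeg n Delta.
Proof. exact: cfdegP. Qed.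

(** A power x_0^m has weight m d_0, while the weight n d_0 + d_c - d_a - d_b of P is below (n + 1)
    d_0. *)
Lemma cfdeg_P a b c : cfdeg n (P a b c).
Proof.
apply: cfdegP => m /P_supp; rewrite w0E => h.
have := wt_ge m ord0; have := d_le0 c; have := d_gt0 a; have := d_gt0 ord0.
move=> h1 h2 h3 h4; rewrite leqNgt; apply/negP => h5.
have : (d ord0 * n.+1 <= d ord0 * m ord0)%N by rewrite leq_mul2l h5 orbT.
by rewrite mulnS [(n * _)%N]mulnC in h *; lia.
Qed.

(** For a = 0 the weight is at most n d_0 - d_b, which excludes x_0^n as well; this makes Gamma_0
    vanish. *)
Lemma cfdeg_P0 b c : cfdeg n' (P ord0 b c).
Proof.
apply: cfdegP => m /P_supp; rewrite w0E => h.
have := wt_ge m ord0; have := d_le0 c; have := d_gt0 b; have := d_gt0 ord0.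
move=> h1 h2 h3 h4; rewrite leqNgt; apply/negP => h5.
have : (d ord0 * n <= d ord0 * m ord0)%N by rewrite leq_mul2l h5 orbT.
by rewrite [(n * _)%N]mulnC in h *; lia.
Qed.

End Structure.

(** * Polynomial identities of the Saito structure *)

Module SaitoAlgebra.

Section NoncommutativeIdentities.
Variables (B : comNzRingType) (n : nat).
Implicit Types M : 'M[B]_n.

(** The last hypothesis is flatness in the directions 0 and a, with [AU] the adjugate of U.
    Multiplying it by U on the right and using P0 U = D N brings out a left factor P0, to be
    cancelled in [Ra_eq]. *)
Lemma Ra_identity (D : B) (P0 G C0 U N AU dU L : 'M[B]_n) :
  P0 *m U = D *: N -> N *m AU = P0 ->
  L *m U = D *: (D *: (N *m G - G *m N) - P0 *m dU) ->
  - (P0 *m AU) *m C0 - L - D *: (G *m P0 - P0 *m G)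
    - (P0 *m C0 *m P0 - P0 *m (P0 *m C0)) = 0 ->
  P0 *m ((1%:M - N) *m (AU *m C0 *m U))
    = P0 *m (D *: (dU + G *m U - U *m G - C0 *m N)).
Proof.
move=> PU NA LU e.
have : (- (P0 *m AU) *m C0 - L - D *: (G *m P0 - P0 *m G)
    - (P0 *m C0 *m P0 - P0 *m (P0 *m C0))) *m U = 0 by rewrite e mul0mx.
rewrite !mulmxBl LU -(scalemxAl D) mulmxBl -!mulmxA PU => /matrixP h.
rewrite mul1mx !mulmxBr !(mulmxA N) NA -scalemxAr !mulmxBr mulmxDr !(mulmxA P0 U) PU.
apply/matrixP => c b; have := h c b; rewrite !mulNmx -!scalemxAl -?scalemxAr -!mulmxA !mx_entryE => h'.
by apply/eqP; rewrite -subr_eq0 -oppr_eq0 -h'; apply/eqP; ring.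
Qed.

Lemma flat_expand (D Da Db : B) (P0 Pa Pb Ga Gb dGa dGb Ca Cb dCa dCb : 'M[B]_n) :
  D *: (D *: (dGa - dGb)) + ((D *: Pb - Db *: P0) *m Ca - (D *: Pa - Da *: P0) *m Cb)
     + D *: (P0 *m (dCa - dCb))
  = D *: (Db *: Ga + D *: dGa + (Pb *m Ca + P0 *m dCa)
        - (Da *: Gb + D *: dGb + (Pa *m Cb + P0 *m dCb)))
    - (Db *: (D *: Ga + P0 *m Ca) - Da *: (D *: Gb + P0 *m Cb)).
Proof.
apply/matrixP => c k; rewrite !mx_expandE -?scalemxAl !mx_entryE; ring.
Qed.

(** The counterpart for two directions a and b: [La] and [Lb] are eliminated by flatness against the
    direction 0, and again a left factor P0 comes out. *)
Lemma flat_identity (D : B) (P0 Ga Gb Ca Cb dCa dCb N AU La Lb : 'M[B]_n) : N *m AU = P0 ->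
  La = - (P0 *m AU *m Ca) - D *: (Ga *m P0 - P0 *m Ga) - (P0 *m Ca *m P0 - P0 *m P0 *m Ca) ->
  Lb = - (P0 *m AU *m Cb) - D *: (Gb *m P0 - P0 *m Gb) - (P0 *m Cb *m P0 - P0 *m P0 *m Cb) ->
  D *: (D *: (Ga *m Gb - Gb *m Ga)) + (Lb *m Ca - La *m Cb) + D *: (P0 *m (dCa - dCb))
    - ((D *: Ga + P0 *m Ca) *m (D *: Gb + P0 *m Cb)
       - (D *: Gb + P0 *m Cb) *m (D *: Ga + P0 *m Ca)) = 0 ->
  P0 *m ((1%:M - N) *m AU *m (Cb *m Ca - Ca *m Cb))
  = P0 *m (D *: (dCa + Gb *m Ca - Ca *m Gb - (dCb + Ga *m Cb - Cb *m Ga))).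
Proof.
move=> NA -> -> e; rewrite mulmxBl mul1mx NA.
apply/matrixP => c k; have := congr1 (fun M : 'M[_]_n => M c k) e.
rewrite -?scalemxAr !mx_expandE -?scalemxAl -?scalemxAr ?mx_expandE -?scalemxAl.
rewrite !mx_entryE => h.
by apply/eqP; rewrite -subr_eq0 -oppr_eq0 -h; apply/eqP; ring.
Qed.
End NoncommutativeIdentities.

(* The algebra below only uses these properties of polynomials; abstracting them keeps
   the type checker from unfolding [mpoly]. [xP a b c] stands for Delta Omega_{ab}^c,
   [cf k] for the coefficient of x_0^k and [cfdeg k f] for "degree at most k in x_0". *)
Record xdata (K : numFieldType) (n' : nat) := XData {
  xA :> idomainType;
  xC : {rmorphism K -> xA};
  xX : 'I_n'.+1 -> xA;
  der : 'I_n'.+1 -> {additive xA -> xA};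
  cf : nat -> {additive xA -> xA};
  cfdeg : nat -> xA -> Prop;
  xP : 'I_n'.+1 -> 'I_n'.+1 -> 'I_n'.+1 -> xA;
  Delta : xA;
  d : 'I_n'.+1 -> nat;
  weuler := fun f : xA => \sum_a (d a)%:R * (xX a * der a f);
  derM : forall i f g, der i (f * g) = der i f * g + f * der i g;
  der_comm : forall i j f, der i (der j f) = der j (der i f);
  derX : forall i j, der i (xX j) = (i == j)%:R;
  derC : forall i z, der i (xC z) = 0;
  cfC : forall k z f, cf k (xC z * f) = xC z * cf k f;
  cf_X0 : forall k f, cf k.+1 (xX ord0 * f) = cf k f;
  cf_Xneq : forall k a f, a != ord0 -> cf k (xX a * f) = xX a * cf k f;
  cf_der : forall k a f, a != ord0 -> cf k (der a f) = der a (cf k f);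
  cf_X0_der0 : forall k f, cf k (xX ord0 * der ord0 f) = k%:R * cf k f;
  der0_cf : forall k f, der ord0 (cf k f) = 0;
  cf_big : forall k j f, cfdeg k f -> (k < j)%N -> cf j f = 0;
  cfdegM : forall k j f g, cfdeg k f -> cfdeg j g -> cfdeg (k + j) (f * g);
  cfM : forall k j f g, cfdeg k f -> cfdeg j g -> cf (k + j) (f * g) = cf k f * cf j g;
  cfdegB : forall k f g, cfdeg k f -> cfdeg k g -> cfdeg k (f - g);
  cfdegS : forall k f, cfdeg k.+1 f -> cf k.+1 f = 0 -> cfdeg k f;
  cfdeg_cf : forall k j f, cfdeg j (cf k f);
  cfdeg_ex : forall f, exists k, cfdeg k f;
  cfdeg_le : forall k j f, (k <= j)%N -> cfdeg k f -> cfdeg j f;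
  cfdeg_der : forall a k f, a != ord0 -> cfdeg k f -> cfdeg k (der a f);
  cfdeg0 : forall f, cfdeg 0 f -> f = cf 0 f;
  cf_det : forall m (M : 'M[xA]_m) k, (forall i j, cfdeg k (M i j)) ->
    cf (m * k) (\det M) = \det (map_mx (cf k) M) /\ cfdeg (m * k) (\det M);
  cf_monic_quot : forall k (D Q : xA) c, cfdeg k D -> cf k D = 1 ->
    forall j, cfdeg (j * k) (Q * D ^+ j) -> cf (j * k) (Q * D ^+ j) = c -> Q = c;
  weight_ge0 : forall f (p q : nat), weuler f = (p%:R - q%:R) * f -> f != 0 -> (q <= p)%N;
  xP_sym : forall a b c, xP a b c = xP b a c;
  xP_flat : forall a b c k, Delta * (der b (xP a k c) - der a (xP b k c))
    - \sum_i (xP a i c * xP b k i - xP b i c * xP a k i)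
    - (der b Delta * xP a k c - der a Delta * xP b k c) = 0;
  xP_euler : forall b c, \sum_a (d a)%:R * (xX a * xP a b c)
    = (b == c)%:R * (1 - (d c)%:R) * Delta;
  xP_weight : forall a b c, weuler (xP a b c) =
    ((n'.+1 * d ord0 + d c)%:R - (d a + d b)%:R) * xP a b c;
  Delta_weight : weuler Delta = (n'.+1 * d ord0)%:R * Delta;
  cfdeg_P : forall a b c, cfdeg n'.+1 (xP a b c);
  cfdeg_P0 : forall b c, cfdeg n' (xP ord0 b c);
  cfdeg_Delta : cfdeg n'.+1 Delta;
  cf_Delta : cf n'.+1 Delta = 1;
  Delta_neq0 : Delta != 0;
  d_sort : forall a b : 'I_n'.+1, (a <= b)%N -> (d b <= d a)%N;
  d_gt1 : forall a, (1 < d a)%N;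
  det_div : forall (al be : 'I_n'.+1 -> 'I_n'.+1) (q : 'I_n'.+1 -> 'I_n'.+1 -> xA),
    exists Q, \det (\matrix_(c, j) (xP (al j) (be j) c - Delta * q c j)) = Q * Delta ^+ n'
}.

Section Structure.
Variables (K : numFieldType) (n' : nat) (R : xdata K n').
Local Notation n := n'.+1.
Local Notation A := (xA R).
Local Notation P := (@xP K n' R).
Local Notation X := (@xX K n' R).
Local Notation der := (@der K n' R).
Local Notation cf := (@cf K n' R).
Local Notation cfdeg := (@cfdeg K n' R).
Local Notation Delta := (Delta R).
Local Notation d := (@d K n' R).
Local Notation E := (@weuler K n' R).
Local Notation C := (@xC K n' R).
Local Notation xP_sym := (@xP_sym K n' R).
Local Notation xP_flat := (@xP_flat K n' R).
Local Notation xP_euler := (@xP_euler K n' R).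
Local Notation xP_weight := (@xP_weight K n' R).
Local Notation cfdeg_P := (@cfdeg_P K n' R).
Local Notation cfdeg_P0 := (@cfdeg_P0 K n' R).
Local Notation d_sort := (@d_sort K n' R).
Local Notation d_gt1 := (@d_gt1 K n' R).
Local Notation det_div := (@det_div K n' R).

Lemma d_gt0 a : (0 < d a)%N. Proof. exact: ltnW (d_gt1 a). Qed.

Lemma natC (k : nat) : k%:R = C k%:R. Proof. by rewrite rmorph_nat. Qed.

Lemma C_neq0 z : z != 0 -> C z != 0.
Proof. by move=> z0; rewrite fmorph_eq0. Qed.

Lemma dA_neq0 a : (d a)%:R != 0 :> A.
Proof. by rewrite natC C_neq0 // pnatr_eq0 -lt0n d_gt0. Qed.

Lemma cf_nat k (m : nat) f : cf k (m%:R * f) = m%:R * cf k f.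
Proof. by rewrite natC cfC. Qed.

Lemma der_nat i (k : nat) : der i k%:R = 0. Proof. by rewrite natC derC. Qed.
Lemma der1 i : der i 1 = 0. Proof. exact: (der_nat i 1). Qed.

Lemma E_M f g : E (f * g) = E f * g + f * E g.
Proof.
rewrite /weuler mulr_suml mulr_sumr -big_split; apply: eq_bigr => a _ /=.
rewrite derM; ring.
Qed.
Lemma E_B f g : E (f - g) = E f - E g.
Proof. by rewrite /weuler -sumrB; apply: eq_bigr => a _; rewrite raddfB !mulrBr. Qed.
Lemma E_sum (I : finType) (f : I -> A) : E (\sum_i f i) = \sum_i E (f i).
Proof.
rewrite /weuler exchange_big /=; apply: eq_bigr => a _.
by rewrite raddf_sum !mulr_sumr.
Qed.

Lemma cf_weightB f (p q : nat) j : E f = (p%:R - q%:R) * f ->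
  E (cf j f) = (p%:R - q%:R - (d ord0 * j)%:R) * cf j f.
Proof.
move=> h; have := congr1 (cf j) h; rewrite mulrBl raddfB !cf_nat -mulrBl => h2.
rewrite mulrBl -h2.
rewrite /weuler raddf_sum (bigD1 ord0) //= der0_cf mulr0 mulr0 add0r.
rewrite [X in _ = X - _](bigD1 ord0) //= cf_nat cf_X0_der0 natrM -mulrA.
rewrite addrAC subrr add0r; apply: eq_bigr => a a0.
by rewrite cf_nat cf_Xneq // cf_der.
Qed.

Definition dmx i (M : 'M[A]_n) : 'M[A]_n := map_mx (der i) M.
Lemma dmxB i M M' : dmx i (M - M') = dmx i M - dmx i M'.
Proof. by apply/matrixP => c b; rewrite !mxE raddfB. Qed.
Lemma dmxZ i f M : dmx i (f *: M) = der i f *: M + f *: dmx i M.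
Proof. by apply/matrixP => c b; rewrite !mxE derM. Qed.
Lemma dmxM i M M' : dmx i (M *m M') = dmx i M *m M' + M *m dmx i M'.
Proof.
apply/matrixP => c b; rewrite !mxE raddf_sum -big_split; apply: eq_bigr => k _ /=.
by rewrite !mxE derM.
Qed.
Lemma dmx_sum i (I : finType) (F : I -> 'M[A]_n) : dmx i (\sum_k F k) = \sum_k dmx i (F k).
Proof.
apply: (big_morph (dmx i)) => [M M'|]; first by apply/matrixP => c b; rewrite !mxE raddfD.
by apply/matrixP => c b; rewrite !mxE raddf0.
Qed.

(** * The leading coefficients Gamma and N, and the existence of C *)

Definition Pm a : 'M[A]_n := \matrix_(c, b) P a b c.
Definition Gam a b c : A := cf n (P a b c).
Definition Gm a : 'M[A]_n := \matrix_(c, b) Gam a b c.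

Lemma Gam_sym a b c : Gam a b c = Gam b a c.
Proof. by rewrite /Gam xP_sym. Qed.
Lemma Gam0 b c : Gam ord0 b c = 0.
Proof. exact: cf_big (cfdeg_P0 b c) (ltnSn _). Qed.
Lemma Gm0 : Gm ord0 = 0.
Proof. by apply/matrixP => c b; rewrite !mxE Gam0. Qed.

Lemma Gam_weight a b c : E (Gam a b c) = ((d c)%:R - (d a + d b)%:R) * Gam a b c.
Proof.
rewrite (cf_weightB n (xP_weight a b c)); congr (_ * _).
by rewrite !(natrD, natrM); ring.
Qed.

(** Since d_a > 0, a nonzero Gamma_ab^c forces d_b < d_c; the triangularity arguments below rest on
    this. *)
Lemma Gam_neq0 a b c : Gam a b c != 0 -> (d a + d b <= d c)%N.
Proof. exact: weight_ge0 (Gam_weight a b c). Qed.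

(** The coefficient of x_0^(2n) in the flatness of P. Derivatives of Delta do not contribute, its
    leading coefficient being 1. The direction 0 is set apart because d/dx_0 lowers degrees; there
    Gamma_0 = 0 and nothing depends on x_0. *)
Lemma Gm_flat a b : dmx b (Gm a) - dmx a (Gm b) - (Gm a *m Gm b - Gm b *m Gm a) = 0.
Proof.
have dG0 e : dmx ord0 (Gm e) = 0.
  by apply/matrixP => c k; rewrite !mxE der0_cf.
have d0 e : dmx e (0 : 'M[A]_n) = 0 by apply/matrixP => c k; rewrite !mxE raddf0.
have [->|a0] := eqVneq a ord0.
  by rewrite Gm0 d0 dG0 mul0mx mulmx0 !subrr.
have [->|b0] := eqVneq b ord0.
  by rewrite Gm0 d0 dG0 mul0mx mulmx0 !subrr.
apply/matrixP => c k.
have dD e : e != ord0 -> cf n (der e Delta) = 0.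
  by move=> e0; rewrite cf_der // cf_Delta der1.
have cP := cfdeg_P; have cD := cfdeg_Delta R.
have cfB j f g : cf j (f - g) = cf j f - cf j g by exact: raddfB.
have := congr1 (cf (n + n)) (xP_flat a b c k); rewrite raddf0 !cfB (raddf_sum (cf (n + n))) /=.
rewrite mulrBr cfB (cfM cD (cfdeg_der b0 (cP a k c))) (cfM cD (cfdeg_der a0 (cP b k c))).
rewrite cf_Delta !mul1r (cf_der n (P a k c) b0) (cf_der n (P b k c) a0).
rewrite (cfM (cfdeg_der b0 cD) (cP a k c)) (cfM (cfdeg_der a0 cD) (cP b k c)).
rewrite !dD // !mul0r subrr subr0 => h; rewrite [RHS]mxE -[RHS]h !mxE; congr (_ - _).
rewrite -sumrB; apply: eq_bigr => i _.
by rewrite !mxE cfB !cfM.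
Qed.

(** The coefficient of 1 / x_0 in the expansion of Omega_0 at x_0 = infinity. *)
Definition N : 'M[A]_n := \matrix_(c, b) cf n' (P ord0 b c).
Definition GE : 'M[A]_n := \sum_a ((d a)%:R * X a) *: Gm a.
Definition Dm : 'M[A]_n := diag_mx (\row_a (d a)%:R).

Lemma GE_E c b : GE c b = \sum_a (d a)%:R * (X a * Gam a b c).
Proof. by rewrite /GE summxE; apply: eq_bigr => a _; rewrite !mxE mulrA. Qed.

Lemma DmE c b : Dm c b = (c == b)%:R * (d c)%:R.
Proof. by rewrite !mxE; case: eqP => [->|_]; rewrite ?mulr1n ?mul1r ?mulr0n ?mul0r. Qed.

(** The coefficient of x_0^n in the Euler identity, where the term a = 0 contributes d_0 N. It says
    that N is v |-> v / d_0 - nabla_v E. *)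
Lemma N_euler : (d ord0)%:R *: N = 1%:M - Dm - GE.
Proof.
apply/matrixP => c b; rewrite !mxBE GE_E DmE.
have := congr1 (cf n) (xP_euler b c).
have e1 : (b == c)%:R * (1 - (d c)%:R) = C ((b == c)%:R * (1 - (d c)%:R)).
  by rewrite rmorphM rmorphB rmorph1 !rmorph_nat.
rewrite {1}e1 cfC -e1 cf_Delta mulr1 raddf_sum (bigD1 ord0) //= cf_nat cf_X0.
have -> : \sum_(a | a != ord0) cf n ((d a)%:R * (X a * P a b c))
    = \sum_a (d a)%:R * (X a * Gam a b c).
  rewrite [RHS](bigD1 ord0) //= Gam0 !mulr0 add0r; apply: eq_bigr => a a0.
  by rewrite cf_nat cf_Xneq.
move/(canRL (addrK _)) => h; rewrite !mxE h eq_sym mulrBr mulr1.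
by case: eqP => [->|_]; rewrite ?mulr1n ?mulr0n ?mul1r ?mul0r.
Qed.

(** By [Gam_neq0] the entry (c, b) of [GE] vanishes unless d_b < d_c, so d_0 N is triangular with
    diagonal 1 - d_a. The values z = 0 and z = d_0 give the determinants of N and of 1 - N. *)
Lemma det_N_shift (z : K) : \det ((C z)%:M - (d ord0)%:R *: N)
  = C (\prod_a (z - 1 + (d a)%:R)).
Proof.
rewrite N_euler -det_tr det_trig; last first.
  apply/is_trig_mxP => i j ij; rewrite [LHS]mxE !mxBE GE_E DmE !mxE.
  rewrite eq_sym (_ : (i == j) = false); last by apply/eqP => e; rewrite e ltnn in ij.
  rewrite /= !mulr0n mul0r !subr0 !sub0r opprK; apply: big1 => a _.
  rewrite (_ : Gam a i j = 0) ?mulr0 //.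
  apply/eqP; apply: contraTT (d_sort (ltnW ij)) => /Gam_neq0 h; rewrite -ltnNge.
  by have := d_gt0 a; lia.
rewrite rmorph_prod; apply: eq_bigr => i _; rewrite [LHS]mxE !mxBE GE_E DmE !mxE eqxx !mulr1n mul1r.
rewrite big1 => [|a _].
  by rewrite subr0 /= rmorphD rmorphB rmorph1 rmorph_nat opprB addrA addrAC.
rewrite (_ : Gam a i i = 0) ?mulr0 //.
by apply/eqP/negPn/negP => /Gam_neq0; have := d_gt0 a; lia.
Qed.

Definition kap : K := \prod_a (1 - (d a)%:R) / (d ord0)%:R ^+ n.

Lemma dK_neq0 a : (d a)%:R != 0 :> K. Proof. by rewrite pnatr_eq0 -lt0n d_gt0. Qed.

Lemma kap_neq0 : kap != 0.
Proof.
rewrite /kap mulf_neq0 // ?invr_eq0 ?expf_neq0 ?dK_neq0 //.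
apply/prodf_neq0 => a _; rewrite subr_eq0 eq_sym -[1]/(1%:R) eqr_nat.
by rewrite gtn_eqF ?d_gt1.
Qed.

Lemma det_N : \det N = C kap.
Proof.
have h : (d ord0)%:R ^+ n * \det N = C (\prod_a (1 - (d a)%:R)).
  rewrite -detZ -[_ *: N]opprK -[- (_ *: N)]sub0r -(raddf0 (@scalar_mx A n)) -(rmorph0 C).
  rewrite -scaleN1r detZ det_N_shift -(rmorph1 C) -rmorphN -rmorphXn -rmorphM; congr (C _).
  have -> : (-1) ^+ n = \prod_(a < n) (-1) :> K by rewrite prodr_const card_ord.
  rewrite -big_split; apply: eq_bigr => a _ /=.
  by rewrite sub0r mulN1r opprD opprK.
apply: (mulfI (x := (d ord0)%:R ^+ n)); first by rewrite expf_neq0 ?dA_neq0.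
rewrite h natC -rmorphXn -rmorphM /kap mulrC divfK //.
by rewrite expf_neq0 ?dK_neq0.
Qed.

Lemma mx_cancel m (M : 'M[A]_n) (M' Q : 'M[A]_(n, m)) : \det M != 0 -> M *m M' = M *m Q -> M' = Q.
Proof.
move=> dM e; have := congr1 (mulmx (\adj M)) e.
rewrite !mulmxA mul_adj_mx !mul_scalar_mx => /matrixP h; apply/matrixP => i j.
by have := h i j; rewrite !mxE => /(mulfI dM).
Qed.

Lemma mx_cancelr m (M : 'M[A]_n) (M' Q : 'M[A]_(m, n)) : \det M != 0 -> M' *m M = Q *m M -> M' = Q.
Proof.
move=> dM /(congr1 trmx); rewrite !trmx_mul => /mx_cancel; rewrite det_tr => /(_ dM).
by move/(congr1 trmx); rewrite !trmxK.
Qed.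

Lemma detN_neq0 : \det N != 0. Proof. by rewrite det_N C_neq0 ?kap_neq0. Qed.

(** By [det_div] the determinant is Q Delta^(n-1). Its degree in x_0 is at most n (n - 1), that of
    Delta^(n-1), and its coefficient there is det N; hence Q is the constant [kap]. *)
Lemma det_P0 : \det (Pm ord0) = C kap * Delta ^+ n'.
Proof.
have [Q hQ] := det_div (fun _ => ord0) id (fun _ _ => 0).
have e : \det (Pm ord0) = Q * Delta ^+ n'.
  by rewrite -hQ; congr (\det _); apply/matrixP => c b; rewrite !mxE mulr0 subr0.
have [|h1 h2] := @cf_det _ _ R n (Pm ord0) n'; first by move=> c b; rewrite mxE; exact: cfdeg_P0.
have mn : map_mx (cf n') (Pm ord0) = N by apply/matrixP => c b; rewrite !mxE.
rewrite mn det_N e in h1; rewrite e in h2.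
rewrite mulnC in h1 h2; by rewrite e (cf_monic_quot (cfdeg_Delta R) (cf_Delta R) h2 h1).
Qed.

Lemma detP0_neq0 : \det (Pm ord0) != 0.
Proof. by rewrite det_P0 mulf_neq0 ?C_neq0 ?kap_neq0 ?expf_neq0 ?Delta_neq0. Qed.

Lemma adj_mul_det (M Y : 'M[A]_n) c b :
  (\adj M *m Y) c b = \det (\matrix_(i, j) (if j == c then Y i b else M i j)).
Proof.
rewrite (expand_det_col _ c) mxE; apply: eq_bigr => i _; rewrite !mxE eqxx mulrC; congr (_ * _).
rewrite /cofactor; congr (_ * \det _); apply/matrixP => p q; rewrite !mxE.
by rewrite eq_sym (negPf (neq_lift _ _)).
Qed.

(** Cramer's rule: an entry of the adjugate of P0 times Y is the determinant of P0 with one column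
    replaced by a column of Y, a multiple of Delta^(n-1) by [det_div]; and det P0 is Delta^(n-1) up
    to a constant. *)
Lemma C_exists a : exists M : 'M[A]_n, Pm ord0 *m M = Pm a - Delta *: Gm a.
Proof.
set Y := Pm a - Delta *: Gm a.
have h c b : exists Q, (\adj (Pm ord0) *m Y) c b = Q * Delta ^+ n'.
  have [Q hQ] := det_div (fun j => if j == c then a else ord0) (fun j => if j == c then b else j)
    (fun i j => if j == c then Gam a b i else 0).
  exists Q; rewrite adj_mul_det -hQ; congr (\det _); apply/matrixP => i j; rewrite !mxE.
  by case: eqP; rewrite ?mulr0 ?subr0.
have h2 cb : exists Q, (\adj (Pm ord0) *m Y) cb.1 cb.2 = Q * Delta ^+ n' by apply: h.
have [Q hQ] := fin_all_exists h2.
exists (\matrix_(c, b) (C kap^-1 * Q (c, b))).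
apply: (mx_cancel (M := \adj (Pm ord0))).
  have := congr1 determinant (mul_adj_mx (Pm ord0)); rewrite det_mulmx det_scalar => e.
  apply/eqP => a0; move/eqP: e; rewrite a0 mul0r eq_sym expf_eq0 (negPf detP0_neq0) andbF //.
rewrite mulmxA mul_adj_mx mul_scalar_mx; apply/matrixP => c b.
rewrite (hQ (c, b)) mxE [X in _ * X]mxE det_P0 mulrACA -rmorphM mulfV ?kap_neq0 //.
by rewrite rmorph1 mul1r mulrC.
Qed.

Lemma det_1N : exists2 z : K, z != 0 & \det (1%:M - N) = C z.
Proof.
exists (\prod_a ((d ord0)%:R - 1 + (d a)%:R) / (d ord0)%:R ^+ n).
  rewrite mulf_neq0 // ?invr_eq0 ?expf_neq0 ?dK_neq0 //.
  apply/prodf_neq0 => a _; rewrite addrAC subr_eq0 -natrD -[1]/(1%:R) eqr_nat.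
  by have := d_gt1 a; have := d_gt1 ord0; lia.
apply: (mulfI (x := (d ord0)%:R ^+ n)); first by rewrite expf_neq0 ?dA_neq0.
rewrite -detZ scalerBr scalemx1 {1}natC det_N_shift natC -rmorphXn -rmorphM.
by rewrite mulrC divfK // expf_neq0 ?dK_neq0.
Qed.

Lemma C_existsb a : exists M : 'M[A]_n, Pm ord0 *m M == Pm a - Delta *: Gm a.
Proof. by have [M h] := C_exists a; exists M; apply/eqP. Qed.

Definition Cm a : 'M[A]_n := xchoose (C_existsb a).

Lemma P0C a : Pm ord0 *m Cm a = Pm a - Delta *: Gm a.
Proof. exact/eqP/(xchooseP (C_existsb a)). Qed.

Lemma Cm0 : Cm ord0 = 1%:M.
Proof. by apply: (mx_cancel detP0_neq0); rewrite P0C Gm0 scaler0 subr0 mulmx1. Qed.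

Lemma Cm_sym a b c : Cm a c b = Cm b c a.
Proof.
suff e : col b (Cm a) = col a (Cm b) by have := congr1 (fun M : 'cV_n => M c 0) e; rewrite !mxE.
apply: (mx_cancel detP0_neq0); rewrite !colE !mulmxA !P0C -!colE; apply/colP => i.
by rewrite !mxE xP_sym Gam_sym.
Qed.

(** * Polynomials free of x_0 *)

Definition indep f := forall k, cf k.+1 f = 0.

Lemma indep_cfdeg f : indep f -> cfdeg 0 f.
Proof.
move=> h; have [k] := cfdeg_ex f; elim: k => // k IHk /cfdegS hk.
exact/IHk/hk/h.
Qed.
Lemma cfdeg_indep f : cfdeg 0 f -> indep f.
Proof. by move=> h k; apply: cf_big h _. Qed.
Lemma indepE f : indep f -> f = cf 0 f.
Proof. by move=> /indep_cfdeg /cfdeg0. Qed.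
Lemma indep_der0 f : indep f -> der ord0 f = 0.
Proof. by move=> /indepE ->; rewrite der0_cf. Qed.
Lemma indep0 : indep 0. Proof. by move=> k; rewrite raddf0. Qed.
Lemma indepD f g : indep f -> indep g -> indep (f + g).
Proof. by move=> hf hg k; rewrite raddfD hf hg addr0. Qed.
Lemma indepN f : indep f -> indep (- f).
Proof. by move=> hf k; rewrite raddfN hf oppr0. Qed.
Lemma indepM f g : indep f -> indep g -> indep (f * g).
Proof.
by move=> /indep_cfdeg hf /indep_cfdeg hg; apply: cfdeg_indep; apply: (cfdegM hf hg).
Qed.
Lemma indep_sum (I : Type) (r : seq I) (Q : pred I) (f : I -> A) :
  (forall i, Q i -> indep (f i)) -> indep (\sum_(i <- r | Q i) f i).
Proof. by move=> h; apply: big_ind => //; [exact: indep0 | exact: indepD]. Qed.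
Lemma indep_Cm z f : indep f -> indep (C z * f).
Proof. by move=> hf k; rewrite cfC hf mulr0. Qed.
Lemma indep_X a f : a != ord0 -> indep f -> indep (X a * f).
Proof. by move=> a0 hf k; rewrite cf_Xneq // hf mulr0. Qed.
Lemma indep_cf k f : indep (cf k f).
Proof. by apply: cfdeg_indep; apply: cfdeg_cf. Qed.
Lemma indep_der a f : indep f -> indep (der a f).
Proof.
have [->|a0] := eqVneq a ord0; first by move=> /indep_der0 ->; exact: indep0.
by move=> hf k; rewrite cf_der // hf raddf0.
Qed.

Definition indepm m q (M : 'M[A]_(m, q)) := forall c b, indep (M c b).
Lemma indepmD m q (M M' : 'M[A]_(m, q)) : indepm M -> indepm M' -> indepm (M + M').
Proof. by move=> h h' c b; rewrite mxE; apply: indepD. Qed.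
Lemma indepmB m q (M M' : 'M[A]_(m, q)) : indepm M -> indepm M' -> indepm (M - M').
Proof. by move=> h h' c b; rewrite !mxE; apply: indepD => //; apply: indepN. Qed.
Lemma indepmM m q s (M : 'M[A]_(m, q)) (M' : 'M[A]_(q, s)) :
  indepm M -> indepm M' -> indepm (M *m M').
Proof. by move=> h h' c b; rewrite mxE; apply: indep_sum => i _; apply: indepM. Qed.
Lemma indepm_dmx a M : indepm M -> indepm (dmx a M).
Proof. by move=> h c b; rewrite mxE; apply: indep_der. Qed.
Lemma indepm_dmx0 M : indepm M -> dmx ord0 M = 0.
Proof. by move=> h; apply/matrixP => c b; rewrite !mxE indep_der0. Qed.
Lemma indep1 : indep 1.
Proof.
by move=> k; rewrite -(cf_Delta R) (cf_big (cfdeg_cf _ 0 _)).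
Qed.
Lemma indepm1 : indepm (1%:M : 'M[A]_n).
Proof. by move=> c b; rewrite mxE; case: eqP => _; [exact: indep1 | exact: indep0]. Qed.

Lemma Gm_indep a : indepm (Gm a).
Proof. by move=> c b; rewrite mxE; apply: indep_cf. Qed.
Lemma N_indep : indepm N.
Proof. by move=> c b; rewrite mxE; apply: indep_cf. Qed.

Lemma indep_det m (M : 'M[A]_m) : indepm M -> indep (\det M).
Proof.
move=> h; have [|_ h2] := @cf_det _ _ R m M 0; first by move=> i j; exact: indep_cfdeg.
by rewrite muln0 in h2; apply: cfdeg_indep.
Qed.

Lemma indepm_adj (M : 'M[A]_n) : indepm M -> indepm (\adj M).
Proof.
move=> h c b; rewrite mxE /cofactor -signr_odd; apply: indepM.
  by case: odd; rewrite ?expr0 ?expr1; [apply: indepN|]; exact: indep1.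
by apply: indep_det => i j; rewrite !mxE.
Qed.

(** If C_a had degree k + 1 in x_0 with top coefficient L, then N L would be the coefficient of
    x_0^(n+k) in P_a - Delta Gamma_a. This is zero, by the degree bounds for k > 0 and by the
    definition of Gamma_a for k = 0; as det N is nonzero, L = 0. *)
Lemma Cm_indep a : indepm (Cm a).
Proof.
have [k hk] : exists k, forall c b, cfdeg k (Cm a c b).
  have h (cb : 'I_n * 'I_n) : exists k, cfdeg k (Cm a cb.1 cb.2) by apply: cfdeg_ex.
  have [k hk] := fin_all_exists h.
  exists (\max_cb k cb)%N => c b; apply: cfdeg_le (hk (c, b)).
  exact: (leq_bigmax (c, b)).
elim: k hk => [|k IHk] hk; first by move=> c b; apply: cfdeg_indep.
apply: IHk => c b; apply: cfdegS => //.
suff /matrixP/(_ c b) : map_mx (cf k.+1) (Cm a) = 0 by rewrite !mxE.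
apply: (mx_cancel detN_neq0); rewrite mulmx0; apply/matrixP => i j.
have := congr1 (cf (n' + k.+1)) (congr1 (fun M : 'M[_]_n => M i j) (P0C a)).
rewrite mxE (raddf_sum (cf _)) /= => e.
transitivity (cf (n' + k.+1) (P a j i) - cf (n' + k.+1) (Delta * Gam a j i)).
  rewrite -raddfB [RHS](_ : _ = cf (n' + k.+1) ((Pm a - Delta *: Gm a) i j)); last by rewrite !mxE.
  rewrite -e !mxE; apply: eq_bigr => s _; rewrite !mxE; symmetry; apply: cfM => //.
  exact: cfdeg_P0.
rewrite [RHS]mxE -addSnnS; case: k {hk e} => [|k].
  rewrite (cfM (cfdeg_Delta R) (indep_cfdeg (indep_cf _ _))) cf_Delta mul1r.
  by rewrite -(indepE (indep_cf _ _)) addn0 subrr.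
rewrite (cf_big (cfdeg_P a j i)); last by lia.
rewrite (cf_big (k := n + 0)) ?subrr //; last by lia.
exact: cfdegM (cfdeg_Delta R) (indep_cfdeg (indep_cf _ _)).
Qed.

(** * The matrix U of multiplication by E *)

Definition Um : 'M[A]_n := \sum_a (C ((d a)%:R / (d ord0)%:R) * X a) *: Cm a.
Definition Um' : 'M[A]_n := \sum_(a | a != ord0) (C ((d a)%:R / (d ord0)%:R) * X a) *: Cm a.

Lemma UmE : Um = (X ord0)%:M + Um'.
Proof.
by rewrite /Um (bigD1 ord0) //= divff ?dK_neq0 // rmorph1 mul1r Cm0 scalemx1.
Qed.

Lemma Um'_indep : indepm Um'.
Proof.
move=> c b; rewrite summxE; apply: indep_sum => a a0; rewrite mxE -mulrA.
by apply/indep_Cm/indep_X/Cm_indep.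
Qed.

(** P0 C_a = P_a - Delta Gamma_a is contracted with (d_a / d_0) x^a; the Euler identity evaluates
    the first term, and [N_euler] recognises the result. *)
Lemma P0U : Pm ord0 *m Um = Delta *: N.
Proof.
have h c b : (d ord0)%:R * (Pm ord0 *m Um) c b = (d ord0)%:R * (Delta *: N) c b.
  rewrite mulmx_sumr summxE mulr_sumr.
  transitivity (\sum_a ((d a)%:R * (X a * P a b c) - Delta * ((d a)%:R * (X a * Gam a b c)))).
    apply: eq_bigr => a _; rewrite -scalemxAr P0C !mxE.
    rewrite !mulrA natC -rmorphM mulrCA divff ?dK_neq0 // mulr1 rmorph_nat.
    ring.
  rewrite sumrB -mulr_sumr -GE_E xP_euler.
  have := congr1 (fun M : 'M[_]_n => M c b) N_euler; rewrite !mxBE DmE 3!mxE eq_sym => e.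
  rewrite [X in _ = _ * X]mxE mulrCA [_ * N c b](_ : _ = ((d ord0)%:R *: N) c b) ?mxE //.
  rewrite e; case: eqP => [->|_] /=; rewrite ?mulr1n ?mulr0n; ring.
by apply/matrixP => c b; apply: mulfI (h c b); rewrite dA_neq0.
Qed.

Lemma det_Um : \det Um = Delta.
Proof.
have := congr1 determinant P0U; rewrite det_mulmx detZ det_N det_P0 => e.
have k0 : C kap * Delta ^+ n' != 0 by rewrite -det_P0 detP0_neq0.
by apply: (mulfI k0); rewrite e exprSr; ring.
Qed.

Lemma P0_adj : Pm ord0 = N *m \adj Um.
Proof.
have d0 : \det Um != 0 by rewrite det_Um Delta_neq0.
by apply: (mx_cancelr d0); rewrite P0U -mulmxA mul_adj_mx det_Um mul_mx_scalar.
Qed.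

Lemma dmxD i M M' : dmx i (M + M') = dmx i M + dmx i M'.
Proof. by apply/matrixP => c b; rewrite !mxE raddfD. Qed.
Lemma dmx_scalar i f : dmx i f%:M = (der i f)%:M.
Proof. by apply/matrixP => c b; rewrite !mxE raddfMn. Qed.

(** N is nabla-parallel: when [N_euler] is differentiated, flatness exchanges d_a Gamma_e for d_e
    Gamma_a, and the contraction with d_e x^e becomes the weighted Euler operator, evaluated by
    [Gam_weight]. *)
Lemma dmxN a : dmx a N = N *m Gm a - Gm a *m N.
Proof.
have der_lin e (M : 'M[A]_n) : dmx e ((d ord0)%:R *: M) = (d ord0)%:R *: dmx e M.
  by rewrite dmxZ der_nat scale0r add0r.
have dinj (M M' : 'M[A]_n) : (d ord0)%:R *: M = (d ord0)%:R *: M' -> M = M'.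
  move=> /matrixP h; apply/matrixP => c b; have := h c b; rewrite !mxE; apply: mulfI.
  exact: dA_neq0.
apply: dinj; rewrite -der_lin scalerBr scalemxAl scalemxAr N_euler !dmxB dmx_scalar der1.
have -> : dmx a Dm = 0.
  apply/matrixP => c b; rewrite [LHS]mxE DmE derM.
  by case: eqP => _; rewrite ?der1 ?raddf0 ?der_nat !(mul0r, mulr0) addr0 mxE.
have -> : dmx a GE = (d a)%:R *: Gm a + (Dm *m Gm a - (d a)%:R *: Gm a - Gm a *m Dm)
    + GE *m Gm a - Gm a *m GE.
  rewrite /GE dmx_sum mulmx_suml mulmx_sumr.
  transitivity (\sum_e (((d e)%:R * (e == a)%:R) *: Gm e + ((d e)%:R * X e) *: dmx e (Gm a)
     + (((d e)%:R * X e) *: Gm e *m Gm a - Gm a *m (((d e)%:R * X e) *: Gm e)))).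
    apply: eq_bigr => e _; rewrite dmxZ derM der_nat mul0r add0r derX (eq_sym a).
    rewrite -addrA; congr (_ + _); rewrite -scalemxAl -scalemxAr -scalerBr -scalerDr.
    congr (_ *: _); have /matrixP h := Gm_flat e a; apply/matrixP => c b.
    by have := h c b; rewrite !mx_entryE; move=> h'; rewrite -[RHS]addr0 -h'; ring.
  rewrite big_split big_split /= sumrB addrA.
  congr (_ + _ + _ - _).
    rewrite (bigD1 a) //= eqxx mulr1 big1 ?addr0 // => e ea.
    by rewrite (negPf ea) mulr0 scale0r.
  apply/matrixP => c b; rewrite summxE.
  have := Gam_weight a b c; rewrite /weuler => h.
  transitivity (\sum_e (d e)%:R * (X e * der e (Gam a b c))).
    by apply: eq_bigr => e _; rewrite !mxE mulrA.
  rewrite h !mxBE mul_diag_mx mul_mx_diag !mxE natrD; ring.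
apply/matrixP => c b.
by rewrite !mx_expandE !mx_entryE mxE mul0rn; ring.
Qed.

Lemma dmxP0U a : Delta *: dmx a (Pm ord0) *m Um - der a Delta *: Pm ord0 *m Um
  = Delta *: (Delta *: dmx a N - Pm ord0 *m dmx a Um).
Proof.
have := congr1 (dmx a) P0U; rewrite dmxM dmxZ => /(congr1 (fun M => Delta *: M)).
rewrite -!scalemxAl P0U => /matrixP h; apply/matrixP => c b; have := h c b.
rewrite !mx_entryE => e; apply/eqP; rewrite -subr_eq0; apply/eqP.
move/eqP: e; rewrite -subr_eq0 => /eqP e; rewrite -[RHS]e; ring.
Qed.

(** * Powers of x_0 in the flatness of the natural connection *)

Lemma flat_mx a b : Delta *: (dmx b (Pm a) - dmx a (Pm b)) - (Pm a *m Pm b - Pm b *m Pm a)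
  - (der b Delta *: Pm a - der a Delta *: Pm b) = 0.
Proof.
apply/matrixP => c k; rewrite [RHS]mxE -[RHS](xP_flat a b c k) !mx_entryE.
have e i p q : Pm i p q = P i q p by rewrite mxE.
rewrite ![dmx _ _ _ _]mxE !e ![(_ *m _) _ _]mxE -sumrB; congr (_ - _ - _).
by apply: eq_bigr => i _; rewrite !e.
Qed.

Lemma PaE a : Pm a = Delta *: Gm a + Pm ord0 *m Cm a.
Proof. by rewrite P0C addrC subrK. Qed.

Lemma dmx0_Um : dmx ord0 Um = 1%:M.
Proof.
by rewrite UmE dmxD dmx_scalar derX eqxx (indepm_dmx0 Um'_indep) addr0.
Qed.

(* [Lm a] is Delta^2 times the derivative of P_0 / Delta. *)
Definition Lm a : 'M[A]_n := Delta *: dmx a (Pm ord0) - der a Delta *: Pm ord0.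

Lemma detU_neq0 : \det Um != 0. Proof. by rewrite det_Um Delta_neq0. Qed.

(** As d_0 U = 1 and d_0 N = 0, the derivative of Omega_0 = N U^-1 in x_0 is - N U^-2; the formula
    is this one times Delta^2. *)
Lemma L0 : Lm ord0 = - (Pm ord0 *m \adj Um).
Proof.
apply: (mx_cancelr detU_neq0); rewrite /Lm mulmxBl dmxP0U (indepm_dmx0 N_indep) dmx0_Um.
rewrite scaler0 sub0r mulmx1 scalerN mulNmx -mulmxA mul_adj_mx det_Um.
by rewrite mul_mx_scalar.
Qed.

Lemma flat0 a : Lm ord0 *m Cm a - Lm a - Delta *: (Gm a *m Pm ord0 - Pm ord0 *m Gm a)
  - (Pm ord0 *m Cm a *m Pm ord0 - Pm ord0 *m (Pm ord0 *m Cm a)) = 0.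
Proof.
have := flat_mx a ord0; rewrite {1 4}(PaE a) (PaE a) dmxD dmxZ dmxM.
rewrite (indepm_dmx0 (Gm_indep a)) (indepm_dmx0 (Cm_indep a)) /Lm => h; rewrite -[RHS]h.
apply/matrixP => c b; rewrite !mx_expandE -?scalemxAl -?scalemxAr !mx_entryE; ring.
Qed.

Lemma detX_neq0 (M : 'M[A]_n) z : z != 0 -> \det M = C z -> \det M != 0.
Proof. by move=> z0 ->; rewrite C_neq0. Qed.

Definition Ra a : 'M[A]_n := dmx a Um + Gm a *m Um - Um *m Gm a - Cm a *m N.

(** Without denominators, (1 - N) U^-1 C_a U = R_a. On the right the terms in x_0 cancel, which
    [Um_comm] exploits. *)
Lemma Ra_eq a : (1%:M - N) *m (\adj Um *m Cm a *m Um) = Delta *: Ra a.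
Proof.
apply: (mx_cancel detP0_neq0); apply: (Ra_identity (L := Lm a) P0U).
- by rewrite -P0_adj.
- by rewrite -dmxN -dmxP0U mulmxBl.
by rewrite -L0 flat0.
Qed.

(** U is x_0 plus terms free of x_0, so the coefficient of x_0 in the hypothesis reads M = M'. *)
Lemma Um_cfE (M : 'M[A]_n) : indepm M -> forall M' : 'M[A]_n, indepm M' ->
  M *m Um = Um *m M' -> M = M'.
Proof.
move=> hM M' hM' /matrixP h; apply/matrixP => c b; have := congr1 (cf 1) (h c b).
rewrite UmE !mx_expandE mul_scalar_mx mul_mx_scalar !mx_entryE !raddfD !cf_X0.
rewrite (indepmM hM Um'_indep) (indepmM Um'_indep hM') !addr0.
by rewrite -!indepE.
Qed.

(** With z = det (1 - N), a nonzero constant, [Ra_eq] becomes z C_a U = U M' where M' is free of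
    x_0; then M' = z C_a by [Um_cfE]. *)
Lemma Um_comm a : Um *m Cm a = Cm a *m Um.
Proof.
have [z z0 hz] := det_1N.
have hR : indepm (\adj (1%:M - N) *m Ra a).
  apply: indepmM; first by apply/indepm_adj/indepmB; [exact: indepm1 | exact: N_indep].
  rewrite /Ra UmE dmxD dmx_scalar derX !mx_expandE mul_scalar_mx mul_mx_scalar.
  have -> : (a == ord0)%:R%:M + dmx a Um' + (X ord0 *: Gm a + Gm a *m Um') -
     (X ord0 *: Gm a + Um' *m Gm a) - Cm a *m N
     = (a == ord0)%:R%:M + dmx a Um' + Gm a *m Um' - Um' *m Gm a - Cm a *m N.
    by apply/matrixP => c b; rewrite !mx_entryE; ring.
  apply: indepmB; last exact: indepmM (Cm_indep a) N_indep.
  apply: indepmB; last exact: indepmM Um'_indep (Gm_indep a).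
  apply: indepmD; last exact: indepmM (Gm_indep a) Um'_indep.
  apply: indepmD; last exact/indepm_dmx/Um'_indep.
  by case: eqP => _ c b; [exact: indepm1 | rewrite mxE mul0rn; exact: indep0].
have hC : indepm (C z *: Cm a) by move=> c b; rewrite mxE; apply/indep_Cm/Cm_indep.
have e : (C z *: Cm a) *m Um = Um *m (\adj (1%:M - N) *m Ra a).
  have := congr1 (mulmx (Um *m \adj (1%:M - N))) (Ra_eq a).
  rewrite !mulmxA -(mulmxA Um) mul_adj_mx hz mul_mx_scalar -!scalemxAl mul_mx_adj det_Um.
  rewrite !mul_scalar_mx -scalemxAr => /matrixP h; apply/matrixP => c b; have := h c b.
  rewrite -!scalemxAl !mxZE mulrCA; apply: mulfI; exact: Delta_neq0.
have e2 := Um_cfE hC hR e.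
move: e; rewrite -e2 -scalemxAl -scalemxAr => /matrixP h; apply/matrixP => c b.
by have := h c b; rewrite !mxZE => /(mulfI (C_neq0 z0)) ->.
Qed.

(** Once U and C_a commute, [Ra_eq] reduces to (1 - N) C_a = R_a. *)
Lemma nabla_Um a : dmx a Um + Gm a *m Um - Um *m Gm a = Cm a + Cm a *m N - N *m Cm a.
Proof.
have := Ra_eq a; rewrite -(mulmxA (\adj Um)) -Um_comm (mulmxA (\adj Um)) mul_adj_mx det_Um mul_scalar_mx.
rewrite -scalemxAr => /matrixP h; apply/matrixP => c b.
have := mulfI (Delta_neq0 R) (etrans (esym (mxZE _ _ _ _)) (etrans (h c b) (mxZE _ _ _ _))).
rewrite /Ra !mx_expandE !mx_entryE => e.
by have := canRL (subrK _) e; move=> ->; ring.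
Qed.

Definition Zm a b : 'M[A]_n := dmx b (Cm a) + Gm b *m Cm a - Cm a *m Gm b.

Lemma flat_ab a b : Pm ord0 *m ((1%:M - N) *m \adj Um *m (Cm b *m Cm a - Cm a *m Cm b))
  = Pm ord0 *m (Delta *: (Zm a b - Zm b a)).
Proof.
have Le e : Lm e = - (Pm ord0 *m \adj Um *m Cm e)
    - Delta *: (Gm e *m Pm ord0 - Pm ord0 *m Gm e)
    - (Pm ord0 *m Cm e *m Pm ord0 - Pm ord0 *m Pm ord0 *m Cm e).
  have /matrixP h := flat0 e; apply/matrixP => c k; have := h c k.
  rewrite L0 !mx_expandE !mx_entryE => e1; rewrite -[LHS]addr0 -e1; ring.
have hG := Gm_flat a b; have hL := flat_mx a b.
apply: (flat_identity (esym P0_adj) (Le a) (Le b)).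
have -> : Gm a *m Gm b - Gm b *m Gm a = dmx b (Gm a) - dmx a (Gm b).
  by apply/eqP; rewrite eq_sym -subr_eq0 hG.
rewrite [Lm b]/Lm [Lm a]/Lm (flat_expand _ _ _ _ _ _ (Gm a) (Gm b)) -!dmxM -!dmxZ -!dmxD -!PaE -[RHS]hL.
by apply/matrixP => c k; rewrite !mx_entryE; ring.
Qed.

(** For Y the commutator and Z the antisymmetrised nabla C, [flat_ab] and the commutation of Y with
    U give (1 - N) Y = Z U, with Y, Z, N free of x_0. The coefficient of x_0 gives Z = 0, and then Y
    = 0 since det (1 - N) is nonzero. *)
Lemma nabla_C_comm a b : Zm a b = Zm b a /\ Cm a *m Cm b = Cm b *m Cm a.
Proof.
have := mx_cancel detP0_neq0 (flat_ab a b); set Y := Cm b *m _ - _; set Z := _ - Zm b a => h.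
have YU : Y *m Um = Um *m Y.
  have c2 i j : Cm i *m Cm j *m Um = Um *m (Cm i *m Cm j).
    by rewrite -mulmxA -Um_comm !mulmxA -Um_comm.
  by rewrite /Y mulmxBl mulmxBr !c2.
have e : (1%:M - N) *m Y = Z *m Um.
  have := congr1 (mulmx^~ Um) h; rewrite -!mulmxA YU (mulmxA (\adj Um)) mul_adj_mx det_Um.
  rewrite mul_scalar_mx -scalemxAr -scalemxAl => /matrixP h2; apply/matrixP => c k.
  by have := h2 c k; rewrite !mxZE => /(mulfI (Delta_neq0 R)).
have hY : indepm Y by apply: indepmB; apply: indepmM; apply: Cm_indep.
have hZm i j : indepm (Zm i j).
  apply: indepmB; last exact: indepmM (Cm_indep _) (Gm_indep _).
  by apply: indepmD; [exact/indepm_dmx/Cm_indep | exact: indepmM (Gm_indep _) (Cm_indep _)].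
have hZ : indepm Z by apply: indepmB.
have Z0 : Z = 0.
  clearbody Y Z; apply/matrixP => c b'; have := congr1 (fun M : 'M[_]_n => cf 1 (M c b')) e.
  rewrite UmE (mulmxDr Z) mul_mx_scalar mxDE mxZE raddfD cf_X0 -(indepE (hZ _ _)).
  rewrite (indepmM hZ Um'_indep) addr0 => <-; rewrite mx0E.
  by apply: indepmM => //; apply: indepmB; [exact: indepm1 | exact: N_indep].
split; first by apply/eqP; rewrite -subr_eq0; apply/eqP.
have [z z0 hz] := det_1N.
rewrite Z0 mul0mx -(mulmx0 _ (1%:M - N)) in e; have := mx_cancel (detX_neq0 z0 hz) e.
by move=> h0; apply/eqP; rewrite eq_sym -subr_eq0; apply/eqP.
Qed.
(** The weighted Euler operator is applied to P0 C_a = P_a - Delta Gamma_a, all other weights being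
    known, and P0 is cancelled. *)
Lemma Cm_weight a b c : E (Cm a c b) = ((d c + d ord0)%:R - (d a + d b)%:R) * Cm a c b.
Proof.
pose w := (n * d ord0)%:R : A.
have E_DG i j : E (Delta * Gam a j i) = (w + (d i)%:R - (d a)%:R - (d j)%:R) * (Delta * Gam a j i).
  by rewrite E_M Delta_weight Gam_weight (natrD _ (d a)) -/w; ring.
have E_P i j : E (P ord0 j i) = (w + (d i)%:R - (d ord0)%:R - (d j)%:R) * P ord0 j i.
  by rewrite xP_weight (natrD _ (d ord0)) (natrD _ _ (d i)) -/w; ring.
have E_R i j : E ((Pm a - Delta *: Gm a) i j)
    = (w + (d i)%:R - (d a)%:R - (d j)%:R) * (Pm a - Delta *: Gm a) i j.
  by rewrite !mx_entryE !mxE E_B E_DG xP_weight (natrD _ (d a)) (natrD _ _ (d i)) -/w; ring.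
pose M : 'M[A]_n := \matrix_(i, j) (E (Cm a i j)
  - ((d i)%:R + (d ord0)%:R - (d a)%:R - (d j)%:R) * Cm a i j).
suff : M = 0.
  move/matrixP/(_ c b); rewrite !mxE => /eqP; rewrite subr_eq0 => /eqP ->.
  by rewrite !natrD; ring.
apply: (mx_cancel detP0_neq0); rewrite mulmx0; apply/matrixP => i j.
have := E_R i j; rewrite -P0C mxE E_sum => /eqP; rewrite -subr_eq0 => /eqP e.
rewrite [RHS]mxE -[RHS]e mxE mulr_sumr -sumrB; apply: eq_bigr => s _.
rewrite E_M !mxE E_P; ring.
Qed.

(** * Flat coordinates by homogeneous integration *)

Lemma poincare (eta : 'I_n -> A) (k : nat) : (0 < k)%N ->
  (forall a b, der a (eta b) = der b (eta a)) ->
  (forall a, E (eta a) = (k%:R - (d a)%:R) * eta a) ->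
  exists f, (forall a, der a f = eta a) /\ E f = k%:R * f.
Proof.
(* The primitive is the contraction of the closed form with the weighted Euler field, divided by its
   weight k. *)
move=> k0 cl hE; pose g := \sum_a (d a)%:R * (X a * eta a).
have kK : k%:R != 0 :> K by rewrite pnatr_eq0 -lt0n.
have Ck : C k%:R^-1 * k%:R = 1 by rewrite natC -rmorphM mulVf ?rmorph1.
have hg a : der a g = k%:R * eta a.
  rewrite /g raddf_sum /= -[RHS](subrK ((d a)%:R * eta a)) -mulrBl -hE /weuler.
  transitivity (\sum_i ((d i)%:R * (X i * der i (eta a)) + (d i)%:R * (a == i)%:R * eta i)).
    apply: eq_bigr => i _; rewrite !derM der_nat derX (cl a i); ring.
  rewrite big_split /=; congr (_ + _); rewrite (bigD1 a) //= eqxx mulr1 big1 ?addr0 // => i ia.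
  by rewrite eq_sym (negPf ia) mulr0 mul0r.
have hf a : der a (C k%:R^-1 * g) = eta a.
  by rewrite derM derC mul0r add0r hg mulrA Ck mul1r.
exists (C k%:R^-1 * g); split=> //.
rewrite /weuler mulrA [k%:R * _]mulrC Ck mul1r; apply: eq_bigr => a _.
by rewrite hf.
Qed.

Lemma Gam_der_flat a b c k : der b (Gam a k c) + \sum_i Gam b i c * Gam a k i
  = der a (Gam b k c) + \sum_i Gam a i c * Gam b k i.
Proof.
have := congr1 (fun M : 'M[_]_n => M c k) (Gm_flat a b); rewrite !mx_entryE => h.
have eG p q : (Gm p *m Gm q) c k = \sum_i Gam p i c * Gam q k i.
  by rewrite mxE; apply: eq_bigr => i _; rewrite !mxE.
rewrite !eG ![dmx _ _ _ _]mxE ![Gm _ _ _]mxE in h.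
move: (\sum_i Gam a i c * Gam b k i) (\sum_i Gam b i c * Gam a k i) h => s1 s2 h.
by apply/eqP; rewrite -subr_eq0 -[X in _ == X]h; apply/eqP; ring.
Qed.

Lemma flat_coframe c m : exists w : 'I_n -> A, forall b, (d c <= d b + m)%N ->
  [/\ E (w b) = ((d c)%:R - (d b)%:R) * w b,
      forall a, der a (w b) = \sum_e Gam a b e * w e
    & (d c <= d b)%N -> w b = (b == c)%:R].
Proof.
elim: m => [|m [w hw]].
  exists (fun b => (b == c)%:R) => b; rewrite addn0 => cb; split=> //.
    case: eqP => [->|_]; last by rewrite mulr0 /weuler big1 // => a _; rewrite raddf0 !mulr0.
    by rewrite subrr mul0r /weuler big1 // => a _; rewrite der_nat !mulr0.
  move=> a; rewrite der_nat big1 // => e _; case: eqP => [->|_]; last by rewrite mulr0.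
  rewrite mulr1; apply/eqP/negPn/negP => /Gam_neq0.
  by have := d_gt0 a; lia.
have hG a b e : (d c <= d b + m.+1)%N -> Gam a b e != 0 -> (d c <= d e + m)%N.
  by move=> ? /Gam_neq0; have := d_gt0 a; lia.
have hnew b : d c = (d b + m.+1)%N -> exists f,
    (forall a, der a f = \sum_e Gam a b e * w e) /\ E f = m.+1%:R * f.
  move=> eb; apply: poincare => // [a a'|a].
    transitivity (\sum_f (der a (Gam a' b f) + \sum_e Gam a e f * Gam a' b e) * w f).
      transitivity (\sum_e (der a (Gam a' b e) * w e
          + \sum_f Gam a e f * Gam a' b e * w f)).
        rewrite raddf_sum; apply: eq_bigr => e _ /=; rewrite derM; congr (_ + _).
        have [->|g0] := eqVneq (Gam a' b e) 0.
          by rewrite mul0r big1 // => f _; rewrite mulr0 mul0r.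
        have [|_ -> _] := hw e; first by apply: hG g0; rewrite eb.
        by rewrite mulr_sumr; apply: eq_bigr => f _; ring.
      rewrite big_split /= exchange_big /= -big_split; apply: eq_bigr => f _ /=.
      by rewrite mulrDl mulr_suml.
    transitivity (\sum_f (der a' (Gam a b f) + \sum_e Gam a' e f * Gam a b e) * w f).
      by apply: eq_bigr => f _; rewrite Gam_der_flat.
    transitivity (\sum_e (der a' (Gam a b e) * w e
        + \sum_f Gam a' e f * Gam a b e * w f)).
      rewrite big_split /= [X in _ = _ + X]exchange_big /= -big_split; apply: eq_bigr => f _ /=.
      by rewrite mulrDl mulr_suml.
    rewrite raddf_sum; apply: eq_bigr => e _ /=; rewrite derM; congr (_ + _).
    have [->|g0] := eqVneq (Gam a b e) 0.
      by rewrite mul0r big1 // => f _; rewrite mulr0 mul0r.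
    have [|_ -> _] := hw e; first by apply: hG g0; rewrite eb.
    by rewrite mulr_sumr; apply: eq_bigr => f _; ring.
  rewrite E_sum mulr_sumr; apply: eq_bigr => e _.
  have [->|g0] := eqVneq (Gam a b e) 0.
    by rewrite mul0r mulr0 /weuler big1 // => f _; rewrite raddf0 !mulr0.
  have [|hE _ _] := hw e; first by apply: hG g0; rewrite eb.
  rewrite E_M Gam_weight hE eb !natrD; ring.
(* Components of weight at most m are kept; those of weight m + 1 are the new primitives. *)
have h b : exists f, [/\ (d c <= d b + m)%N -> f = w b
   & d c = (d b + m.+1)%N -> 
     (forall a, der a f = \sum_e Gam a b e * w e) /\ E f = m.+1%:R * f].
  have [eb|nb] := eqVneq (d c) (d b + m.+1)%N; last first.
    by exists (w b); split=> // eb; rewrite eb eqxx in nb.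
  have [f hf] := hnew b eb; exists f; split=> // le; exfalso; lia.
have [w' hw'] := fin_all_exists h.
exists w' => b hb.
have ew a : \sum_e Gam a b e * w' e = \sum_e Gam a b e * w e.
  apply: eq_bigr => e _; have [->|g0] := eqVneq (Gam a b e) 0; first by rewrite !mul0r.
  by have [-> //] := hw' e; apply: hG g0.
have [le|lt] := leqP (d c) (d b + m)%N.
  have [-> // _] := hw' b; have [h1 h2 h3] := hw b le.
  by split=> // a; rewrite ew h2.
have eb : d c = (d b + m.+1)%N by lia.
have [_ /(_ eb) [h1 h2]] := hw' b; split.
- by rewrite h2 eb natrD addrAC subrr add0r.
- by move=> a; rewrite ew h1.
- by move=> le; exfalso; lia.
Qed.

(** The parallel 1-form is closed by the symmetry of Gamma and has positive weight d_c, so it can be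
    integrated in turn. *)
Lemma flat_coordinate c : exists T : A, [/\ E T = (d c)%:R * T,
   forall a b, der a (der b T) = \sum_e Gam a b e * der e T
 & forall b, (d c <= d b)%N -> der b T = (b == c)%:R].
Proof.
have [w hw] := flat_coframe c (d c).
have hw' b := hw b (leq_addl _ _).
have [||T [hT hE]] := @poincare w (d c) (d_gt0 c).
- move=> a b; have [_ -> _] := hw' a; have [_ -> _] := hw' b.
  by apply: eq_bigr => e _; rewrite Gam_sym.
- by move=> a; have [-> _ _] := hw' a.
exists T; split=> // [a b|b le].
  by rewrite hT; have [_ -> _] := hw' b; apply: eq_bigr => e _; rewrite hT.
by rewrite hT; have [_ _ ->] := hw' b.
Qed.

End Structure.
End SaitoAlgebra.

Lemma mpoly_natZ (K : nzRingType) n (k : nat) (f : mpoly n K) : k%:R * f = k%:R *: f.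
Proof. by rewrite -mul_mpolyC mpolyC_nat. Qed.

(* [P a b c] is Delta Omega_{ab}^c; the matrices [Gm a], [Cm a], [U] and [N] are those of
   Gamma_a, of the product by the a-th coordinate field, of the product by E, and of
   v |-> r v - nabla_v E. The field [sp_flat_coordinate] gives the flat coordinate of
   degree d_c. *)
Record saito_polys (K : numFieldType) (n' : nat) (P : 'I_n'.+1 -> 'I_n'.+1 -> 'I_n'.+1 -> mpoly n'.+1 K)
    (D : mpoly n'.+1 K) (d : 'I_n'.+1 -> nat) (Gm Cm : 'I_n'.+1 -> 'M[mpoly n'.+1 K]_n'.+1)
    (N U : 'M[mpoly n'.+1 K]_n'.+1) : Prop := SaitoPolys {
  sp_d : forall a, (0 < d a)%N;
  sp_P_sym : forall a b c, P a b c = P b a c;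
  sp_P_flat : forall a b, D *: (map_mx (mderiv b) (\matrix_(c, e) P a e c)
      - map_mx (mderiv a) (\matrix_(c, e) P b e c))
    - ((\matrix_(c, e) P a e c) *m (\matrix_(c, e) P b e c)
      - (\matrix_(c, e) P b e c) *m (\matrix_(c, e) P a e c))
    - (mderiv b D *: (\matrix_(c, e) P a e c) - mderiv a D *: (\matrix_(c, e) P b e c)) = 0;
  sp_P_euler : forall b c, \sum_a (d a)%:R * ('x_a * P a b c) = (b == c)%:R * (1 - (d c)%:R) * D;
  sp_det_P0 : \det (\matrix_(c, e) P ord0 e c) != 0;
  sp_det_N : exists2 z : K, z != 0 & \det N = mpolyC n'.+1 z;
  sp_Gm : forall a c b, Gm a c b = cf n'.+1 (P a b c);
  sp_Gm0 : Gm ord0 = 0;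
  sp_Gm_flat : forall a b, map_mx (mderiv b) (Gm a) - map_mx (mderiv a) (Gm b)
    - (Gm a *m Gm b - Gm b *m Gm a) = 0;
  sp_PC : forall a, (\matrix_(c, e) P ord0 e c) *m Cm a = (\matrix_(c, e) P a e c) - D *: Gm a;
  sp_Cm0 : Cm ord0 = 1%:M;
  sp_Cm_sym : forall a b c, Cm a c b = Cm b c a;
  sp_Cm_nabla : forall a b, map_mx (mderiv b) (Cm a) + Gm b *m Cm a - Cm a *m Gm b
    = map_mx (mderiv a) (Cm b) + Gm a *m Cm b - Cm b *m Gm a;
  sp_Cm_comm : forall a b, Cm a *m Cm b = Cm b *m Cm a;
  sp_Cm_weight : forall a b c, \sum_i (d i)%:R * ('x_i * mderiv i (Cm a c b))
    = ((d c + d ord0)%:R - (d a + d b)%:R) * Cm a c b;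
  sp_U : U = \sum_a (mpolyC n'.+1 ((d a)%:R / (d ord0)%:R) * 'x_a) *: Cm a;
  sp_PU : (\matrix_(c, e) P ord0 e c) *m U = D *: N;
  sp_det_U : \det U = D;
  sp_U_comm : forall a, U *m Cm a = Cm a *m U;
  sp_U_nabla : forall a, map_mx (mderiv a) U + Gm a *m U - U *m Gm a = Cm a + Cm a *m N - N *m Cm a;
  sp_U_der0 : map_mx (mderiv ord0) U = 1%:M;
  sp_N_nabla : forall a, map_mx (mderiv a) N = N *m Gm a - Gm a *m N;
  sp_N : (d ord0)%:R *: N = 1%:M - diag_mx (\row_a (d a)%:R) - \sum_a ((d a)%:R * 'x_a) *: Gm a;
  sp_flat_coordinate : forall c, exists T : mpoly n'.+1 K, [/\
     \sum_a (d a)%:R * ('x_a * mderiv a T) = (d c)%:R * T,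
     forall a b, mderiv a (mderiv b T) = \sum_e Gm a e b * mderiv e T
   & forall b, (d c <= d b)%N -> mderiv b T = (b == c)%:R]
}.

(** * The polynomial data of a reflection group *)

Section Glue.
Variables (K : numClosedFieldType) (n' : nat).
Local Notation n := n'.+1.
Local Notation Pol := (mpoly n K).
Variable G : seq 'M[K]_n.
Hypotheses (G_uniq : uniq G) (G1 : 1%:M \in G)
  (GM : forall g h, g \in G -> h \in G -> g *m h \in G)
  (GU : forall g, g \in G -> g \in unitmx)
  (GV : forall g, g \in G -> invmx g \in G).
Variable x : n.-tuple Pol.
Hypothesis x_inv : forall a, grp_invariant G (tnth x a).
Hypothesis x_gen : forall f, grp_invariant G f -> exists P, f = comp_mpoly x P.
Variables (F : fieldType) (iota : {rmorphism Pol -> F}).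
Hypothesis ii : injective iota.
Variable D : Pol.
Hypothesis delta_div : forall l, l != 0 -> (1 < size (stab G l))%N ->
  exists q, comp_mpoly x D = lin l ^+ size (stab G l) * q.
Variable d : 'I_n -> nat.
Hypotheses (x_euler : forall a, euler (tnth x a) = (d a)%:R *: tnth x a)
  (d_sort : forall a b : 'I_n, (a <= b)%N -> (d b <= d a)%N)
  (d_gt1 : forall a, (1 < d a)%N).
Variable w0 : nat.
Hypotheses (D_euler : euler (comp_mpoly x D) = w0%:R *: comp_mpoly x D)
  (D_supp : forall m, m \in msupp D -> (m ord0 <= n)%N)
  (D_monic : cf n D = 1).

Local Notation x_comp_inj := (comp_mpoly_inj G1 GM GU GV x_gen).
Local Notation x_jac := (row_mul_jac_eq0 G1 GM GU GV x_gen).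
Local Notation OmegaV := (OmegaV x iota).

Lemma D_neq0 : D != 0.
Proof. by apply/eqP => D0; move/eqP: D_monic; rewrite D0 cf0 eq_sym oner_eq0. Qed.

(** Delta Omega is polynomial in u by [delta_OmegaV] and invariant by [hess_invariant]. *)
Lemma xP_exists a b c : exists P : Pol, iota (comp_mpoly x D) * OmegaV a b c = iota (comp_mpoly x P).
Proof.
have [f hf] := fin_all_exists (fun ab : 'I_n * 'I_n => 
   delta_OmegaV G_uniq G1 GM GU GV x_inv x_gen ii delta_div ab.1 ab.2 c).
have [P hP] : exists P, f (a, b) = comp_mpoly x P.
  apply: x_gen; apply: (hess_invariant (delta := comp_mpoly x D) (c := c) G1 GM GU GV x_inv x_gen
    (f := fun a b => f (a, b))).
    exact: comp_mpoly_invariant.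
  move=> i j; apply: ii; rewrite rmorphN rmorphM -mulrN.
  rewrite -(OmegaV_rel G1 GM GU GV x_gen ii) mulr_sumr rmorph_sum.
  apply: eq_bigr => p _; rewrite mulr_sumr rmorph_sum; apply: eq_bigr => q _.
  by rewrite !rmorphM -(hf (p, q)) /= mulrCA.
by exists P; rewrite (hf (a, b)) hP.
Qed.

Variable P : 'I_n -> 'I_n -> 'I_n -> Pol.
Hypothesis hP : forall a b c, iota (comp_mpoly x D) * OmegaV a b c = iota (comp_mpoly x (P a b c)).

Lemma P_rel c i j : hsum x (fun a b => P a b c) i j = - (comp_mpoly x D * mderiv i (mderiv j (tnth x c))).
Proof.
apply: ii; rewrite rmorphN rmorphM -mulrN.
rewrite -(OmegaV_rel G1 GM GU GV x_gen ii) mulr_sumr rmorph_sum.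
apply: eq_bigr => p _; rewrite mulr_sumr rmorph_sum; apply: eq_bigr => q _.
by rewrite !rmorphM -hP /= mulrCA.
Qed.

(** Each of the n columns is Delta times one in [delta_det_OmegaV], whose determinant needs a single
    Delta; Delta^(n-1) splits off. *)
Lemma P_det_div (al be : 'I_n -> 'I_n) (q : 'I_n -> 'I_n -> Pol) :
  exists Q, \det (\matrix_(c, j) (P (al j) (be j) c - D * q c j)) = Q * D ^+ n'.
Proof.
have [f hf] := delta_det_OmegaV G_uniq G1 GM GU GV x_inv x_gen ii delta_div al be (fun c j => comp_mpoly x (q c j)).
apply: (descent G1 GM GU GV x_inv x_gen (q := f)); first by rewrite expf_neq0 ?D_neq0.
apply: ii; rewrite !rmorphM -hf rmorphXn -det_map_mx -det_map_mx.
set M := \matrix_(c, j) (OmegaV _ _ _ - _).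
have -> : map_mx iota (map_mx (comp_mpoly x) (\matrix_(c, j) (P (al j) (be j) c - D * q c j)))
   = iota (comp_mpoly x D) *: M.
  apply/matrixP => c j; rewrite !mxE mulrBr hP -rmorphM -rmorphB; congr (iota _).
  by rewrite rmorphB rmorphM.
by rewrite detZ exprS rmorphXn mulrAC.
Qed.

Lemma weulerE (f : Pol) : \sum_a (d a)%:R * ('x_a * mderiv a f) = weuler d f.
Proof. by apply: eq_bigr => a _; rewrite mpoly_natZ. Qed.

Lemma xP_weight a b c : \sum_i (d i)%:R * ('x_i * mderiv i (P a b c)) =
  ((n'.+1 * d ord0 + d c)%:R - (d a + d b)%:R) * P a b c.
Proof.
rewrite weulerE (P_weight x_jac x_comp_inj x_euler P_rel D_euler).
rewrite (w0E x_comp_inj x_euler D_euler D_monic) -addrA -opprD -natrD -natrD.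
by rewrite -mul_mpolyC mpolyCB !mpolyC_nat.
Qed.

Lemma xP_euler b c : \sum_a (d a)%:R * ('x_a * P a b c) = (b == c)%:R * (1 - (d c)%:R) * D.
Proof.
under eq_bigr => a _ do rewrite mpoly_natZ.
rewrite (P_euler x_jac x_comp_inj x_euler P_rel) -mul_mpolyC mpolyCM mpolyCB mpolyC1.
by rewrite !mpolyC_nat.
Qed.

Lemma xweight_ge0 (f : Pol) (p q : nat) :
  \sum_a (d a)%:R * ('x_a * mderiv a f) = (p%:R - q%:R) * f -> f != 0 -> (q <= p)%N.
Proof.
rewrite weulerE => h f0.
have h2 : weuler d f = (p%:R - q%:R) *: f by rewrite h -mul_mpolyC mpolyCB !mpolyC_nat.
by have <- := weight_supp h2 (mlead_supp f0); rewrite leq_addl.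
Qed.

Lemma xDelta_weight : \sum_a (d a)%:R * ('x_a * mderiv a D) = (n'.+1 * d ord0)%:R * D.
Proof.
rewrite weulerE (Delta_weuler x_comp_inj x_euler D_euler).
by rewrite (w0E x_comp_inj x_euler D_euler D_monic) mpoly_natZ.
Qed.

Lemma xcfC k z (f : Pol) : cf k (mpolyC n z * f) = mpolyC n z * cf k f.
Proof. by rewrite !mul_mpolyC cfZ. Qed.

Lemma xcf_X0_der0 k (f : Pol) : cf k ('x_ord0 * mderiv ord0 f) = k%:R * cf k f.
Proof. by rewrite cf_X0_mderiv0 mpoly_natZ. Qed.

Lemma cf_is_zmod k : zmod_morphism (@cf K n' k).
Proof. by move=> f g; rewrite cfB. Qed.
HB.instance Definition _ k := GRing.isZmodMorphism.Build Pol Pol (@cf K n' k) (cf_is_zmod k).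

Definition xd : SaitoAlgebra.xdata K n' :=
  @SaitoAlgebra.XData K n' Pol (@mpolyC n K) (fun a => 'x_a) (@mderiv n K) (@cf K n') (@cfdeg K n')
  P D d (@mderivM n K) (fun i j f => @mderiv_comm n K j i f) (@mderivX1 K n) (@mderivC n K) xcfC (@cf_X0 K n')
  (@cf_Xneq K n') (@cf_mderiv K n') xcf_X0_der0 (@mderiv0_cf K n') (@cf_big K n')
  (@cfdegM K n') (@cfM K n') (@cfdegB K n') (@cfdegS K n') (@cfdeg_cf K n') (@cfdeg_ex K n') (@cfdeg_le K n')
  (@cfdeg_mderiv K n') (@cfdeg0 K n') (@cf_det K n') (@cf_monic_quot K n') xweight_ge0
  (P_sym x_jac x_comp_inj P_rel) (P_flat x_jac x_comp_inj P_rel) xP_euler xP_weight xDelta_weight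
  (cfdeg_P x_jac x_comp_inj x_euler P_rel D_euler d_sort d_gt1 D_monic)
  (cfdeg_P0 x_jac x_comp_inj x_euler P_rel D_euler d_sort d_gt1 D_monic)
  (cfdegP D_supp) D_monic D_neq0 d_sort d_gt1 P_det_div.

Lemma saito_polys_exist : exists Gm Cm N U, saito_polys P D d Gm Cm N U.
Proof.
exists (@SaitoAlgebra.Gm K n' xd), (@SaitoAlgebra.Cm K n' xd), (@SaitoAlgebra.N K n' xd),
  (@SaitoAlgebra.Um K n' xd).
split.
- exact: (@SaitoAlgebra.d_gt0 K n' xd).
- exact: (@SaitoAlgebra.xP_sym K n' xd).
- exact: (@SaitoAlgebra.flat_mx K n' xd).
- exact: (@SaitoAlgebra.xP_euler K n' xd).
- exact: (@SaitoAlgebra.detP0_neq0 K n' xd).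
- exists (SaitoAlgebra.kap xd); [exact: (@SaitoAlgebra.kap_neq0 K n' xd) | exact: (@SaitoAlgebra.det_N K n' xd)].
- by move=> a c b; rewrite mxE.
- exact: (@SaitoAlgebra.Gm0 K n' xd).
- exact: (@SaitoAlgebra.Gm_flat K n' xd).
- exact: (@SaitoAlgebra.P0C K n' xd).
- exact: (@SaitoAlgebra.Cm0 K n' xd).
- exact: (@SaitoAlgebra.Cm_sym K n' xd).
- by move=> a b; have [h _] := @SaitoAlgebra.nabla_C_comm K n' xd a b; exact: h.
- by move=> a b; have [_ h] := @SaitoAlgebra.nabla_C_comm K n' xd a b; exact: h.
- exact: (@SaitoAlgebra.Cm_weight K n' xd).
- by [].
- exact: (@SaitoAlgebra.P0U K n' xd).
- exact: (@SaitoAlgebra.det_Um K n' xd).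
- exact: (@SaitoAlgebra.Um_comm K n' xd).
- exact: (@SaitoAlgebra.nabla_Um K n' xd).
- exact: (@SaitoAlgebra.dmx0_Um K n' xd).
- exact: (@SaitoAlgebra.dmxN K n' xd).
- exact: (@SaitoAlgebra.N_euler K n' xd).
move=> c; have [T [h1 h2 h3]] := @SaitoAlgebra.flat_coordinate K n' xd c.
exists T; split; [exact: h1 | move=> a b; rewrite [LHS]h2 | exact: h3].
by apply: eq_bigr => e _; rewrite mxE.
Qed.
End Glue.

(** * Matrix algebra of the dual structure: S_a = U^-1 C_a and Omega_a = Gamma_a + N S_a *)

Section Pointwise.
Variables (A : comUnitRingType) (n : nat).
Local Notation I := 'I_n.+1.
Local Notation M := 'M[A]_n.+1.
Variables (G Cm S : I -> M) (N U : M) (dG dC dS : I -> I -> M) (dN dU : I -> M).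
Hypotheses (U_unit : U \in unitmx)
  (US : forall a, U *m S a = Cm a)
  (UdS : forall i a, U *m dS i a = dC i a - dU i *m S a)
  (G0 : G ord0 = 0) (C0 : Cm ord0 = 1%:M)
  (C_comm : forall a b, Cm a *m Cm b = Cm b *m Cm a)
  (U_comm : forall a, U *m Cm a = Cm a *m U)
  (C_nabla : forall a i, dC i a + G i *m Cm a - Cm a *m G i = dC a i + G a *m Cm i - Cm i *m G a)
  (U_nabla : forall i, dU i + G i *m U - U *m G i = Cm i + Cm i *m N - N *m Cm i)
  (N_nabla : forall i, dN i = N *m G i - G i *m N)
  (G_flat : forall a i, dG i a - dG a i - (G a *m G i - G i *m G a) = 0)
  (dG0 : forall a, dG ord0 a = 0) (dC0 : forall a, dC ord0 a = 0) (dU0 : dU ord0 = 1%:M).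

Local Notation entE := mx_entryE.
Local Notation expE := mx_expandE.

Lemma U_cancel (X Y : M) : U *m X = U *m Y -> X = Y.
Proof. by move=> /(congr1 (mulmx (invmx U))); rewrite !mulmxA mulVmx // !mul1mx. Qed.

Lemma CS a b : Cm a *m S b = U *m (S a *m S b).
Proof. by rewrite mulmxA US. Qed.

Lemma S_comm a b : S a *m S b = S b *m S a.
Proof.
have e c d : U *m (U *m (S c *m S d)) = Cm c *m Cm d.
  by rewrite (mulmxA U (S c)) US mulmxA U_comm -mulmxA US.
by apply: U_cancel; apply: U_cancel; rewrite !e C_comm.
Qed.

Definition nabS i a : M := dS i a + G i *m S a - S a *m G i.

Lemma U_nabS i a : U *m nabS i a = (dC i a + G i *m Cm a - Cm a *m G i)
  - (Cm i + Cm i *m N - N *m Cm i) *m S a.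
Proof.
rewrite -U_nabla /nabS !mulmxBr !mulmxDr UdS (mulmxA U (S a)) US.
rewrite !mulmxBl !mulmxDl -!(mulmxA _ U) US -!mulmxA.
by apply/matrixP => c b; rewrite !entE; ring.
Qed.

(** In U nabS_i a = nabla_i C_a - (nabla_i U) S_a the first term is symmetric in i and a, and so is
    C_i S_a; of nabla_i U = C_i + C_i N - N C_i only C_i N S_a survives. *)
Lemma nabS_anti i a : nabS i a - nabS a i = S a *m N *m S i - S i *m N *m S a.
Proof.
apply: U_cancel; rewrite (mulmxBr U (nabS i a)) (mulmxBr U (S a *m N *m S i)) !U_nabS C_nabla.
rewrite !mulmxA !US.
have e : Cm i *m S a = Cm a *m S i by rewrite !CS S_comm.
rewrite !mulmxBl !mulmxDl -!(mulmxA N) e.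
by apply/matrixP => c b; rewrite !entE; ring.
Qed.

Definition Om a : M := G a + N *m S a.
Definition dOm i a : M := dG i a + (dN i *m S a + N *m dS i a).

(** Replacing Gamma by Gamma + N S adds [N S_i, S_a] - [N S_a, S_i], which cancels the defect of
    [nabS_anti] because the S_a commute. *)
Lemma S_nabla_Om i a : dS i a - dS a i + (Om i *m S a - S a *m Om i) - (Om a *m S i - S i *m Om a) = 0.
Proof.
have /matrixP h := nabS_anti i a; apply/matrixP => c b; have := h c b.
rewrite /nabS /Om !expE -!(mulmxA N) (S_comm i a) !mulmxA !entE => e.
rewrite -[RHS](subrr ((S a *m N *m S i) c b - (S i *m N *m S a) c b)) -{1}e; ring.
Qed.

(** N is parallel, so the curvature of Gamma + N S is that of Gamma, plus N times the defect of
    [nabS_anti], minus the commutator of N S_a and N S_i; the last two cancel. *)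
Lemma Om_flat i a : dOm i a - dOm a i - (Om a *m Om i - Om i *m Om a) = 0.
Proof.
have e : N *m (nabS i a - nabS a i) = N *m (S a *m N *m S i - S i *m N *m S a) by rewrite nabS_anti.
have /matrixP g := G_flat a i; apply/matrixP => c b; have := congr1 (fun X : M => X c b) e.
have := g c b; rewrite /nabS /dOm /Om !N_nabla !expE !entE => g0 e0.
rewrite -g0 -[LHS](addrK ((N *m S a *m N *m S i) c b - (N *m S i *m N *m S a) c b)) -{2}e0; ring.
Qed.

Lemma dS0 a : dS ord0 a = - (S ord0 *m S a).
Proof.
by apply: U_cancel; rewrite UdS dC0 dU0 mul1mx sub0r mulmxN mulmxA US C0 mul1mx.
Qed.

(** Flatness in the directions i and 0, with d_0 Omega_i = - Omega_0 S_i because U is the only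
    ingredient depending on x_0. This is (ASS4) for e = d/dx_0. *)
Lemma Om_e i : dOm i ord0 + Om i *m Om ord0 - Om ord0 *m Om i = - (Om ord0 *m S i).
Proof.
have /matrixP h := Om_flat i ord0; apply/matrixP => c b; have := h c b.
have dN0 : dN ord0 = 0 by rewrite N_nabla G0 mulmx0 mul0mx subrr.
have -> : dOm ord0 i = - (Om ord0 *m S i).
  by rewrite /dOm dG0 dN0 mul0mx !add0r dS0 /Om G0 add0r mulmxN mulmxA.
rewrite !entE => e; rewrite -[LHS]subr0 -e; ring.
Qed.
End Pointwise.

Local Open Scope complex_scope.
Local Open Scope classical_set_scope.

(** * Holomorphic vector fields *)

Section Differential.
Variable C : numFieldType.

(** A field such as nabla_y z has a closed formula only on an open set; the differential passes from
    one expression to the other by its uniqueness. *)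
Lemma near_diff (V W : normedModType C) (f g : V -> W) (p : V) :
  (\forall q \near p, f q = g q) -> differentiable f p ->
  differentiable g p /\ 'd g p = 'd f p :> (V -> W).
Proof.
move=> fg df; have cf : continuous ('d f p) by move=> ?; exact: diff_continuous.
have h : g \o shift p = cst (g p) + 'd f p +o_ (0 : V) id.
  have [_ /eqaddoP h] := (diff_locallyP p f).1 df; apply/eqaddoP => e e0; have := h e e0.
  have gp := nbhs_singleton fg.
  have : \forall y \near (0 : V), f (y + p) = g (y + p).
    by move: fg; rewrite (near_shift 0 p) /=; apply: filterS => y /=; rewrite subr0.
  by apply: filterS2 => y /= e1; rewrite !fctE /= e1 gp.
have e := diff_unique cf h.
by split=> //; apply/diff_locallyP; rewrite e.
Qed.

Definition dif (V W : normedModType C) (f : V -> W) (p : V) (df : V -> W) : Prop :=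
  differentiable f p /\ 'd f p = df :> (V -> W).

Lemma dif_derive (V W : normedModType C) (f : V -> W) p df v : dif f p df -> 'D_v f p = df v.
Proof. by move=> [h <-]; rewrite deriveE. Qed.

Lemma dif_near (V W : normedModType C) (f g : V -> W) p df :
  (\forall q \near p, f q = g q) -> dif f p df -> dif g p df.
Proof. by move=> h [d1 d2]; have [h1 h2] := near_diff h d1; split; rewrite ?h2. Qed.

Lemma dif_ext (V W : normedModType C) (f g : V -> W) p df dg :
  f =1 g -> df =1 dg -> dif f p df -> dif g p dg.
Proof. by move=> /funext -> /funext ->. Qed.

Lemma dif_cst (V W : normedModType C) (c : W) (p : V) : dif (fun _ => c) p (fun _ => 0).
Proof. by split; [exact: differentiable_cst | exact: diff_cst]. Qed.

Lemma dif_add (V W : normedModType C) (f g : V -> W) p df dg :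
  dif f p df -> dif g p dg -> dif (fun q => f q + g q) p (fun v => df v + dg v).
Proof.
by move=> [f1 <-] [g1 <-]; split; [exact: differentiableD | rewrite (diffD f1 g1)].
Qed.

Lemma dif_sum (V W : normedModType C) (I : finType) (f df : I -> V -> W) p :
  (forall i, dif (f i) p (df i)) -> dif (fun q => \sum_i f i q) p (fun v => \sum_i df i v).
Proof.
move=> h; rewrite /index_enum; elim: (Finite.enum _) => [|i s IH].
  by apply: dif_ext (dif_cst _ _) => q; rewrite big_nil.
by apply: dif_ext (dif_add (h i) IH) => q; rewrite big_cons.
Qed.

Lemma dif_mul (V : normedModType C) (f g : V -> C^o) p df dg : dif f p df -> dif g p dg ->
  dif (fun q => f q * g q : C^o) p (fun v => df v * g p + f p * dg v).
Proof.
move=> [f1 <-] [g1 <-]; split; first exact: differentiableM.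
rewrite (diffM f1 g1); apply/funext => v.
by rewrite addrC mulrC.
Qed.

Lemma dif_Zl (V W : normedModType C) (k : V -> C^o) (w : W) p dk : dif k p dk ->
  dif (fun q => k q *: w) p (fun v => dk v *: w).
Proof. by move=> [f1 <-]; split; [exact: differentiableZl | exact: diffZl]. Qed.

Lemma dif_comp_coord (V : normedModType C) m n (f : V -> 'M[C]_(m, n)) p df i j :
  dif f p df -> dif (fun q => f q i j : C^o) p (fun v => df v i j).
Proof.
move=> [f1 <-].
have hc (M : 'M[C]_(m, n)) : differentiable (fun N : 'M[C]_(m, n) => N i j : C^o) M.
  exact: differentiable_coord.
have hd (M : 'M[C]_(m, n)) : 'd (fun N : 'M[C]_(m, n) => N i j : C^o) M = (fun N : 'M[C]_(m, n) => N i j) :> (_ -> _).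
  have @g : {linear 'M[C]_(m, n) -> C^o}.
    by exists (fun N : 'M[C]_(_, _) => N i j); do 2![eexists]; do ?[constructor];
     rewrite ?mxE// => ? *; rewrite ?mxE//; move=> ?; rewrite !mxE.
  rewrite (_ : (fun _ => _) = g) //; apply: diff_lin; exact: coord_continuous.
split; first exact: (differentiable_comp f1 (hc _)).
by rewrite (diff_comp f1 (hc _)) hd.
Qed.

Lemma dif_mx (V : normedModType C) m n (f : V -> 'M[C]_(m, n)) p (df : V -> 'M[C]_(m, n)) :
  (forall i j, dif (fun q => f q i j : C^o) p (fun v => df v i j)) -> dif f p df.
Proof.
move=> h.
have : dif (fun q => \sum_i \sum_j f q i j *: delta_mx i j) p (fun v => \sum_i \sum_j df v i j *: delta_mx i j).
  by apply: dif_sum => i; apply: dif_sum => j; apply: dif_Zl.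
by apply: dif_ext => q; rewrite -matrix_sum_delta.
Qed.

Lemma dif_id (V : normedModType C) (p : V) : dif (fun q => q) p (fun v => v).
Proof. by have h := is_diff_id p; split; [exact: ex_diff | exact: diff_val]. Qed.

Lemma dif_mulmx (V : normedModType C) m n k (f : V -> 'M[C]_(m, n)) (g : V -> 'M[C]_(n, k)) p df dg :
  dif f p df -> dif g p dg -> dif (fun q => f q *m g q) p (fun v => df v *m g p + f p *m dg v).
Proof.
move=> hf hg; apply: dif_mx => i j.
have : dif (fun q => \sum_s f q i s * g q s j : C^o) p
   (fun v => \sum_s (df v i s * g p s j + f p i s * dg v s j)).
  by apply: dif_sum => s; apply: dif_mul; apply: dif_comp_coord.
by apply: dif_ext => q; rewrite !mxE // -big_split.
Qed.

Lemma dif_scale (V : normedModType C) m n (k : V -> C^o) (g : V -> 'M[C]_(m, n)) p dk dg :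
  dif k p dk -> dif g p dg -> dif (fun q => k q *: g q) p (fun v => dk v *: g p + k p *: dg v).
Proof.
move=> hf hg; apply: dif_mx => i j.
have : dif (fun q => k q * g q i j : C^o) p (fun v => dk v * g p i j + k p * dg v i j).
  by apply: dif_mul => //; apply: dif_comp_coord.
by apply: dif_ext => q; rewrite !mxE.
Qed.
End Differential.

(** * Additive identities behind the axioms *)

Section Abel.
Variables (A : comNzRingType) (m k : nat).
Implicit Types a b c d e f g h : 'M[A]_(m, k).
Let entrywise := (mxDE, mxBE, mxNE).
Lemma abel_torsion a b d : a + d - (b + d) = a - b.
Proof. by apply/matrixP => i j; rewrite !entrywise; ring. Qed.
Lemma abel_lie a b c d e f : a + (b + c) - d - (b - e) - (a - f) = c - d + f + e.
Proof. by apply/matrixP => i j; rewrite !entrywise; ring. Qed.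
Lemma abel_cov2 a b c d : a + b + c - (a + d) = b + c - d.
Proof. by apply/matrixP => i j; rewrite !entrywise; ring. Qed.
Lemma abel_ss1 a b c d e a' b' c' d' e' : c - c' + (d - e) - (d' - e') = 0 ->
  a + (b + c) + d - (a + e) - (a' + (b' + c') + d') + (a' + e') = b - b'.
Proof.
by move=> h; rewrite -[RHS]addr0 -h; apply/matrixP => i j; rewrite !entrywise; ring.
Qed.
Lemma abel_flat a a' b c c' d d' e f f' g : c - c' + (f - f') = 0 ->
  a + g + (b + (d + c)) + (e + f) - (a' + g + (e + (d' + c')) + (b + f'))
    - (a - a' + (d - d')) = 0.
Proof.
by move=> h; rewrite -[RHS]h; apply/matrixP => i j; rewrite !entrywise; ring.
Qed.
End Abel.

(** * The axioms as matrix identities at a point *)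

Section LocalFields.
Variables (R : realType) (n' : nat).
Local Notation n := n'.+1.
Local Notation C := (R[i]).
Local Notation V := (Cn R n).
Local Notation T := 'rV[C]_n.
Implicit Types (U W : set T) (x y z : vfield R n) (p q u v w : T) (K Gam : coefs R n).

Lemma dif_partials (Y : normedModType C) (f : V -> Y) (p : V) : differentiable f p ->
  dif f p (fun v => \sum_i (v : T) 0 i *: 'D_(delta_mx 0 i) f p).
Proof.
move=> df; split=> //; apply/funext => v; rewrite {1}[v](@row_sum_delta _ n) linear_sum.
by apply: eq_bigr => i _; rewrite linearZ /= deriveE.
Qed.

(* The 2-jet of a local field: [J] is its Jacobian matrix and [H] its Hessian. *)
Lemma local_jet U W x : local_field U W x -> exists J : T -> 'M[C]_n, forall p : V, W p ->
  @dif C V V x p (fun v : T => v *m J p) /\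
  exists2 H : T -> 'M[C]_n, @dif C V _ J p H & forall u v, u *m H v = v *m H u.
Proof.
move=> [oW _ [F [F0 hF]]].
have dF m (p : V) : W p -> @dif C V _ (F m) p (fun v : T => \sum_i v 0 i *: F (mnm_add m (mnm1 i)) p).
  move=> Wp; have [d _] := hF m ord0 p Wp; have := dif_partials d.
  apply: dif_ext => // v; apply: eq_bigr => i _.
  by have [_ ->] := hF m i p Wp.
exists (fun q => \matrix_i F (mnm_add (@mnm0 n) (mnm1 i)) q) => p Wp; split.
  have h : \forall q \near (p : V), F (@mnm0 n) q = x q.
    by apply: filterS (open_nbhs_nbhs (conj oW Wp)) => q Uq; apply: F0.
  apply: dif_near h _; apply: dif_ext (dF _ _ Wp) => // v.
  by rewrite mulmx_sum_row; apply: eq_bigr => i _; rewrite rowK.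
pose F2 i j := F (mnm_add (mnm_add (@mnm0 n) (mnm1 i)) (mnm1 j)) p.
exists (fun v => \matrix_i \sum_j v 0 j *: F2 i j).
  apply: dif_mx => i j; have := dif_comp_coord 0 j (dF (mnm_add (@mnm0 n) (mnm1 i)) p Wp).
  by apply: dif_ext => v; rewrite mxE.
move=> u v; rewrite !mulmx_sum_row.
have e (a b : T) : \sum_i a 0 i *: row i (\matrix_i0 \sum_j b 0 j *: F2 i0 j) = \sum_i \sum_j (a 0 i * b 0 j) *: F2 i j.
  by apply: eq_bigr => i _; rewrite rowK scaler_sumr; apply: eq_bigr => j _; rewrite scalerA.
rewrite !e exchange_big /=; apply: eq_bigr => j _; apply: eq_bigr => i _.
rewrite mulrC; congr (_ *: F _ p); apply/mnmP => k; rewrite !mnmDE; lia.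
Qed.

(** Tangent vectors are rows, so [ad K v q] acts on the right ([mult_ad]) and [kmx] is the transpose
    of matrices such as [Gm] and [Cm]. *)
Definition kmx K a q : 'M[C]_n := \matrix_(b, c) K a b c q.
Definition ad K v q : 'M[C]_n := \sum_a v 0 a *: kmx K a q.

Lemma mult_ad K x y q : mult K x y q = y q *m ad K (x q) q.
Proof.
apply/rowP => c; rewrite !mxE exchange_big /=; apply: eq_bigr => b _.
rewrite summxE mulr_sumr; apply: eq_bigr => a _; rewrite !mxE; ring.
Qed.

Lemma adD K u v q : ad K (u + v) q = ad K u q + ad K v q.
Proof. by rewrite /ad -big_split; apply: eq_bigr => a _; rewrite mxE scalerDl. Qed.
Lemma adN K u q : ad K (- u) q = - ad K u q.
Proof. by rewrite /ad -sumrN; apply: eq_bigr => a _; rewrite mxE scaleNr. Qed.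

Definition bl (M : 'I_n -> 'I_n -> 'M[C]_n) u v : 'M[C]_n := \sum_i \sum_a (u 0 i * v 0 a) *: M i a.

Lemma blD M M' u v : bl M u v + bl M' u v = bl (fun i a => M i a + M' i a) u v.
Proof.
rewrite /bl -big_split; apply: eq_bigr => i _; rewrite -big_split; apply: eq_bigr => a _.
by rewrite scalerDr.
Qed.
Lemma blN M u v : - bl M u v = bl (fun i a => - M i a) u v.
Proof.
rewrite /bl -sumrN; apply: eq_bigr => i _; rewrite -sumrN; apply: eq_bigr => a _.
by rewrite scalerN.
Qed.
Lemma bl_swap M u v : bl M v u = bl (fun i a => M a i) u v.
Proof.
rewrite /bl exchange_big /=; apply: eq_bigr => i _; apply: eq_bigr => a _.
by rewrite mulrC.
Qed.
Lemma bl0 M u v : (forall i a, M i a = 0) -> bl M u v = 0.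
Proof. by move=> h; rewrite /bl big1 // => i _; rewrite big1 // => a _; rewrite h scaler0. Qed.
Lemma ad_mul K K' u v q : ad K u q *m ad K' v q = bl (fun i a => kmx K i q *m kmx K' a q) u v.
Proof.
rewrite /ad /bl mulmx_suml; apply: eq_bigr => i _; rewrite mulmx_sumr; apply: eq_bigr => a _.
by rewrite -scalemxAl -scalemxAr scalerA.
Qed.

Definition kdif K p (dk : 'I_n -> 'I_n -> 'M[C]_n) : Prop :=
  forall a, @dif C V _ (kmx K a) p (fun v : T => \sum_i v 0 i *: dk i a).

Lemma dif_ad K p dk (y : V -> V) (dy : V -> V) : kdif K p dk -> @dif C V V y p dy ->
  @dif C V _ (fun q : V => ad K (y q) q) p (fun v : V => ad K (dy v) p + bl dk v (y p)).
Proof.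
move=> hk hy.
have : @dif C V _ (fun q => \sum_a (y q) 0 a *: kmx K a q) p
    (fun v => \sum_a (dy v 0 a *: kmx K a p + y p 0 a *: \sum_i (v : T) 0 i *: dk i a)).
  by apply: dif_sum => a; apply: dif_scale; [exact: (dif_comp_coord 0 a hy) | exact: hk].
apply: dif_ext => // v; rewrite big_split /=; congr (_ + _); rewrite /bl exchange_big /=.
apply: eq_bigr => a _; rewrite scaler_sumr; apply: eq_bigr => i _.
by rewrite scalerA mulrC.
Qed.

Lemma dif_mult K p dk x y (dx dy : V -> V) : kdif K p dk -> @dif C V V x p dx -> @dif C V V y p dy ->
  @dif C V V (mult K x y) p (fun v : V => dy v *m ad K (x p) p + y p *m (ad K (dx v) p + bl dk v (x p))).
Proof.
move=> hk hx hy; have := dif_mulmx hy (dif_ad hk hx).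
by apply: dif_ext => // q; rewrite mult_ad.
Qed.

Lemma nablaE Gam x y (dy : V -> V) p : @dif C V V y p dy ->
  nabla Gam x y p = dy (x p) + y p *m ad Gam (x p) p.
Proof. by move=> hy; rewrite /nabla (dif_derive _ hy) mult_ad. Qed.

Lemma bracketE x y (dx dy : V -> V) p : @dif C V V x p dx -> @dif C V V y p dy ->
  bracket x y p = dy (x p) - dx (y p).
Proof. by move=> hx hy; rewrite /bracket (dif_derive _ hx) (dif_derive _ hy). Qed.

Lemma torsion_free_gen U Gam : (forall a b c p, U p -> Gam a b c p = Gam b a c p) -> torsion_free U Gam.
Proof.
move=> hs W x y p hx hy Wp; have [Jx hJx] := local_jet hx; have [Jy hJy] := local_jet hy.
have Up : U p by have [_ h _] := hx; apply: h.
rewrite (nablaE _ _ (hJx p Wp).1) (nablaE _ _ (hJy p Wp).1) (bracketE (hJx p Wp).1 (hJy p Wp).1).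
rewrite -!mult_ad (_ : mult Gam y x p = mult Gam x y p).
  move: (x p *m _) (y p *m _) (mult _ _ _ _) => A B D.
  exact: abel_torsion.
apply/rowP => c; rewrite !mxE exchange_big /=; apply: eq_bigr => a _; apply: eq_bigr => b _.
by rewrite hs //; ring.
Qed.

(** The derivatives of x and y combine into the bracket and those of z cancel, which leaves the
    symmetry of nabla_i K_a in i and a. It serves (SS1) and (ASS1). *)
Lemma ss1_gen U Gam K : (forall p, U p -> exists dk, kdif K p dk /\
   forall i a, dk i a - dk a i + (kmx K a p *m kmx Gam i p - kmx Gam i p *m kmx K a p)
     - (kmx K i p *m kmx Gam a p - kmx Gam a p *m kmx K i p) = 0) ->
  forall W x y z p, local_field U W x -> local_field U W y ->
    local_field U W z -> W p ->
    nabla Gam x (mult K y z) p - mult K y (nabla Gam x z) p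
      - nabla Gam y (mult K x z) p + mult K x (nabla Gam y z) p
    = mult K (bracket x y) z p.
Proof.
move=> hk W x y z p hx hy hz Wp; have Up : U p by have [_ h _] := hx; apply: h.
have [dk [hd ht]] := hk p Up.
have [Jx /(_ p Wp)[hJx _]] := local_jet hx; have [Jy /(_ p Wp)[hJy _]] := local_jet hy.
have [Jz /(_ p Wp)[hJz _]] := local_jet hz.
rewrite (nablaE _ x (dif_mult hd hJy hJz)) (nablaE _ y (dif_mult hd hJx hJz)).
rewrite !mult_ad (nablaE _ x hJz) (nablaE _ y hJz) (bracketE hJx hJy) adD adN.
have : z p *m (bl dk (x p) (y p) - bl dk (y p) (x p)
    + (ad K (y p) p *m ad Gam (x p) p - ad Gam (x p) p *m ad K (y p) p)
    - (ad K (x p) p *m ad Gam (y p) p - ad Gam (y p) p *m ad K (x p) p)) = 0.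
  rewrite !ad_mul !(bl_swap _ (x p) (y p)) !(blN, blD) bl0 ?mulmx0 //.
rewrite !(mulmxDl, mulmxDr, mulmxBl, mulmxBr, mulmxN, mulmxA); exact: abel_ss1.
Qed.
(** Lie derivative of the product along a field with constant Jacobian matrix L: used for the linear
    field E and, with L = 0, for d/dx_0. *)
Lemma lie_gen U K e (L : 'M[C]_n) : (forall p, U p -> @dif C V V e p (fun v : T => v *m L)) ->
  forall (N : T -> 'I_n -> 'M[C]_n),
  (forall p, U p -> exists dk, kdif K p dk /\
   forall a, (\sum_i e p 0 i *: dk i a) - kmx K a p *m L + L *m kmx K a p
     + \sum_b L a b *: kmx K b p = N p a) ->
  forall W x y p, local_field U W x -> local_field U W y -> W p ->
    bracket e (mult K x y) p - mult K (bracket e x) y p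
      - mult K x (bracket e y) p
    = y p *m \sum_a x p 0 a *: N p a.
Proof.
move=> he N hN W x y p hx hy Wp; have Up : U p by have [_ h _] := hx; apply: h.
have [dk [hd ht]] := hN p Up; have hE := he p Up.
have [Jx /(_ p Wp)[hJx _]] := local_jet hx; have [Jy /(_ p Wp)[hJy _]] := local_jet hy.
rewrite (bracketE hE (dif_mult hd hJx hJy)) !mult_ad (bracketE hE hJx) (bracketE hE hJy).
have -> : \sum_a x p 0 a *: N p a = bl dk (e p) (x p) - ad K (x p) p *m L + L *m ad K (x p) p
    + ad K (x p *m L) p.
  under eq_bigr => a _ do rewrite -ht !(scalerDr, scalerN).
  rewrite !big_split /= sumrN; congr (_ - _ + _ + _).
  - rewrite /bl exchange_big /=; apply: eq_bigr => a _; rewrite scaler_sumr.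
    by apply: eq_bigr => i _; rewrite scalerA mulrC.
  - by rewrite /ad mulmx_suml; apply: eq_bigr => a _; rewrite -scalemxAl.
  - by rewrite /ad mulmx_sumr; apply: eq_bigr => a _; rewrite -scalemxAr.
  rewrite /ad; under [RHS]eq_bigr => b _ do rewrite mxE scaler_suml.
  rewrite exchange_big /=; apply: eq_bigr => a _; rewrite scaler_sumr.
  by apply: eq_bigr => b _; rewrite scalerA.
rewrite !(adD, adN) !(mulmxDl, mulmxDr, mulmxBl, mulmxBr, mulmxN, mulNmx, mulmxA).
exact: abel_lie.
Qed.

(** As nabla_v e = v A, the derivatives of y cancel and the covariant derivative of A remains. It
    serves (SS4) with e = E and (ASS4) with e = d/dx_0. *)
Lemma cov2_gen U Gam e (A : T -> 'M[C]_n) (dA : T -> 'I_n -> 'M[C]_n) (N : T -> 'I_n -> 'M[C]_n) :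
  @open V U ->
  (forall p, U p -> exists Je : T -> 'M[C]_n, @dif C V V e p (fun v : T => v *m Je p) /\
     forall v, v *m Je p + e p *m ad Gam v p = v *m A p) ->
  (forall p, U p -> @dif C V _ A p (fun v : T => \sum_i v 0 i *: dA p i)) ->
  (forall p, U p -> forall i, dA p i + A p *m kmx Gam i p - kmx Gam i p *m A p = N p i) ->
  forall W x y p, local_field U W x -> local_field U W y -> W p ->
    nabla Gam x (nabla Gam y e) p - nabla Gam (nabla Gam x y) e p
    = y p *m \sum_i x p 0 i *: N p i.
Proof.
move=> oU he hA hN W x y p hx hy Wp; have Up : U p by have [_ h _] := hx; apply: h.
have [Jx /(_ p Wp)[hJx _]] := local_jet hx; have [Jy /(_ p Wp)[hJy _]] := local_jet hy.
have ne z q : U q -> nabla Gam z e q = z q *m A q.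
  by move=> Uq; have [Je [h1 h2]] := he q Uq; rewrite (nablaE _ z h1) h2.
have nU : \forall q \near (p : V), y q *m A q = nabla Gam y e q.
  by apply: filterS (open_nbhs_nbhs (conj oU Up)) => q Uq; rewrite ne.
have h1 := dif_near nU (dif_mulmx hJy (hA p Up)).
rewrite (nablaE _ x h1) !ne // (nablaE _ x hJy).
have -> : \sum_i x p 0 i *: N p i = (\sum_i x p 0 i *: dA p i) + A p *m ad Gam (x p) p
    - ad Gam (x p) p *m A p.
  rewrite /ad mulmx_suml mulmx_sumr -sumrN -!big_split; apply: eq_bigr => i _ /=.
  by rewrite -(hN p Up) -scalemxAl -scalemxAr !scalerDr scalerN.
rewrite !(mulmxDl, mulmxDr, mulmxBl, mulmxBr, mulmxN, mulNmx, mulmxA).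
exact: abel_cov2.
Qed.

(** The Hessian of z cancels by symmetry and the Jacobians of x and y against the bracket; only the
    curvature remains. *)
Lemma flat_gen U Gam : @open V U -> (forall p, U p -> exists dk, kdif Gam p dk /\
   forall i a, dk i a - dk a i + (kmx Gam a p *m kmx Gam i p - kmx Gam i p *m kmx Gam a p) = 0) ->
  flat U Gam.
Proof.
move=> oU hk W x y z p hx hy hz Wp; have [oW sW _] := hx; have Up := sW p Wp.
have [dk [hd ht]] := hk p Up.
have [Jx hJx] := local_jet hx; have [Jy hJy] := local_jet hy; have [Jz hJz] := local_jet hz.
have [H hH Hs] := (hJz p Wp).2.
have step (v w : vfield R n) Jv : (forall q, W q -> @dif C V V v q (fun u : T => u *m Jv q)) ->
   nabla Gam w (nabla Gam v z) p = w p *m Jv p *m Jz p + v p *m H (w p)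
     + (w p *m Jz p *m ad Gam (v p) p + z p *m (ad Gam (w p *m Jv p) p + bl dk (w p) (v p)))
     + (v p *m Jz p + z p *m ad Gam (v p) p) *m ad Gam (w p) p.
  move=> hv.
  have nW : \forall q \near (p : V), v q *m Jz q + z q *m ad Gam (v q) q = nabla Gam v z q.
    by apply: filterS (open_nbhs_nbhs (conj oW Wp)) => q Wq; rewrite (nablaE _ v (hJz q Wq).1).
  have h1 := dif_near nW (dif_add (dif_mulmx (hv p Wp) hH) (dif_mulmx (hJz p Wp).1 (dif_ad hd (hv p Wp)))).
  by rewrite (nablaE _ w h1) (nablaE _ v (hJz p Wp).1).
rewrite (step y x Jy) => [|q Wq]; last exact: (hJy q Wq).1.
rewrite (step x y Jx) => [|q Wq]; last exact: (hJx q Wq).1.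
rewrite (nablaE _ _ (hJz p Wp).1) (bracketE (hJx p Wp).1 (hJy p Wp).1) (Hs (x p) (y p)).
rewrite adD adN.
have : z p *m (bl dk (x p) (y p) - bl dk (y p) (x p)
    + (ad Gam (y p) p *m ad Gam (x p) p - ad Gam (x p) p *m ad Gam (y p) p)) = 0.
  rewrite !ad_mul !(bl_swap _ (x p) (y p)) !(blN, blD) bl0 ?mulmx0 //.
rewrite !(mulmxDl, mulmxDr, mulmxBl, mulmxBr, mulmxN, mulNmx, mulmxA); exact: abel_flat.
Qed.
End LocalFields.

(** * Rational functions with a power of one polynomial as denominator *)

Lemma dif_inv (C : numFieldType) (V : normedModType C) (f : V -> C^o) p df : dif f p df -> f p != 0 ->
  dif (fun q => (f q)^-1 : C^o) p (fun v => - (f p) ^- 2 * df v).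
Proof.
move=> [f1 <-] fp; split; first exact: differentiableV.
by rewrite (diffV f1 fp).
Qed.

Lemma foldr_comm (I : eqType) (T : Type) (f : I -> T -> T) : (forall i j t, f i (f j t) = f j (f i t)) ->
  forall s1 s2, perm_eq s1 s2 -> forall t, foldr f t s1 = foldr f t s2.
Proof.
move=> fC s1 s2 h t.
have fA i s t' : foldr f (f i t') s = f i (foldr f t' s).
  by elim: s => //= j s ->; rewrite fC.
elim: s1 s2 h => [|i s IH] s2 h; first by have := perm_size h; case: s2 h.
have is2 : i \in s2 by rewrite -(perm_mem h) mem_head.
have [u [v e]] : exists u v, s2 = u ++ i :: v.
  by case/splitPr: is2 => u v; exists u, v.
rewrite e foldr_cat /= fA -foldr_cat /=; congr (f i _); apply: IH.
by move: h; rewrite e perm_sym -cat1s perm_catCA /= perm_cons perm_sym.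
Qed.

Lemma quot_der_comm (A : comNzRingType) (di dj : {additive A -> A}) :
  (forall f g, di (f * g) = di f * g + f * di g) -> (forall f g, dj (f * g) = dj f * g + f * dj g) ->
  (forall f, di (dj f) = dj (di f)) -> forall (D P : A) (k : nat),
  D * di (D * dj P - k%:R * P * dj D) - k.+1%:R * (D * dj P - k%:R * P * dj D) * di D
  = D * dj (D * di P - k%:R * P * di D) - k.+1%:R * (D * di P - k%:R * P * di D) * dj D.
Proof.
move=> hi hj hc D P k.
have n0 (d : {additive A -> A}) (m : nat) : (forall f g, d (f * g) = d f * g + f * d g) -> d m%:R = 0.
  move=> hd; rewrite -[m%:R]/(1 *+ m) raddfMn.
  have : d 1 = d 1 + d 1 by rewrite -{1}[1]mulr1 hd mulr1 mul1r.
  by move/eqP; rewrite -subr_eq0 opprD addrA subrr sub0r oppr_eq0 => /eqP ->; rewrite mul0rn.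
rewrite !raddfB !(hi, hj) (n0 di k hi) (n0 dj k hj) !hc -[k.+1%:R]natr1; ring.
Qed.

Section Rational.
Variables (R : realType) (n' : nat).
Local Notation n := n'.+1.
Local Notation C := (R[i]).
Local Notation V := (Cn R n).
Local Notation T := 'rV[C]_n.
Local Notation Pol := (mpoly n C).
Local Notation ev := (@poly_eval R n).

Lemma evD P Q p : ev (P + Q) p = ev P p + ev Q p. Proof. exact: mevalD. Qed.
Lemma evM P Q p : ev (P * Q) p = ev P p * ev Q p. Proof. exact: mevalM. Qed.
Lemma evC c p : ev (mpolyC n c) p = c. Proof. exact: mevalC. Qed.
Lemma evX a p : ev 'x_a p = p 0 a. Proof. exact: mevalXU. Qed.
Lemma ev0 p : ev 0 p = 0. Proof. exact: meval0. Qed.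
Lemma ev1 p : ev 1 p = 1. Proof. exact: meval1. Qed.
Lemma evN P p : ev (- P) p = - ev P p. Proof. exact: mevalN. Qed.
Lemma evB P Q p : ev (P - Q) p = ev P p - ev Q p. Proof. exact: mevalB. Qed.
Lemma ev_sum (I : finType) (F : I -> Pol) p : ev (\sum_i F i) p = \sum_i ev (F i) p.
Proof. exact: raddf_sum. Qed.

Opaque poly_eval.

Lemma dif_poly P (p : V) : @dif C V C^o (ev P) p (fun v : T => \sum_i v 0 i * ev (mderiv i P) p).
Proof.
elim/mpoly_ring_ind: P => [c|a|P Q hP hQ|P Q hP hQ].
- apply: dif_ext (dif_cst (c : C^o) p) => q; first by rewrite evC.
  by rewrite big1 // => i _; rewrite mderivC ev0 mulr0.
- apply: dif_ext (dif_comp_coord 0 a (dif_id p)) => q; first by rewrite evX.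
  rewrite (bigD1 a) //= mderivX1 eqxx ev1 mulr1 big1 ?addr0 // => i ia.
  by rewrite mderivX1 (negPf ia) ev0 mulr0.
- apply: dif_ext (dif_add hP hQ) => q; first by rewrite evD.
  by rewrite -big_split; apply: eq_bigr => i _; rewrite mderivD evD mulrDr.
- apply: dif_ext (dif_mul hP hQ) => q; first by rewrite evM.
  rewrite mulr_suml mulr_sumr -big_split; apply: eq_bigr => i _ /=.
  rewrite mderivM evD (evM (mderiv i P)) (evM P) mulrDr; congr (_ + _); last by rewrite mulrCA.
  by rewrite mulrA.
Qed.

Variable D : Pol.

(** The pair (P, k) stands for P / D^k and is never reduced: [rat_der] always raises the exponent,
    so mixed derivatives agree as pairs ([rat_derC]). *)
Definition ratf (r : Pol * nat) (p : T) : C := ev r.1 p / ev D p ^+ r.2.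
Definition rat_der (i : 'I_n) (r : Pol * nat) : Pol * nat :=
  (D * mderiv i r.1 - r.2%:R * r.1 * mderiv i D, r.2.+1).

Lemma rat_derC i j r : rat_der i (rat_der j r) = rat_der j (rat_der i r).
Proof.
case: r => P k; rewrite /rat_der.
exact: (f_equal (fun z => (z, k.+2)) (quot_der_comm (@mderivM n C i) (@mderivM n C j)
  (fun f => @mderiv_comm n C j i f) D P k)).
Qed.

Lemma dif_rat r (p : V) : ev D p != 0 ->
  @dif C V C^o (ratf r) p (fun v : T => \sum_i v 0 i * ratf (rat_der i r) p).
Proof.
move=> D0; case: r => P k; elim: k P => [|k IH] P.
  apply: dif_ext (dif_poly P p) => q; first by rewrite /ratf /= expr0 divr1.
  apply: eq_bigr => i _; rewrite /ratf /= expr1 mul0r mul0r subr0 evM.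
  by rewrite mulrAC mulfV // mul1r.
have := dif_mul (IH P) (dif_inv (dif_poly D p) D0).
apply: dif_ext => q; first by rewrite /ratf /= exprSr invfM mulrA.
rewrite mulr_suml [_ * (_ * \sum_i _)]mulrA mulr_sumr -big_split.
apply: eq_bigr => i _; rewrite /ratf /= !evB !evM -[k.+1%:R]natr1 evD ev1 !exprS.
have D2 : ev D p ^+ k != 0 by rewrite expf_neq0.
move: (ev D p) (ev P p) (ev (mderiv i P) p) (ev (mderiv i D) p) (ev k%:R p) (q 0 i) (ev D p ^+ k) D0 D2.
by move=> a b c d e f g a0 g0; field; rewrite a0 g0.
Qed.

Lemma hol_rat (r : Pol * nat) (U : set T) (f : T -> C) : (forall p, U p -> ev D p != 0) ->
  (forall p, U p -> f p = ratf r p) -> @holomorphic_on R n C^o U f.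
Proof.
(* The multi-index m is spelled as a word of indices; by [foldr_comm] the order of its letters does
   not matter. *)
move=> hD hf; pose s (m : multinom n) : seq 'I_n := flatten [seq nseq (m i) i | i <- enum 'I_n].
exists (fun m => ratf (foldr rat_der r (s m))); split.
  move=> p Up; rewrite hf // (_ : s (@mnm0 n) = [::]) //.
  by rewrite /s; elim: (enum _) => //= i l ->; rewrite mnm0E.
move=> m i p Up; have := dif_rat (foldr rat_der r (s m)) (hD p Up) => h; split; first exact: h.1.
rewrite (dif_derive _ h) (bigD1 i) //= big1 ?addr0 => [|j ji].
  rewrite mxE !eqxx mul1r -[rat_der i _]/(foldr rat_der r (i :: s m)); congr (ratf _ p).
  apply: (foldr_comm rat_derC); apply/allP => j _ /=; apply/eqP.
  have hs m' : count_mem j (s m') = m' j.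
    rewrite /s count_flatten -map_comp sumnE big_map big_enum /= (bigD1 j) //= count_nseq.
    rewrite /= eqxx mul1n big1 ?addn0 // => k kj.
    by rewrite count_nseq /= (negPf kj) mul0n.
  by rewrite /= !hs mnmDE mnm1E addnC.
by rewrite mxE eqxx (negPf ji) mul0r.
Qed.
End Rational.

Section Holomorphic.
Variables (R : realType) (n' : nat).
Local Notation n := n'.+1.
Local Notation C := (R[i]).
Local Notation V := (Cn R n).
Local Notation T := 'rV[C]_n.
Local Notation ev := (@poly_eval R n).

Lemma hol_poly P (U : set T) (f : T -> C) : (forall p, U p -> f p = ev P p) ->
  @holomorphic_on R n C^o U f.
Proof.
move=> h; apply: (hol_rat (D := 1) (r := (P, 0%N))) => p Up; first by rewrite ev1 oner_neq0.
by rewrite /ratf /= expr0 divr1 h.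
Qed.

Lemma hol_row (U : set T) (f : vfield R n) :
  (forall j, @holomorphic_on R n C^o U (fun p => f p 0 j)) -> holomorphic_on U f.
Proof.
move=> /fin_all_exists [F hF]; exists (fun m p => \row_j F j m p); split.
  by move=> p Up; apply/rowP => j; rewrite mxE (hF j).1.
move=> m i p Up.
have h : dif ((fun p => \row_j F j m p) : V -> V) p (fun v : T => \row_j \sum_k v 0 k * F j (mnm_add m (mnm1 k)) p).
  apply: dif_mx => a j.
  have [d _] := (hF j).2 m ord0 p Up; have := dif_partials d.
  apply: dif_ext => q; first by rewrite !mxE.
  rewrite mxE; apply: eq_bigr => k _; by have [_ ->] := (hF j).2 m k p Up.
split; first exact: h.1.
rewrite (dif_derive _ h); apply/rowP => j; rewrite !mxE (bigD1 i) //= big1 ?addr0 => [|k ki].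
  by rewrite mxE !eqxx mul1r.
by rewrite mxE eqxx (negPf ki) mul0r.
Qed.

Lemma open_ev_neq0 (D : mpoly n C) : @open V [set p | ev D p != 0].
Proof.
have := @open_comp V C^o (ev D) [set z : C^o | z != 0]; apply.
  by move=> p _; apply: differentiable_continuous; exact: (dif_poly D p).1.
rewrite (_ : [set z : C^o | z != 0] = ~` [set (0 : C^o)]); last first.
  by apply/seteqP; split => z /= /eqP.
rewrite openC; apply: accessible_closed_set1; apply: hausdorff_accessible.
exact: norm_hausdorff.
Qed.
End Holomorphic.

Opaque poly_eval.

(** * Evaluation of the polynomial data: the Saito structure *)

Lemma abel_nabla (A : comNzRingType) m k (x b c x' b' c' : 'M[A]_(m, k)) :
  x + b - c - (x' + b' - c') = 0 -> x - x' + (b - c) - (b' - c') = 0.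
Proof.
by move=> h; rewrite -[RHS]h; apply/matrixP => i j; rewrite !(mxDE, mxBE, mxNE); ring.
Qed.

Lemma abel_conn (A : comNzRingType) m k (a b c : 'M[A]_(m, k)) : a + b - (b - c) = a + c.
Proof. by apply/matrixP => i j; rewrite !(mxDE, mxBE, mxNE); ring. Qed.

Section Evaluate.
Variables (R : realType) (n' : nat).
Local Notation n := n'.+1.
Local Notation C := (R[i]).
Local Notation V := (Cn R n).
Local Notation T := 'rV[C]_n.
Local Notation Pol := (mpoly n C).
Local Notation ev := (@poly_eval R n).

Lemma ev_nat (k : nat) p : ev k%:R p = k%:R.
Proof. by rewrite -mpolyC_nat evC. Qed.

Definition evm m k (M : 'M[Pol]_(m, k)) p : 'M[C]_(m, k) := \matrix_(i, j) ev (M i j) p.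
Lemma evmB m k (M M' : 'M[Pol]_(m, k)) p : evm (M - M') p = evm M p - evm M' p.
Proof. by apply/matrixP => i j; rewrite !mxE evB. Qed.
Lemma evmD m k (M M' : 'M[Pol]_(m, k)) p : evm (M + M') p = evm M p + evm M' p.
Proof. by apply/matrixP => i j; rewrite !mxE evD. Qed.
Lemma evmM m k l (M : 'M[Pol]_(m, k)) (M' : 'M[Pol]_(k, l)) p : evm (M *m M') p = evm M p *m evm M' p.
Proof. by apply/matrixP => i j; rewrite !mxE ev_sum; apply: eq_bigr => s _; rewrite evM !mxE. Qed.
Lemma evmZ m k f (M : 'M[Pol]_(m, k)) p : evm (f *: M) p = ev f p *: evm M p.
Proof. by apply/matrixP => i j; rewrite !mxE evM. Qed.
Lemma evm0 m k p : evm (0 : 'M[Pol]_(m, k)) p = 0.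
Proof. by apply/matrixP => i j; rewrite !mxE ev0. Qed.
Lemma evm1 m p : evm (1%:M : 'M[Pol]_m) p = 1%:M.
Proof. by apply/matrixP => i j; rewrite !mxE; case: eqP => _; rewrite ?ev1 ?ev0. Qed.
Lemma evm_sum (I : finType) m k (F : I -> 'M[Pol]_(m, k)) p : evm (\sum_i F i) p = \sum_i evm (F i) p.
Proof. by apply/matrixP => i j; rewrite !mxE !summxE ev_sum; apply: eq_bigr => s _; rewrite !mxE. Qed.
Lemma evm_det m (M : 'M[Pol]_m) p : \det (evm M p) = ev (\det M) p.
Proof.
rewrite /determinant ev_sum; apply: eq_bigr => s _; rewrite evM; congr (_ * _).
  by case: (perm.odd_perm _); rewrite /= ?expr1 ?expr0 ?evN ev1.
rewrite (big_morph (ev^~ p) (fun P Q => evM P Q p) (ev1 p)).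
by apply: eq_bigr => i _; rewrite mxE.
Qed.

Local Notation dm i M := (map_mx (mderiv i) M).

Lemma dif_evm m k (M : 'M[Pol]_(m, k)) (p : V) :
  @dif C V _ (evm M) p (fun v : T => \sum_i v 0 i *: evm (dm i M) p).
Proof.
apply: dif_mx => i j; apply: dif_ext (dif_poly (M i j) p) => q; first by rewrite mxE.
by rewrite summxE; apply: eq_bigr => l _; rewrite !mxE.
Qed.

Lemma trmxB' m k (M M' : 'M[C]_(m, k)) : (M - M')^T = M^T - M'^T.
Proof. by apply/matrixP => i j; rewrite !mxE. Qed.
Lemma trmxD' m k (M M' : 'M[C]_(m, k)) : (M + M')^T = M^T + M'^T.
Proof. by apply/matrixP => i j; rewrite !mxE. Qed.
Lemma trmxZ' m k c (M : 'M[C]_(m, k)) : (c *: M)^T = c *: M^T.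
Proof. by apply/matrixP => i j; rewrite !mxE. Qed.

Lemma evm_cov (X M1 M2 M3 M4 : 'M[Pol]_n) p : evm (X + M1 *m M2 - M3 *m M4) p
  = evm X p + evm M1 p *m evm M2 p - evm M3 p *m evm M4 p.
Proof. by rewrite evmB evmD !evmM. Qed.

Lemma evm_flat (X Y M M' : 'M[Pol]_n) p : X - Y - (M *m M' - M' *m M) = 0 ->
  (evm X p)^T - (evm Y p)^T + ((evm M p)^T *m (evm M' p)^T - (evm M' p)^T *m (evm M p)^T) = 0.
Proof.
move=> /(congr1 (fun M => (evm M p)^T)); rewrite evm0 trmx0 !(evmB, evmM) !trmxB' !trmx_mul.
by rewrite opprB.
Qed.

Lemma evm_nabla (X X' M M' G G' : 'M[Pol]_n) p : X + G *m M - M *m G = X' + G' *m M' - M' *m G' ->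
  (evm X p)^T - (evm X' p)^T + ((evm M p)^T *m (evm G p)^T - (evm G p)^T *m (evm M p)^T)
   - ((evm M' p)^T *m (evm G' p)^T - (evm G' p)^T *m (evm M' p)^T) = 0.
Proof.
move=> /(congr1 (fun M => (evm M p)^T)); rewrite !evm_cov !trmxB' !trmxD' !trmx_mul.
move=> /eqP; rewrite -subr_eq0 => /eqP; exact: abel_nabla.
Qed.

Variables (P : 'I_n -> 'I_n -> 'I_n -> Pol) (D : Pol) (d : 'I_n -> nat) (Gm Cm : 'I_n -> 'M[Pol]_n)
  (N U : 'M[Pol]_n) (sp : saito_polys P D d Gm Cm N U).
Variables (gam cc : 'I_n -> 'I_n -> 'I_n -> Pol).
Hypotheses (hgam : forall a b c, gam a b c = Gm a c b) (hcc : forall a b c, cc a b c = Cm a c b).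
Local Notation Gam := (poly_coefs gam).
Local Notation K := (poly_coefs cc).
Local Notation E := (@Euler_field R n' d).
Local Notation e := (@coord_field R n ord0).
Local Notation M0 := (M0 D).

Lemma kmx_poly (k : 'I_n -> 'I_n -> 'I_n -> Pol) (M : 'I_n -> 'M[Pol]_n) :
  (forall a b c, k a b c = M a c b) -> forall a p, kmx (poly_coefs k) a p = (evm (M a) p)^T.
Proof. by move=> h a p; apply/matrixP => b c; rewrite !mxE /poly_coefs h. Qed.

Lemma kdif_poly (k : 'I_n -> 'I_n -> 'I_n -> Pol) (M : 'I_n -> 'M[Pol]_n) :
  (forall a b c, k a b c = M a c b) -> forall p,
  kdif (poly_coefs k) p (fun i a => (evm (dm i (M a)) p)^T).
Proof.
move=> h p a; apply: dif_ext (dif_evm (M a)^T p) => q.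
  by rewrite (kmx_poly h); apply/matrixP => b c; rewrite !mxE.
by apply: eq_bigr => i _; congr (_ *: _); apply/matrixP => b c; rewrite !mxE.
Qed.

Local Notation Gk := (kmx_poly hgam).
Local Notation Ck := (kmx_poly hcc).

Lemma Gam_hol (Y : set T) : holomorphic_coefs Y Gam.
Proof. by move=> a b c; apply: (hol_poly (P := gam a b c)). Qed.
Lemma K_hol (Y : set T) : holomorphic_coefs Y K.
Proof. by move=> a b c; apply: (hol_poly (P := cc a b c)). Qed.

Lemma gam_sym a b c : gam a b c = gam b a c.
Proof. by rewrite !hgam !(sp_Gm sp) (sp_P_sym sp). Qed.
Lemma cc_sym a b c : cc a b c = cc b a c.
Proof. by rewrite !hcc (sp_Cm_sym sp). Qed.

Lemma Gam_torsion_free (Y : set T) : torsion_free Y Gam.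
Proof. by apply: torsion_free_gen => a b c p _; rewrite /poly_coefs gam_sym. Qed.

Lemma Gam_flat (Y : set T) : @open V Y -> flat Y Gam.
Proof.
move=> oY; apply: flat_gen => // p _; exists (fun i a => (evm (dm i (Gm a)) p)^T); split.
  exact: kdif_poly hgam p.
by move=> i a; rewrite !Gk; apply: evm_flat; exact: (sp_Gm_flat sp a i).
Qed.

Lemma mult_comm_gen (Y : set T) (S : coefs R n) :
  (forall a b c p, Y p -> S a b c p = S b a c p) -> mult_commutative Y S.
Proof.
move=> hs W x y p [_ sW _] _ Wp; apply/rowP => c; rewrite !mxE exchange_big /=.
by apply: eq_bigr => a _; apply: eq_bigr => b _; rewrite hs; [ring | exact: sW].
Qed.

Lemma mult_assoc_gen (Y : set T) (S : coefs R n) :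
  (forall a b c p, Y p -> S a b c p = S b a c p) ->
  (forall a b p, Y p -> kmx S a p *m kmx S b p = kmx S b p *m kmx S a p) ->
  mult_associative Y S.
Proof.
move=> hs hS W x y z p hx hy hz Wp; have Yp : Y p by have [_ h _] := hx; apply: h.
have comm (v w : vfield R n) : mult S v w p = mult S w v p.
  apply/rowP => c; rewrite !mxE exchange_big /=.
  by apply: eq_bigr => a _; apply: eq_bigr => b _; rewrite hs //; ring.
rewrite (comm (mult S x y)) mult_ad (comm y) mult_ad [RHS]mult_ad mult_ad -!mulmxA !ad_mul bl_swap.
by congr (_ *m _); apply: eq_bigr => i _; apply: eq_bigr => a _; rewrite hS.
Qed.

Lemma K_comm (Y : set T) : mult_commutative Y K.
Proof. by apply: mult_comm_gen => a b c p _; rewrite /poly_coefs cc_sym. Qed.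

Lemma K_assoc (Y : set T) : mult_associative Y K.
Proof.
apply: mult_assoc_gen => [a b c p _|a b p _]; first by rewrite /poly_coefs cc_sym.
by rewrite !Ck -!trmx_mul -!evmM (sp_Cm_comm sp).
Qed.

Lemma ad_coord (S : coefs R n) a p q : ad S (@coord_field R n a q) p = kmx S a p.
Proof.
rewrite /ad (bigD1 a) //= mxE !eqxx scale1r big1 ?addr0 // => i ia.
by rewrite mxE eqxx (negPf ia) scale0r.
Qed.

Lemma K_unit (Y : set T) : mult_unit Y K e.
Proof. by move=> W x p _ _; rewrite mult_ad ad_coord Ck (sp_Cm0 sp) evm1 trmx1 mulmx1. Qed.

Definition euler_mx : 'M[C]_n := diag_mx (\row_a ((d a)%:R / (d ord0)%:R)).

Lemma dif_Euler (p : V) : @dif C V V E p (fun v : T => v *m euler_mx).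
Proof.
apply: dif_mx => i j; have := dif_mul (dif_cst ((d j)%:R / (d ord0)%:R : C^o) p) (dif_comp_coord 0 j (dif_id p)).
apply: dif_ext => v; first by rewrite ord1 mxE.
by rewrite mul0r add0r ord1 /euler_mx mul_mx_diag !mxE mulrC.
Qed.

Lemma dC_neq0 a : (d a)%:R != 0 :> C.
Proof. by rewrite pnatr_eq0 -lt0n (sp_d sp). Qed.

Lemma trmx_lin_sum (I : finType) (c : I -> C) (M : I -> 'M[C]_n) :
  (\sum_i c i *: M i)^T = \sum_i c i *: (M i)^T.
Proof. by rewrite linear_sum; apply: eq_bigr => i _; rewrite linearZ. Qed.

(** In [lie_gen] the terms d_a + d_b - d_c cancel against the weight d_c + d_0 - d_a - d_b of
    C_ab^c; the remaining d_0, over the d_0 in E, is the coefficient 1 of (SS2). *)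
Lemma ss2_Euler (Y : set T) W x y p : local_field Y W x -> local_field Y W y -> W p ->
  bracket E (mult K x y) p - mult K (bracket E x) y p - mult K x (bracket E y) p = mult K x y p.
Proof.
move=> hx hy Wp; rewrite (lie_gen (U := Y) (K := K) (e := E) (L := euler_mx) (N := fun q a => kmx K a q) _ _ hx hy Wp).
- by rewrite mult_ad.
- by move=> q _; exact: dif_Euler.
move=> q _; exists (fun i a => (evm (dm i (Cm a)) q)^T); split; first exact: kdif_poly hcc q.
move=> a; apply/matrixP => b c; rewrite !mxDE mxNE mul_mx_diag mul_diag_mx !summxE.
have hsum (F : 'I_n -> C) : \sum_b0 euler_mx a b0 * F b0 = (d a)%:R / (d ord0)%:R * F a.
  rewrite (bigD1 a) //= !mxE eqxx mulr1n big1 ?addr0 // => i ia.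
  by rewrite !mxE eq_sym (negPf ia) mulr0n mul0r.
under [X in _ + X]eq_bigr => i _ do rewrite mxE.
rewrite hsum !Ck; have := congr1 (fun f => ev f q) (sp_Cm_weight sp a b c).
rewrite /= ev_sum evM evB !ev_nat !natrD => h.
have -> : \sum_i (E q 0 i *: (evm (dm i (Cm a)) q)^T) b c
   = (d ord0)%:R^-1 * \sum_i ev ((d i)%:R * ('x_i * mderiv i (Cm a c b))) q.
  rewrite mulr_sumr; apply: eq_bigr => i _; rewrite 5!mxE !evM ev_nat evX /=.
  by rewrite !mulrA [(d ord0)%:R^-1 * _]mulrC.
have d0 := dC_neq0 ord0.
rewrite h !mxE; move: (ev (Cm a c b) q) ((d ord0)%:R : C) ((d a)%:R : C) ((d b)%:R : C) ((d c)%:R : C) d0 => z t u v w t0.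
by field.
Qed.

Lemma E_hol (Y : set T) : holomorphic_on Y E.
Proof.
apply: hol_row => j; apply: (hol_poly (P := mpolyC n ((d j)%:R / (d ord0)%:R) * 'x_j)) => p _.
by rewrite mxE evM evC evX.
Qed.
Lemma e_hol (Y : set T) : holomorphic_on Y e.
Proof.
apply: hol_row => j; apply: (hol_poly (P := mpolyC n (e 0 0 j))) => p _.
by rewrite evC.
Qed.

Lemma ss3_e (Y : set T) W x p : local_field Y W x -> W p -> nabla Gam x e p = 0.
Proof.
move=> _ _; rewrite (nablaE _ x (dif_cst (e 0) p)) add0r; apply/rowP => c.
rewrite -[e 0]/(e p) -mult_ad !mxE big1 // => a _; rewrite (bigD1 ord0) //= big1 ?addr0 => [|i i0].
  by rewrite /poly_coefs gam_sym hgam (sp_Gm0 sp) mxE ev0 !mul0r.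
by rewrite [e p 0 i]mxE eqxx (negPf i0) mulr0.
Qed.

(* [EA p] is the matrix of v |-> nabla_v E = r v - N v acting on row vectors. *)
Definition EA p : 'M[C]_n := ((d ord0)%:R^-1%:M - evm N p)^T.

(** The symmetry of Gamma moves E into the direction slot, where [sp_N] evaluates sum_a d_a x^a
    Gamma_a. *)
Lemma nabla_Euler_mx (p : T) : @dif C V V E p (fun v : T => v *m euler_mx) /\
  forall v : T, v *m euler_mx + E p *m ad Gam v p = v *m EA p.
Proof.
split; first exact: dif_Euler.
move=> v; have d0 := dC_neq0 ord0.
have e1 : E p *m ad Gam v p = v *m ad Gam (E p) p.
  rewrite -[LHS](mult_ad Gam (fun _ => v) E) -[RHS](mult_ad Gam E (fun _ => v)).
  apply/rowP => c; rewrite !mxE exchange_big /=.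
  apply: eq_bigr => a _; apply: eq_bigr => b _; rewrite /poly_coefs gam_sym; ring.
rewrite e1 -mulmxDr; congr (_ *m _); apply: (can_inj (scalerK d0)).
rewrite /EA; apply: (can_inj trmxK).
have := congr1 (fun M => evm M p) (sp_N sp); rewrite evmZ ev_nat !evmB evm1 evm_sum => h.
rewrite trmxZ' trmxD' [in RHS]trmxZ' trmxK scalerBr h scale_scalar_mx mulfV // /ad trmx_lin_sum.
have -> : \sum_a evm (((d a)%:R * 'x_a) *: Gm a) p = (d ord0)%:R *: \sum_i E p 0 i *: (kmx Gam i p)^T.
  rewrite scaler_sumr; apply: eq_bigr => a _; rewrite evmZ evM ev_nat evX Gk trmxK scalerA mxE.
  by rewrite mulrA mulrCA mulfV ?mulr1.
have -> : evm (diag_mx (\row_a (d a)%:R)) p = (d ord0)%:R *: euler_mx^T.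
  apply/matrixP => i j; rewrite !mxE eq_sym; case: eqP => [->|_].
    by rewrite !mulr1n ev_nat mulrCA mulfV ?mulr1.
  by rewrite !mulr0n ev0 mulr0.
rewrite scalerDr; move: (_ *: euler_mx^T) (_ *: \sum_i _) => a b.
have -> : ((1 : C)%:M : 'M[C]_n) - (1%:M - a - b) = a + b.
  by apply/matrixP => i j; rewrite !(mxDE, mxBE, mxNE); ring.
by [].
Qed.

Lemma dif_EA (p : V) : @dif C V _ EA p (fun v : T => \sum_i v 0 i *: - (evm (dm i N) p)^T).
Proof.
apply: dif_mx => a b.
have h := dif_add (dif_cst (((d ord0)%:R^-1%:M : 'M[C]_n)^T a b : C^o) p)
  (dif_mul (dif_cst (-1 : C^o) p) (dif_comp_coord b a (dif_evm N p))).
apply: dif_ext h => v; first by rewrite /EA trmxB' !mxE mulN1r.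
rewrite add0r mul0r add0r summxE mulN1r summxE -sumrN; apply: eq_bigr => i _.
by rewrite !mxE mulrN.
Qed.

(** nabla E is a scalar minus N, and N is parallel. *)
Lemma ss4_Euler (Y : set T) W x y p : @open V Y -> local_field Y W x -> local_field Y W y -> W p ->
  nabla Gam x (nabla Gam y E) p - nabla Gam (nabla Gam x y) E p = 0.
Proof.
move=> oY hx hy Wp; rewrite (cov2_gen (U := Y) (Gam := Gam) (e := E) (A := EA)
  (dA := fun q i => - (evm (dm i N) q)^T) (N := fun _ _ => 0) oY _ _ _ hx hy Wp).
- by rewrite big1 ?mulmx0 // => i _; rewrite scaler0.
- by move=> q _; exists (fun _ => euler_mx); exact: nabla_Euler_mx.
- by move=> q _; exact: dif_EA.
move=> q _ i; rewrite Gk /EA (sp_N_nabla sp) evmB !evmM !trmxB' !trmx_mul.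
rewrite mulmxBl mulmxBr tr_scalar_mx scalar_mxC.
move: (_ *m _) (_ *m _) (_ *m _) => a b c.
by apply/matrixP => k j; rewrite !(mxDE, mxBE, mxNE, mxE); ring.
Qed.

Lemma saito_gen (Y : set T) : @open V Y -> saito_structure Y Gam K e E.
Proof.
move=> oY; split => //.
- exact: Gam_hol.
- exact: K_hol.
- exact: e_hol.
- exact: E_hol.
- exact: Gam_torsion_free.
- exact: Gam_flat.
- exact: K_comm.
- exact: K_assoc.
- exact: K_unit.
- apply: ss1_gen => p _; exists (fun i a => (evm (dm i (Cm a)) p)^T); split; first exact: kdif_poly hcc p.
  by move=> i a; rewrite !Gk !Ck; apply: evm_nabla; exact: (sp_Cm_nabla sp a i).
- by move=> W x y p hx hy Wp; exact: ss2_Euler hx hy Wp.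
- by move=> W x p hx Wp; exact: ss3_e hx Wp.
- by move=> W x y p hx hy Wp; exact: ss4_Euler oY hx hy Wp.
Qed.

Lemma mult_mx_E p : mult_mx K E p = (evm U p)^T.
Proof.
have -> : (evm U p)^T = ad K (E p) p.
  rewrite (sp_U sp) evm_sum /ad; apply: (can_inj trmxK); rewrite trmxK trmx_lin_sum.
  by apply: eq_bigr => a _; rewrite evmZ evM evC evX Ck trmxK mxE.
apply/row_matrixP => b; rewrite rowK mult_ad rowE; congr (_ *m _).
Qed.

Lemma det_evU p : \det (evm U p) = ev D p.
Proof. by rewrite evm_det (sp_det_U sp). Qed.

Lemma evU_unit p : (evm U p \in unitmx) = (ev D p != 0).
Proof. by rewrite unitmxE det_evU unitfE. Qed.

Lemma invertible_locus_M0 : invertible_locus K E = M0.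
Proof.
by apply/seteqP; split => p /=; rewrite /invertible_locus /Defs.M0 /= mult_mx_E unitmx_tr evU_unit.
Qed.

(** * The dual structure on M_0 *)

Definition Sm p a : 'M[C]_n := invmx (evm U p) *m evm (Cm a) p.

Lemma kmx_dual_mult a p : kmx (dual_mult K E) a p = (Sm p a)^T.
Proof.
apply/row_matrixP => b; apply/rowP => c.
rewrite mxE [LHS]mxE /dual_mult mult_mx_E mult_ad ad_coord Ck /Sm trmx_mul trmx_inv.
by rewrite -(rowE b) -row_mul mxE.
Qed.

Local Notation r := ((d ord0)%:R^-1).
Local Notation S := (dual_mult K E).
Local Notation Dc := (dual_conn r Gam K E).

Definition Omm p a : 'M[C]_n := evm (Gm a) p + evm N p *m Sm p a.

Lemma row_mult_coord (k : coefs R n) a b p :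
  mult k (@coord_field R n a) (@coord_field R n b) p = row b (kmx k a p).
Proof. by rewrite mult_ad ad_coord rowE. Qed.

(** In the dual connection, r y - nabla_y E is N y, taken at the dual product y of two coordinate
    fields. *)
Lemma kmx_dual_conn a p : kmx Dc a p = (Omm p a)^T.
Proof.
apply/row_matrixP => b; apply/rowP => c.
rewrite mxE [LHS]mxE /dual_conn (nablaE _ _ (dif_cst (delta_mx 0 b : V) p)) add0r.
rewrite -[(delta_mx 0 b : T)]/(@coord_field R n b p) -mult_ad row_mult_coord Gk row_mult_coord kmx_dual_mult.
have [h1 h2] := nabla_Euler_mx p.
rewrite (nablaE _ _ h1) h2 row_mult_coord kmx_dual_mult /EA /Omm trmxB' trmxD' trmx_mul tr_scalar_mx.
rewrite mulmxBr mul_mx_scalar -row_mul abel_conn (raddfD (row b)) /Sm !trmx_mul.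
by [].
Qed.

Lemma M0_unit p : M0 p -> evm U p \in unitmx. Proof. by rewrite evU_unit. Qed.

Lemma U_Sm p a : M0 p -> evm U p *m Sm p a = evm (Cm a) p.
Proof. by move=> Mp; rewrite /Sm mulKVmx ?M0_unit. Qed.

Definition Sr a : 'M[Pol]_n := \adj U *m Cm a.

Lemma Sm_rat p a : M0 p -> forall c b, Sm p a c b = ratf D (Sr a c b, 1%N) p.
Proof.
move=> Mp c b; suff -> : Sm p a = (ev D p)^-1 *: evm (Sr a) p.
  by rewrite !mxE /ratf /= expr1 mulrC.
apply: (can_inj (mulKmx (M0_unit Mp))); rewrite U_Sm // -scalemxAr -evmM /Sr mulmxA mul_mx_adj.
by rewrite (sp_det_U sp) mul_scalar_mx evmZ scalerA mulVf ?scale1r.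
Qed.

Definition dSm p i a : 'M[C]_n := invmx (evm U p) *m (evm (dm i (Cm a)) p - evm (dm i U) p *m Sm p a).

Lemma near_M0 p (Q : T -> Prop) : M0 p -> (forall q, M0 q -> Q q) -> \forall q \near (p : V), Q q.
Proof.
move=> Mp h; apply: filterS (open_nbhs_nbhs (conj (@open_ev_neq0 R n' D) Mp)) => q Mq; exact: h.
Qed.

(** Differentiability comes from the rational form [Sm_rat], the value of the differential from
    differentiating U S_a = C_a. *)
Lemma dif_Sm (p : V) a : M0 p ->
  @dif C V _ (fun q => Sm q a) p (fun v : T => \sum_i v 0 i *: dSm p i a).
Proof.
move=> Mp; pose dl (v : T) : 'M[C]_n := \matrix_(c, b) \sum_i v 0 i * ratf D (rat_der D i (Sr a c b, 1%N)) p.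
have h1 : @dif C V _ (fun q => Sm q a) p dl.
  apply: dif_mx => c b.
  have h : \forall q \near (p : V), (ratf D (Sr a c b, 1%N) q : C^o) = Sm q a c b.
    by apply: near_M0 => // q Mq; rewrite Sm_rat.
  by apply: dif_near h _; apply: dif_ext (dif_rat (Sr a c b, 1%N) Mp) => v; rewrite /dl ?mxE.
have h2 : \forall q \near (p : V), evm U q *m Sm q a = evm (Cm a) q.
  by apply: near_M0 => // q Mq; rewrite U_Sm.
have [_ e1] := dif_near h2 (dif_mulmx (dif_evm U p) h1).
have [_ e2] := dif_evm (Cm a) p.
apply: dif_ext h1 => // v; apply: (can_inj (mulKmx (M0_unit Mp))).
have := congr1 (fun f => f v) (etrans (esym e1) e2) => /= /(canRL (addKr _)) ->.
rewrite mulmx_sumr mulmx_suml -sumrN -big_split; apply: eq_bigr => i _ /=.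
by rewrite -scalemxAr /dSm mulKVmx ?M0_unit // scalerBr -scalemxAl addrC.
Qed.

Lemma dif_tr m k (f : V -> 'M[C]_(m, k)) (p : V) df : @dif C V _ f p df ->
  @dif C V _ (fun q => (f q)^T) p (fun v => (df v)^T).
Proof.
move=> h; apply: dif_mx => i j; apply: dif_ext (dif_comp_coord j i h) => q; by rewrite mxE.
Qed.

Lemma kdif_S p : M0 p -> kdif S p (fun i a => (dSm p i a)^T).
Proof.
move=> Mp a; apply: dif_ext (dif_tr (dif_Sm a Mp)) => q; first by rewrite kmx_dual_mult.
by rewrite trmx_lin_sum.
Qed.

Definition dOmm p i a : 'M[C]_n := evm (dm i (Gm a)) p + (evm (dm i N) p *m Sm p a + evm N p *m dSm p i a).

Lemma kdif_Dc p : M0 p -> kdif Dc p (fun i a => (dOmm p i a)^T).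
Proof.
move=> Mp a.
apply: dif_ext (dif_tr (dif_add (dif_evm (Gm a) p) (dif_mulmx (dif_evm N p) (dif_Sm a Mp)))) => q.
  by rewrite kmx_dual_conn.
rewrite -trmx_lin_sum; congr (_^T); rewrite mulmx_suml mulmx_sumr -!big_split.
by apply: eq_bigr => i _; rewrite /dOmm -scalemxAl -scalemxAr !scalerDr.
Qed.

(** P0 = D N U^-1 and P_a = D Gamma_a + P0 C_a give P_a / D = Gamma_a + N U^-1 C_a: the dual
    connection is the natural one. *)
Lemma Omm_P p a b c : M0 p -> Omm p a c b = ev (P a b c) p / ev D p.
Proof.
move=> Mp; have e1 : evm (\matrix_(c, e) P ord0 e c) p = ev D p *: (evm N p *m invmx (evm U p)).
  apply: (can_inj (mulmxK (M0_unit Mp))); rewrite -evmM (sp_PU sp) evmZ -scalemxAl mulmxKV //.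
  exact: M0_unit.
have := congr1 (fun M => evm M p) (sp_PC sp a); rewrite evmM evmB evmZ e1 -scalemxAl -mulmxA => e2.
have -> : ev (P a b c) p = (evm (\matrix_(c, e) P a e c) p) c b by rewrite !mxE.
rewrite -[evm (\matrix_(_, _) _) p](subrK (ev D p *: evm (Gm a) p)) -e2 -scalerDr mxZE addrC.
by rewrite mulrAC mulfV // mul1r.
Qed.

Lemma Dc_sym a b c p : M0 p -> Dc a b c p = Dc b a c p.
Proof.
move=> Mp; have h a' b' : Dc a' b' c p = Omm p a' c b'.
  by have /matrixP/(_ b' c) := kmx_dual_conn a' p; rewrite [LHS]mxE [RHS]mxE.
apply: etrans (h a b) _; apply: etrans (Omm_P a b c Mp) _; apply: etrans _ (esym (h b a)).
apply: etrans _ (esym (Omm_P b a c Mp)).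
by rewrite (sp_P_sym sp a b c).
Qed.

Lemma S_sym a b c p : M0 p -> S a b c p = S b a c p.
Proof.
move=> Mp; have h a' b' : S a' b' c p = Sm p a' c b'.
  by have /matrixP/(_ b' c) := kmx_dual_mult a' p; rewrite [LHS]mxE [RHS]mxE.
rewrite !h /Sm !mxE; apply: eq_bigr => i _; rewrite !mxE (sp_Cm_sym sp) //.
Qed.

Lemma tr_flat (X Y M M' : 'M[C]_n) : X - Y - (M *m M' - M' *m M) = 0 ->
  X^T - Y^T + (M^T *m M'^T - M'^T *m M^T) = 0.
Proof. by move=> /(congr1 trmx); rewrite trmx0 !trmxB' !trmx_mul opprB. Qed.

Lemma tr_nabla (X X' M M' G G' : 'M[C]_n) :
  X - X' + (G *m M - M *m G) - (G' *m M' - M' *m G') = 0 ->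
  X^T - X'^T + (M^T *m G^T - G^T *m M^T) - (M'^T *m G'^T - G'^T *m M'^T) = 0.
Proof. by move=> /(congr1 trmx); rewrite trmx0 !trmxB' trmxD' !trmxB' !trmx_mul. Qed.

Lemma evm_cov_eq (X M1 M2 M3 M4 X' M1' M2' M3' M4' : 'M[Pol]_n) p :
  X + M1 *m M2 - M3 *m M4 = X' + M1' *m M2' - M3' *m M4' ->
  evm X p + evm M1 p *m evm M2 p - evm M3 p *m evm M4 p
  = evm X' p + evm M1' p *m evm M2' p - evm M3' p *m evm M4' p.
Proof. by move=> h; rewrite -!evm_cov h. Qed.

Lemma tr_cov (X M1 M2 M3 M4 Y : 'M[C]_n) : X + M1 *m M2 - M3 *m M4 = - Y ->
  X^T + M2^T *m M1^T - M4^T *m M3^T = - Y^T.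
Proof.
move=> /(congr1 trmx); rewrite trmxB' trmxD' !trmx_mul => ->.
by apply/matrixP => b c; rewrite !mxE.
Qed.

Lemma evG_flat p a i : evm (dm i (Gm a)) p - evm (dm a (Gm i)) p
  - (evm (Gm a) p *m evm (Gm i) p - evm (Gm i) p *m evm (Gm a) p) = 0.
Proof. by rewrite -!evmM -!evmB (sp_Gm_flat sp) evm0. Qed.

Lemma evC_comm p a b : evm (Cm a) p *m evm (Cm b) p = evm (Cm b) p *m evm (Cm a) p.
Proof. by rewrite -!evmM (sp_Cm_comm sp). Qed.

Lemma evU_comm p a : evm U p *m evm (Cm a) p = evm (Cm a) p *m evm U p.
Proof. by rewrite -!evmM (sp_U_comm sp). Qed.

Lemma evC_nabla p a i :
  evm (dm i (Cm a)) p + evm (Gm i) p *m evm (Cm a) p - evm (Cm a) p *m evm (Gm i) p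
  = evm (dm a (Cm i)) p + evm (Gm a) p *m evm (Cm i) p - evm (Cm i) p *m evm (Gm a) p.
Proof. exact: evm_cov_eq (sp_Cm_nabla sp a i). Qed.

Lemma evU_nabla p i : evm (dm i U) p + evm (Gm i) p *m evm U p - evm U p *m evm (Gm i) p
  = evm (Cm i) p + evm (Cm i) p *m evm N p - evm N p *m evm (Cm i) p.
Proof. by have := congr1 (fun M => evm M p) (sp_U_nabla sp i); rewrite /= !evm_cov. Qed.

Lemma evN_nabla p i : evm (dm i N) p = evm N p *m evm (Gm i) p - evm (Gm i) p *m evm N p.
Proof. by rewrite -!evmM -!evmB (sp_N_nabla sp). Qed.

Lemma evG0 p : evm (Gm ord0) p = 0. Proof. by rewrite (sp_Gm0 sp) evm0. Qed.
Lemma evC0 p : evm (Cm ord0) p = 1%:M. Proof. by rewrite (sp_Cm0 sp) evm1. Qed.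

Lemma dm0_eq0 i : dm i (0 : 'M[Pol]_n) = 0.
Proof. by apply/matrixP => b c; rewrite !mxE mderiv0. Qed.

Lemma evdG0 p a : evm (dm ord0 (Gm a)) p = 0.
Proof.
have := evG_flat p a ord0; rewrite evG0 (sp_Gm0 sp) dm0_eq0 evm0.
by rewrite mul0mx mulmx0 !subr0.
Qed.

Lemma evdU0 p : evm (dm ord0 U) p = 1%:M. Proof. by rewrite (sp_U_der0 sp) evm1. Qed.

Lemma evdC0 p a : evm (dm ord0 (Cm a)) p = 0.
Proof.
have := evC_nabla p a ord0; rewrite evG0 evC0 (sp_Cm0 sp).
have -> : dm a (1%:M : 'M[Pol]_n) = 0.
  by apply/matrixP => b c; rewrite !mxE -mpolyC_nat mderivC.
by rewrite mul0mx mulmx0 evm0 add0r mulmx1 mul1mx subrr addr0 subr0.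
Qed.

Lemma U_dSm p i a : M0 p -> evm U p *m dSm p i a = evm (dm i (Cm a)) p - evm (dm i U) p *m Sm p a.
Proof. by move=> Mp; rewrite /dSm mulKVmx ?M0_unit. Qed.

Section AtPoint.
Variables (p : T) (Mp : M0 p).
Let Uu := M0_unit Mp.
Let US a := U_Sm a Mp.
Let UdS i a := U_dSm i a Mp.

Lemma Sm_comm a b : Sm p a *m Sm p b = Sm p b *m Sm p a.
Proof. exact: (S_comm Uu US (evC_comm p) (evU_comm p)). Qed.

Lemma Omm_flat i a : dOmm p i a - dOmm p a i - (Omm p a *m Omm p i - Omm p i *m Omm p a) = 0.
Proof.
exact: (Om_flat Uu US UdS (evC_comm p) (evU_comm p) (evC_nabla p) (evU_nabla p) (evN_nabla p) (evG_flat p)).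
Qed.

Lemma Sm_nabla i a : dSm p i a - dSm p a i + (Omm p i *m Sm p a - Sm p a *m Omm p i)
  - (Omm p a *m Sm p i - Sm p i *m Omm p a) = 0.
Proof.
exact: (S_nabla_Om Uu US UdS (evC_comm p) (evU_comm p) (evC_nabla p) (evU_nabla p)).
Qed.

Lemma dSm0 a : dSm p ord0 a = - (Sm p ord0 *m Sm p a).
Proof. exact: (dS0 Uu US UdS (evC0 p) (evdC0 p) (evdU0 p)). Qed.

Lemma Omm_e i : dOmm p i ord0 + Omm p i *m Omm p ord0 - Omm p ord0 *m Omm p i = - (Omm p ord0 *m Sm p i).
Proof.
exact: (Om_e Uu US UdS (evG0 p) (evC0 p) (evC_comm p) (evU_comm p) (evC_nabla p) (evU_nabla p)
  (evN_nabla p) (evG_flat p) (evdG0 p) (evdC0 p) (evdU0 p)).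
Qed.
End AtPoint.

Lemma S_hol : holomorphic_coefs M0 S.
Proof.
move=> a b c; apply: (hol_rat (D := D) (r := (Sr a c b, 1%N))) => // p Mp.
rewrite -(Sm_rat a Mp); have /matrixP/(_ b c) := kmx_dual_mult a p.
by rewrite [LHS]mxE [RHS]mxE.
Qed.

Lemma Dc_hol : holomorphic_coefs M0 Dc.
Proof.
move=> a b c; apply: (hol_rat (D := D) (r := (P a b c, 1%N))) => // p Mp.
rewrite /ratf /= expr1 -(Omm_P a b c Mp); have /matrixP/(_ b c) := kmx_dual_conn a p.
by rewrite [LHS]mxE [RHS]mxE.
Qed.

Lemma S_unit : mult_unit M0 S E.
Proof.
move=> W x p [_ sW _] Wp; have Mp := sW p Wp; rewrite mult_ad.
have -> : ad S (E p) p = 1%:M; last by rewrite mulmx1.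
transitivity ((invmx (evm U p) *m evm U p)^T); last by rewrite mulVmx ?trmx1 ?M0_unit.
rewrite {2}(sp_U sp) evm_sum mulmx_sumr linear_sum /ad; apply: eq_bigr => a _.
by rewrite /= kmx_dual_mult /Sm evmZ evM evC evX -scalemxAr trmxZ' mxE.
Qed.

Lemma S_comm_mult : mult_commutative M0 S.
Proof. by apply: mult_comm_gen => a b c p Mp; exact: S_sym. Qed.

Lemma S_assoc : mult_associative M0 S.
Proof.
apply: mult_assoc_gen => [a b c p Mp|a b p Mp]; first exact: S_sym.
by rewrite !kmx_dual_mult -!trmx_mul (Sm_comm Mp).
Qed.

Lemma Dc_flat : flat M0 Dc.
Proof.
apply: flat_gen => [|p Mp]; first exact: open_ev_neq0.
exists (fun i a => (dOmm p i a)^T); split; first exact: kdif_Dc.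
by move=> i a; rewrite !kmx_dual_conn; apply: tr_flat; exact: Omm_flat.
Qed.

Lemma ass1_dual W x y z p : local_field M0 W x -> local_field M0 W y ->
  local_field M0 W z -> W p ->
  nabla Dc x (mult S y z) p - mult S y (nabla Dc x z) p
    - nabla Dc y (mult S x z) p + mult S x (nabla Dc y z) p
  = mult S (bracket x y) z p.
Proof.
apply: ss1_gen => {}p Mp; exists (fun i a => (dSm p i a)^T); split; first exact: kdif_S.
by move=> i a; rewrite !kmx_dual_conn !kmx_dual_mult; apply: tr_nabla; exact: Sm_nabla.
Qed.

Lemma ad_S_e p : ad S (e p) p = (Sm p ord0)^T.
Proof. by rewrite ad_coord kmx_dual_mult. Qed.

Lemma ass2_dual W x y p : local_field M0 W x -> local_field M0 W y -> W p ->
  bracket e (mult S x y) p - mult S (bracket e x) y p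
    - mult S x (bracket e y) p + mult S e (mult S x y) p = 0.
Proof.
move=> hx hy Wp.
rewrite (lie_gen (U := M0) (K := S) (e := e) (L := 0) (N := fun q a => - (Sm q ord0 *m Sm q a)^T) _ _ hx hy Wp).
- rewrite mult_ad ad_S_e mult_ad -mulmxA -mulmxDr (_ : _ + _ = 0) ?mulmx0 //.
  rewrite /ad mulmx_suml -big_split big1 // => a _ /=.
  by rewrite kmx_dual_mult -scalemxAl -trmx_mul scalerN addNr.
- by move=> q _; apply: dif_ext (dif_cst (e 0) q) => // v; rewrite mulmx0.
move=> q Mq; exists (fun i a => (dSm q i a)^T); split; first exact: kdif_S.
move=> a; rewrite mulmx0 mul0mx subr0 addr0.
rewrite [X in _ + X]big1 ?addr0 => [|b _]; last by rewrite mxE scale0r.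
rewrite (bigD1 ord0) //= mxE !eqxx scale1r big1 ?addr0 => [|i i0].
  by rewrite (dSm0 Mq); apply/matrixP => b c; rewrite !mxE.
by rewrite mxE eqxx (negPf i0) scale0r.
Qed.

Lemma ad_Dc v p : ad Dc v p = ad Gam v p + ad S v p *m (evm N p)^T.
Proof.
rewrite /ad mulmx_suml -big_split; apply: eq_bigr => a _.
by rewrite kmx_dual_conn Gk kmx_dual_mult /Omm trmxD' trmx_mul scalerDr scalemxAl.
Qed.

Lemma ass3_dual W x p : local_field M0 W x -> W p -> nabla Dc x E p = r *: x p.
Proof.
move=> hx Wp; have Mp : M0 p by have [_ sW _] := hx; apply: sW.
have [h1 h2] := nabla_Euler_mx p.
have oM : @open V M0 by exact: open_ev_neq0.
have e1 : E p *m ad S (x p) p = x p.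
  have hs := S_unit hx Wp; rewrite -{2}hs -mult_ad.
  apply/rowP => c; rewrite !mxE exchange_big /=; apply: eq_bigr => a _; apply: eq_bigr => b _.
  by rewrite (S_sym _ _ _ Mp); ring.
rewrite (nablaE _ x h1) ad_Dc mulmxDr addrA h2 mulmxA e1 /EA trmxB' tr_scalar_mx mulmxBr mul_mx_scalar.
by rewrite subrK.
Qed.

Lemma nabla_e_mx p v : M0 p -> e p *m ad Dc v p = v *m kmx Dc ord0 p.
Proof.
move=> Mp; rewrite -[LHS](mult_ad Dc (fun _ => v) e); apply/rowP => c; rewrite !mxE.
apply: eq_bigr => a _; rewrite (bigD1 ord0) //= big1 ?addr0 => [|i i0].
  by rewrite !mxE !eqxx mulr1 (Dc_sym _ _ _ Mp) mulrC.
by rewrite [e p 0 i]mxE eqxx (negPf i0) mulr0.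
Qed.

Lemma ass4_dual W x y p : local_field M0 W x -> local_field M0 W y -> W p ->
  nabla Dc x (nabla Dc y e) p - nabla Dc (nabla Dc x y) e p
    + nabla Dc (mult S x y) e p = 0.
Proof.
move=> hx hy Wp; have Mp : M0 p by have [_ sW _] := hx; apply: sW.
rewrite (cov2_gen (U := M0) (Gam := Dc) (e := e) (A := kmx Dc ord0)
  (dA := fun q i => (dOmm q i ord0)^T) (N := fun q i => - (Omm q ord0 *m Sm q i)^T) _ _ _ _ hx hy Wp).
- rewrite (nablaE _ _ (dif_cst (e 0) p)) add0r -[e 0]/(e p) nabla_e_mx // mult_ad -mulmxA -mulmxDr.
  rewrite (_ : _ + _ = 0) ?mulmx0 // /ad mulmx_suml -big_split big1 // => a _ /=.
  by rewrite kmx_dual_conn kmx_dual_mult -scalemxAl -trmx_mul scalerN addNr.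
- exact: open_ev_neq0.
- move=> q Mq; exists (fun _ => 0); split.
    by apply: dif_ext (dif_cst (e 0) q) => // v; rewrite mulmx0.
  by move=> v; rewrite mulmx0 add0r nabla_e_mx.
- by move=> q Mq; exact: kdif_Dc.
by move=> q Mq i; rewrite !kmx_dual_conn; apply: tr_cov; exact: Omm_e.
Qed.

Lemma almost_saito_dual : (exists p, M0 p) -> almost_saito_structure M0 r Dc S E e.
Proof.
move=> [p0 Mp0]; split.
- exact: open_ev_neq0.
- exact: Dc_hol.
- exact: S_hol.
- exact: E_hol.
- exact: e_hol.
- exists p0 => //; apply/eqP => /rowP/(_ ord0); rewrite !mxE !eqxx => /eqP.
  by rewrite oner_eq0.
- by apply: torsion_free_gen => a b c p Mp; exact: Dc_sym.
- exact: Dc_flat.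
- exact: S_comm_mult.
- exact: S_assoc.
- exact: S_unit.
- exact: ass1_dual.
- exact: ass2_dual.
- exact: ass3_dual.
- exact: ass4_dual.
Qed.

(** As Gamma_0 = 0 and C_0 = 1, v |-> nabla_v e is N U^-1 up to transposition, and det N is a
    nonzero constant. *)
Lemma dual_regular : regular M0 Dc e.
Proof.
move=> p Mp; have [z z0 hz] := sp_det_N sp.
have uQ : kmx Dc ord0 p \in unitmx.
  rewrite kmx_dual_conn unitmx_tr /Omm (sp_Gm0 sp) evm0 add0r /Sm (sp_Cm0 sp) evm1 mulmx1.
  by rewrite unitmx_mul unitmx_inv M0_unit // andbT unitmxE evm_det hz evC unitfE.
have h v : nabla Dc (fun _ => v) e p = v *m kmx Dc ord0 p.
  by rewrite (nablaE _ _ (dif_cst (e 0) p)) add0r -[e 0]/(e p) nabla_e_mx.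
by exists (fun v => v *m invmx (kmx Dc ord0 p)) => v; rewrite h ?mulmxK ?mulmxKV.
Qed.

Lemma e_poly_field : poly_field_of_degree d (- (d ord0)%:Z) e.
Proof.
exists (fun c => mpolyC n (c == ord0)%:R); split.
  by move=> p; apply/rowP => c; rewrite !mxE evC eqxx.
move=> c m; case: eqP => [->|_]; last by rewrite mpolyC0 msupp0.
rewrite subrr msuppC oner_eq0 inE => /eqP ->.
by rewrite big1 // => a _; rewrite mnm0E muln0.
Qed.
End Evaluate.

Opaque poly_eval.

(** * Fractions of polynomials *)

Section Fractions.
Variables (A : idomainType).
Local Notation tf := (@tofrac A).

Lemma tofrac_inj : injective tf.
Proof. by move=> p q /eqP; rewrite tofrac_eq => /eqP. Qed.

Lemma tofrac_neq0 (q : A) : q != 0 -> tf q != 0.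
Proof. by rewrite tofrac_eq0. Qed.

Lemma tofrac_div_eq (p q p' q' : A) : q != 0 -> q' != 0 ->
  tf p / tf q = tf p' / tf q' -> p * q' = p' * q.
Proof.
move=> q0 q'0 h; apply: tofrac_inj; rewrite !rmorphM /=.
have := congr1 (fun z => z * (tf q * tf q')) h.
by rewrite mulrA divfK ?tofrac_neq0 // => ->; rewrite mulrCA divfK ?tofrac_neq0 // mulrC.
Qed.

Lemma div_tofrac_eq (p q p' q' : A) : q != 0 -> q' != 0 -> p * q' = p' * q ->
  tf p / tf q = tf p' / tf q'.
Proof.
move=> q0 q'0 /(congr1 tf); rewrite !rmorphM /= => h.
by apply/eqP; rewrite eqr_div ?tofrac_neq0 // h.
Qed.

Lemma Cramer_frac n (P0 Pa Ga Ca : 'M[A]_n) (D : A) : D != 0 -> \det P0 != 0 ->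
  P0 *m Ca = Pa - D *: Ga ->
  invmx ((tf D)^-1 *: map_mx tf P0) *m ((tf D)^-1 *: map_mx tf Pa - map_mx tf Ga) = map_mx tf Ca.
Proof.
move=> D0 dP h; have DF := tofrac_neq0 D0.
have uP : (tf D)^-1 *: map_mx tf P0 \in unitmx.
  by rewrite unitmxZ ?unitfE ?invr_eq0 // unitmxE det_map_mx unitfE tofrac_neq0.
apply: (can_inj (mulKmx uP)); rewrite mulKVmx // -scalemxAl -map_mxM h map_mxB map_mxZ.
by rewrite scalerBr scalerA mulVf // scale1r.
Qed.
End Fractions.

(** * The discriminant and flat basic invariants *)

Section Discriminant.
Variables (R : realType) (n : nat) (G : {fset 'M[R[i]]_n}).
Hypothesis G1 : 1%:M \in enum_fset G.
Local Notation Gs := (enum_fset G).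
Let G_uniq : uniq Gs := fset_uniq G.

Lemma stabilizer_order_stab (l l' : 'rV[R[i]]_n) : l' != 0 ->
  (forall u : 'cV[R[i]]_n, l *m u = 0 <-> l' *m u = 0) -> stabilizer_order G l = size (stab Gs l').
Proof.
move=> l0 h; rewrite /stabilizer_order; apply: perm_size; apply: uniq_perm.
- exact: fset_uniq.
- exact/filter_uniq/fset_uniq.
move=> g; apply/idP/idP.
  rewrite -[_ \in enum_fset _]/(g \in _) !inE /= => /andP[gG /asboolP hg].
  by apply/(stabP G_uniq G1 l0 g); split=> // u /(h u).2; exact: hg.
move=> /(stabP G_uniq G1 l0 g)[gG hg]; rewrite -[_ \in enum_fset _]/(g \in _) !inE /= gG.
by apply/asboolP => u /h /hg.
Qed.

(** A nontrivial g in the stabilizer is a reflection, because g - 1 = (g - 1) v l has rank one. Its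
    form in Ls has the same kernel as l, so it is a nonzero multiple of l with the same stabilizer
    order. *)
Lemma disc_div (Ls : seq 'rV[R[i]]_n) : hyperplane_forms G Ls -> forall l, l != 0 ->
  (1 < size (stab Gs l))%N ->
  exists q, \prod_(l <- Ls) lin l ^+ stabilizer_order G l = lin l ^+ size (stab Gs l) * q.
Proof.
move=> hL l l0 hs; have lv := mul_dvec G_uniq G1 l0; set v := dvec _ l in lv.
have [g gs g1] : exists2 g, g \in stab Gs l & g != 1%:M.
  apply: contraPP hs => hn; apply/negP; rewrite -leqNgt.
  have su : uniq (stab Gs l) by apply/filter_uniq/fset_uniq.
  apply: (@uniq_leq_size _ _ [:: 1%:M] su) => g gs; rewrite inE.
  by apply/negPn/negP => g1; apply: hn; exists g.
have [gG gfix] := elimT (stabP G_uniq G1 l0 g) gs.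
have grefl : reflection g.
  rewrite /reflection eqn_leq; apply/andP; split; last first.
    by rewrite lt0n mxrank_eq0 subr_eq0.
  have e : g - 1%:M = (g - 1%:M) *m v *m l.
    move: gs; rewrite mem_filter => /andP[/eqP e _].
    by move: e; rewrite mulmxBr mulmx1 mulmxA => /subr0_eq.
  by rewrite e (leq_trans (mxrankM_maxr _ _)) // rank_leq_row.
have [l' l'L hl'] := hf_all hL gG grefl.
have el' : l' = (l' *m v) 0 0 *: l.
  apply/eqP; rewrite -subr_eq0; apply/eqP.
  have -> : l' - (l' *m v) 0 0 *: l = l' *m (1%:M - v *m l).
    by rewrite mulmxBr mulmx1 mulmxA -mul_scalar_mx -mx11_scalar.
  apply/rowP => j; rewrite [RHS]mxE.
  have := hl' (col j (1%:M - v *m l)); rewrite colE !mulmxA => -[_ h].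
  have h0 : col j (l' *m (1%:M - v *m l)) = 0.
    rewrite colE; apply: h; rewrite -!mulmxA; apply: gfix.
    by rewrite !mulmxA mulmxBr mulmx1 mulmxA lv mul1mx subrr mul0mx.
  by have /colP/(_ 0) := h0; rewrite [LHS]mxE [RHS]mxE.
set c := (l' *m v) 0 0 in el'.
have c0 : c != 0.
  apply/eqP => c0; move/eqP: g1; apply; apply/matrixP => i j.
  have := (hl' (delta_mx j 0)).1; rewrite el' c0 scale0r mul0mx => /(_ erefl) h.
  have := congr1 (fun M : 'cV_n => M i 0) h; rewrite -colE !mxE => ->.
  by rewrite eqxx andbT.
have so : stabilizer_order G l' = size (stab Gs l).
  apply: stabilizer_order_stab => // u; rewrite el' -scalemxAl; split=> [h|->]; last by rewrite scaler0.
  by have := congr1 (fun M => c^-1 *: M) h; rewrite /= scalerA mulVf // scale1r scaler0.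
exists (mpolyC n (c ^+ size (stab Gs l)) * \prod_(l <- rem l' Ls) lin l ^+ stabilizer_order G l).
rewrite (big_rem _ l'L) /= so {1}el' linearZ /= exprZn mulrA -mul_mpolyC [_ * lin l ^+ _]mulrC.
by [].
Qed.
End Discriminant.

(** * Homogeneity and the Euler operator *)

Section Euler.
Variables (K : numFieldType) (n' : nat).
Local Notation n := n'.+1.
Local Notation Pol := (mpoly n K).

Lemma eulerE (f : Pol) : euler f = weuler (fun _ => 1%N) f.
Proof. by apply: eq_bigr => i _; rewrite scale1r. Qed.

Lemma wt1 (m : multinom n) : wt (fun _ => 1%N) m = mdeg m.
Proof. by rewrite mdegE /wt; apply: eq_bigr => i _; rewrite mul1n. Qed.

Lemma euler_homog (f : Pol) k : f \is ishomog1 k (@mdeg n) -> euler f = k%:R *: f.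
Proof.
move=> /dhomogP h; apply/mpolyP => m; rewrite eulerE weuler_coeff mcoeffZ wt1.
have [mf|mf] := boolP (m \in msupp f); first by rewrite (h m mf).
by rewrite (memN_msupp_eq0 mf) !mulr0.
Qed.

Lemma homog_euler (f : Pol) (k : nat) : euler f = k%:R *: f -> f \is ishomog1 k (@mdeg n).
Proof.
rewrite eulerE => h; apply/dhomogP => m mf; rewrite -[LHS]/(mdeg m) -wt1.
have e : weuler (fun _ => 1%N) f = (k%:R - 0%:R) *: f by rewrite subr0.
by rewrite -(weight_supp e mf) addn0.
Qed.

Lemma euler_exp_lin (l : 'rV[K]_n) k : euler (lin l ^+ k) = k%:R *: lin l ^+ k.
Proof.
have e1 : euler (lin l) = lin l.
  rewrite /euler {2}/lin; apply: eq_bigr => i _.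
  by rewrite mderiv_lin mulrC mul_mpolyC.
elim: k => [|k IH].
  by rewrite expr0 scale0r /euler big1 // => i _; rewrite -mpolyC1 mderivC mulr0.
by rewrite exprS eulerM e1 IH -natr1 -scalerAr addrC scalerDl scale1r.
Qed.

Lemma euler_prod_lin (s : seq 'rV[K]_n) (k : 'rV[K]_n -> nat) :
  exists w : nat, euler (\prod_(l <- s) lin l ^+ k l) = w%:R *: \prod_(l <- s) lin l ^+ k l.
Proof.
elim: s => [|l s [w IH]].
  exists 0%N; rewrite big_nil scale0r /euler big1 // => i _.
  by rewrite -mpolyC1 mderivC mulr0.
exists (k l + w)%N; rewrite big_cons eulerM IH euler_exp_lin natrD scalerDl.
by rewrite scalerAl scalerAr.
Qed.
End Euler.

(** * Inverting a triangular change of variables *)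

Section TriangularChange.
Variables (K : numFieldType) (n : nat) (T : n.-tuple (mpoly n K)) (d : 'I_n -> nat).
Local Notation Pol := (mpoly n K).
Hypothesis hT : forall c b, (d c <= d b)%N -> mderiv b (tnth T c) = (b == c)%:R.

Lemma det_triangular_jac : (forall a b : 'I_n, (a <= b)%N -> (d b <= d a)%N) ->
  \det (\matrix_(c, i) mderiv i (tnth T c)) = 1.
Proof.
move=> hs; rewrite -det_tr det_trig.
  by apply: big1 => i _; rewrite !mxE hT // eqxx.
apply/is_trig_mxP => i j ij; rewrite !mxE hT; last exact/hs/ltnW.
by rewrite (_ : (i == j) = false) //; apply/eqP => e; rewrite e ltnn in ij.
Qed.

Definition in_image (f : Pol) := exists Q : Pol, comp_mpoly T Q = f.

Lemma in_imageD f g : in_image f -> in_image g -> in_image (f + g).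
Proof. by move=> [P <-] [Q <-]; exists (P + Q); rewrite comp_mpolyD. Qed.
Lemma in_imageM f g : in_image f -> in_image g -> in_image (f * g).
Proof. by move=> [P <-] [Q <-]; exists (P * Q); rewrite rmorphM. Qed.
Lemma in_imageC c : in_image (mpolyC n c).
Proof. by exists (mpolyC n c); rewrite comp_mpolyC. Qed.

(** A variable that occurs in f is detected by a nonzero derivative of f. *)
Lemma in_image_vars (f : Pol) : (forall b, mderiv b f != 0 -> in_image 'x_b) -> in_image f.
Proof.
move=> h; rewrite [f]mpolyE big_seq; apply: big_ind => [||m mf].
- by rewrite -mpolyC0; exact: in_imageC.
- exact: in_imageD.
rewrite -mul_mpolyC; apply: in_imageM; first exact: in_imageC.
rewrite mpolyXE_id; apply: big_ind => [||b _].
- by rewrite -mpolyC1; exact: in_imageC.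
- exact: in_imageM.
have [->|mb] := eqVneq (m b) 0%N; first by rewrite expr0 -mpolyC1; exact: in_imageC.
have ib : in_image 'x_b.
  apply: h; apply/eqP => /(congr1 (mcoeff (mnm_sub m (mnm1 b)))).
  rewrite mcoeff0 mcoeff_deriv submK ?lep1mP // mnmBE mnm1E eqxx => /eqP.
  rewrite mulrn_eq0 /= => /eqP e; move: mf; rewrite mcoeff_msupp e eqxx //.
elim: (m b) => [|k IH]; first by rewrite expr0 -mpolyC1; exact: in_imageC.
by rewrite exprS; apply: in_imageM.
Qed.

(** T_c - x_c involves only variables of degree below d_c, so x_c = T_c - (T_c - x_c) lies in the
    image by induction on the degree. *)
Lemma triangular_inverse : exists Y : n.-tuple Pol, forall a, comp_mpoly T (tnth Y a) = 'x_a.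
Proof.
have h m : forall c, (d c < m)%N -> in_image 'x_c.
  elim: m => // m IH c hc.
  have -> : 'x_c = tnth T c + - 1%:R * (tnth T c - 'x_c) :> Pol by ring.
  apply: in_imageD; first by exists 'x_c; rewrite comp_mpolyXi.
  apply: in_imageM; first by rewrite -mpolyC_nat -mpolyCN; exact: in_imageC.
  apply: in_image_vars => b hb; apply: IH; rewrite ltnS in hc; apply: leq_trans hc.
  rewrite ltnNge; apply: contra hb => le.
  by rewrite mderivB hT // mderivX1 subrr.
have h2 c : in_image 'x_c by apply: (h (d c).+1).
have [Y hY] := fin_all_exists h2.
by exists [tuple Y a | a < n] => a; rewrite tnth_mktuple.
Qed.
End TriangularChange.

Section Evaluation.
Variables (R : realType) (n' : nat).
Local Notation n := n'.+1.
Local Notation Pol := (mpoly n R[i]).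

Lemma ev_comp (T : n.-tuple Pol) (Q : Pol) p :
  poly_eval (comp_mpoly T Q) p = poly_eval Q (\row_j poly_eval (tnth T j) p).
Proof.
elim/mpoly_ring_ind: Q => [c|a|P Q hP hQ|P Q hP hQ].
- by rewrite comp_mpolyC !evC.
- by rewrite comp_mpolyXi evX mxE.
- apply: etrans (congr1 (fun f => poly_eval f p) (comp_mpolyD T P Q)) _.
  apply: etrans (evD _ _ _) _; apply: etrans _ (esym (evD _ _ _)).
  exact: (f_equal2 _ hP hQ).
- apply: etrans (congr1 (fun f => poly_eval f p) (rmorphM (comp_mpoly T) P Q)) _.
  apply: etrans (evM _ _ _) _; apply: etrans _ (esym (evM _ _ _)).
  exact: (f_equal2 _ hP hQ).
Qed.

(** The differential of a function that vanishes everywhere is zero, so by induction on the degree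
    all partial derivatives are 0 and the polynomial is constant. *)
Lemma ev_eq0 (P : Pol) : (forall p, poly_eval P p = 0) -> P = 0.
Proof.
suff H k : forall P : Pol, (mmeasure mdeg P <= k)%N -> (forall p, poly_eval P p = 0) -> P = 0.
  exact: H (leqnn _).
elim: k => [|k IH] Q hQ h0.
  by apply/eqP; rewrite -msize_poly_eq0 -leqn0.
have [c hc] : exists c, Q = mpolyC n c.
  apply: mderiv_eq0_const => a; apply: IH; first exact: msize_mderiv.
  move=> p; have := dif_poly Q p.
  have -> : poly_eval Q = (fun _ => 0) by apply/funext.
  move=> [_ e1]; have [_ e2] := dif_cst (0 : R[i]^o) (p : Cn R n).
  have := congr1 (fun f => f (delta_mx 0 a)) (etrans (esym e2) e1) => /=.
  rewrite (bigD1 a) //= mxE !eqxx mul1r big1 ?addr0 // => i ia.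
  by rewrite mxE eqxx (negPf ia) mul0r.
by move: (h0 0); rewrite hc evC => ->; rewrite mpolyC0.
Qed.
End Evaluation.

(** * Identification of the objects defined by choice *)

Section Bridge.
Variables (R : realType) (n' : nat).
Local Notation n := n'.+1.
Local Notation Pol := (mpoly n R[i]).
Local Notation tf := (@tofrac Pol).
Variables (x : n.-tuple Pol) (D : Pol) (P : 'I_n -> 'I_n -> 'I_n -> Pol).
Hypotheses (x_inj : injective (comp_mpoly x)) (D0 : D != 0)
  (hP : forall a b c, tf (comp_mpoly x D) * Omega_V x a b c = tf (comp_mpoly x (P a b c))).

Lemma comp_neq0 (Q : Pol) : Q != 0 -> comp_mpoly x Q != 0.
Proof.
move=> Q0; apply/eqP => h; move/eqP: Q0; apply; apply: x_inj.
by rewrite h comp_mpoly0.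
Qed.

Lemma Omega_VE a b c : Omega_V x a b c = tf (comp_mpoly x (P a b c)) / tf (comp_mpoly x D).
Proof.
apply: (canRL (mulfK _)); first exact/tofrac_neq0/comp_neq0.
by rewrite mulrC.
Qed.

(** [xget] is resolved by uniqueness: two fractions with the same image in C(u) are equal after
    substitution of x, hence before it, since this substitution is injective. *)
Lemma OmegaE a b c : Omega x a b c = tf (P a b c) / tf D.
Proof.
apply: xget_unique.
  exists (P a b c), D; split; [exact: comp_neq0 | exact: erefl | exact: esym (Omega_VE a b c)].
move=> F [P' [Q [Q0 -> h]]].
have Q'0 : Q != 0 by apply/eqP => e; move: Q0; rewrite e comp_mpoly0 eqxx.
apply: (div_tofrac_eq Q'0 D0); apply: x_inj.
apply: etrans (rmorphM _ _ _) _; apply: etrans _ (esym (rmorphM _ _ _)).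
exact: (tofrac_div_eq Q0 (comp_neq0 D0) (etrans h (Omega_VE a b c))).
Qed.

Lemma Delta_OmegaE a b c : Delta_Omega x D a b c = P a b c.
Proof.
have e : tf (P a b c) = tf D * Omega x a b c.
  by rewrite OmegaE mulrCA mulfV ?mulr1 // tofrac_neq0.
by apply: xget_unique => // Q hQ; apply: tofrac_inj; rewrite hQ -e.
Qed.

Lemma Gamma_polyE a b c : Gamma_poly x D a b c = cf n (P a b c).
Proof. by rewrite /Gamma_poly Delta_OmegaE /cf coef_psi. Qed.

Variables (Gm Cm : 'I_n -> 'M[Pol]_n) (N U : 'M[Pol]_n) (d : 'I_n -> nat).
Hypothesis sp : saito_polys P D d Gm Cm N U.

Lemma C_polyE a b c : C_poly x D a b c = Cm a c b.
Proof.
have e : invmx (Omega_mx x ord0) *m (Omega_mx x a - Gamma_mx x D a) = map_mx tf (Cm a).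
  rewrite -(Cramer_frac D0 (sp_det_P0 sp) (sp_PC sp a)).
  have e1 a' : Omega_mx x a' = (tf D)^-1 *: map_mx tf (\matrix_(c, e) P a' e c).
    by apply/matrixP => i j; rewrite !mxE OmegaE mulrC.
  have e2 : Gamma_mx x D a = map_mx tf (Gm a).
    by apply/matrixP => i j; rewrite !mxE Gamma_polyE (sp_Gm sp).
  by rewrite !e1 e2.
apply: xget_unique => [|Q]; rewrite e mxE //; exact: tofrac_inj.
Qed.

Lemma frac_evalE a b c p : poly_eval D p != 0 ->
  natural_conn x a b c p = poly_eval (P a b c) p / poly_eval D p.
Proof.
move=> Dp; apply: xget_unique; first by exists (P a b c), D; split=> //; exact: OmegaE.
move=> z [P' [Q [Q0 h ->]]].
have Q'0 : Q != 0 by apply/eqP => e; move: Q0; rewrite e ev0 eqxx.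
have := tofrac_div_eq D0 Q'0 (etrans (esym (OmegaE a b c)) h).
move=> /(congr1 (fun f => poly_eval f p)); rewrite (evM (P a b c) Q) (evM P' D) => e.
by apply/eqP; rewrite eqr_div // e.
Qed.
End Bridge.

Opaque poly_eval.

Lemma derivative_of_inverse (A : comNzRingType) k (J Jv G X : 'M[A]_k) :
  Jv *m J = 1%:M -> J *m G *m Jv + J *m X = 0 -> X = - (G *m Jv).
Proof.
move=> JJ /(congr1 (mulmx Jv)); rewrite mulmx0 mulmxDr !mulmxA JJ !mul1mx addrC => /eqP.
by rewrite addr_eq0 => /eqP.
Qed.

Lemma comp_mpolyK (A : comNzRingType) k (T Y : k.-tuple (mpoly k A)) :
  (forall a, comp_mpoly T (tnth Y a) = 'x_a) -> forall Q, comp_mpoly T (comp_mpoly Y Q) = Q.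
Proof.
move=> h Q; rewrite comp_mpoly_comp -[RHS]comp_mpoly_id; congr comp_mpoly.
by apply: eq_from_tnth => a; rewrite !tnth_mktuple h.
Qed.

Lemma comp_mpoly_change (A : comNzRingType) k l (x : k.-tuple (mpoly l A)) (T Y : k.-tuple (mpoly k A)) :
  (forall a, comp_mpoly T (tnth Y a) = 'x_a) -> forall Q,
  comp_mpoly x Q = comp_mpoly [tuple comp_mpoly x (tnth T a) | a < k] (comp_mpoly Y Q).
Proof. by move=> h Q; rewrite -comp_mpoly_comp comp_mpolyK. Qed.

Lemma Omega_V_OmegaV (R : realType) n (x : n.-tuple (mpoly n R[i])) a b c :
  OmegaV x (@tofrac (mpoly n R[i])) a b c = Omega_V x a b c.
Proof. by rewrite /Omega_V /OmegaV /Jinv. Qed.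

(** * The frame of flat coordinates *)

Section FlatCoordinates.
Variables (R : realType) (n' : nat).
Local Notation n := n'.+1.
Local Notation Pol := (mpoly n R[i]).
Local Notation dm i M := (map_mx (mderiv i) M).
Variables (T : n.-tuple Pol) (Gm Cm : 'I_n -> 'M[Pol]_n) (gam cc : 'I_n -> 'I_n -> 'I_n -> Pol).
Hypotheses (hgam : forall a b c, gam a b c = Gm a c b) (hcc : forall a b c, cc a b c = Cm a c b).
Local Notation J := (Defs.jacobian T).
Hypotheses (dJ : \det J = 1)
  (hT : forall c a b, mderiv a (mderiv b (tnth T c)) = \sum_e Gm a e b * mderiv e (tnth T c)).

Lemma map_evE m k (M : 'M[Pol]_(m, k)) p : map_mx (fun P => poly_eval P p) M = evm M p.
Proof. by apply/matrixP => i j; rewrite !mxE. Qed.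

Lemma evJ_unit p : evm J p \in unitmx.
Proof. by rewrite unitmxE evm_det dJ ev1 unitr1. Qed.

Lemma evJ_inv p : invmx (evm J p) = evm (\adj J) p.
Proof.
apply: (can_inj (mulKmx (evJ_unit p))).
by rewrite mulmxV ?evJ_unit // -evmM mul_mx_adj dJ evm1.
Qed.

Lemma coord_field_ofE c p : coord_field_of T c p = row c (evm (\adj J) p)^T.
Proof. by rewrite /coord_field_of map_evE evJ_inv tr_col. Qed.

Lemma dm_mulmx i (M M' : 'M[Pol]_n) : dm i (M *m M') = dm i M *m M' + M *m dm i M'.
Proof.
apply/matrixP => a b; rewrite !mxE (raddf_sum (mderiv i)) -big_split; apply: eq_bigr => k _.
by rewrite /= mderivM !mxE.
Qed.

(** As det J = 1, the adjugate is a polynomial inverse of J; the flatness of the T_c reads d_i J = J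
    Gamma_i. *)
Lemma dm_adjJ i : dm i (\adj J) = - (Gm i *m \adj J).
Proof.
have dJi : dm i J = J *m Gm i.
  by apply/matrixP => c b; rewrite !mxE hT; apply: eq_bigr => e _; rewrite !mxE mulrC.
have e := dm_mulmx i J (\adj J).
have z : dm i (J *m \adj J) = 0.
  rewrite mul_mx_adj dJ; apply/matrixP => a b; rewrite !mxE.
  by rewrite -mpolyC_nat mderivC.
apply: (derivative_of_inverse (J := J)); first by rewrite mul_adj_mx dJ.
by rewrite -dJi -e z.
Qed.

Lemma flat_coordinatesP : flat_coordinates (poly_coefs gam) T.
Proof.
split=> [p|a b p]; first by rewrite map_evE evJ_unit.
have h : @dif R[i] (Cn R n) (Cn R n) (coord_field_of T b) p
    (fun v : 'rV[R[i]]_n => \sum_i v 0 i *: row b (evm (dm i (\adj J)) p)^T).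
  apply: dif_mx => k j; have := dif_comp_coord j b (dif_evm (\adj J) p).
  apply: dif_ext => q; first by rewrite coord_field_ofE !mxE.
  by rewrite !summxE; apply: eq_bigr => i _; rewrite !mxE.
rewrite (nablaE _ _ h) [coord_field_of T b p]coord_field_ofE /ad mulmx_sumr -big_split big1 // => i _ /=.
rewrite -scalemxAr -scalerDr dm_adjJ (kmx_poly hgam) -row_mul -trmx_mul -evmM.
suff -> : evm (- (Gm i *m \adj J)) p = - evm (Gm i *m \adj J) p.
  by apply/rowP => j; rewrite !mxE addNr mulr0.
by apply/matrixP => c e; rewrite !mxE evN.
Qed.

(** [M a] is the product by d/dt^a in the frame d/dx and [B a] the same in the frame d/dt; the
    entries of [B a] are polynomials in x, which Y rewrites in t. *)
Lemma polynomial_multP (Y : n.-tuple Pol) : (forall a, comp_mpoly T (tnth Y a) = 'x_a) ->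
  polynomial_mult (poly_coefs cc) T.
Proof.
move=> hY.
pose M a : 'M[Pol]_n := \sum_i (\adj J) i a *: (Cm i)^T.
pose B a : 'M[Pol]_n := (\adj J)^T *m M a *m J^T.
have evT (L : 'M[Pol]_n) p : evm L^T p = (evm L p)^T by apply/matrixP => i j; rewrite !mxE.
have evadj p : (evm J p)^T *m (evm (\adj J) p)^T = 1%:M.
  by rewrite -trmx_mul -evmM mul_adj_mx dJ evm1 trmx1.
exists (fun a b c => comp_mpoly Y (B a b c)) => a b p.
have -> : mult (poly_coefs cc) (coord_field_of T a) (coord_field_of T b) p
    = row b ((evm (\adj J) p)^T *m evm (M a) p).
  rewrite mult_ad !coord_field_ofE -row_mul; congr (row b (_ *m _)).
  rewrite /ad /M evm_sum; apply: eq_bigr => i _.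
  by rewrite evmZ evT (kmx_poly hcc) !mxE.
have -> : row b ((evm (\adj J) p)^T *m evm (M a) p) = row b (evm (B a) p) *m (evm (\adj J) p)^T.
  by rewrite -row_mul /B !evmM !evT -!mulmxA evadj mulmx1.
rewrite mulmx_sum_row; apply: eq_bigr => c _; rewrite -coord_field_ofE; congr (_ *: _).
rewrite 2!mxE -ev_comp; exact: (congr1 (fun f => poly_eval f p) (esym (comp_mpolyK hY _))).
Qed.
End FlatCoordinates.

Section BasicInvariants.
Variables (R : realType) (n' : nat).
Local Notation n := n'.+1.
Local Notation Pol := (mpoly n R[i]).

Lemma basic_invariants_comp (G : {fset 'M[R[i]]_n}) (x T Y : n.-tuple Pol) (d : 'I_n -> nat) :
  basic_invariants G x -> (forall a, euler (tnth x a) = (d a)%:R *: tnth x a) ->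
  (forall c, weuler d (tnth T c) = (d c)%:R *: tnth T c) ->
  (forall a, comp_mpoly T (tnth Y a) = 'x_a) ->
  basic_invariants G [tuple comp_mpoly x (tnth T a) | a < n].
Proof.
move=> hx xe Te hY; split.
- move=> a; exists (d a); rewrite tnth_mktuple; apply: homog_euler.
  by rewrite (euler_comp xe) Te comp_mpolyZ.
- move=> a; rewrite tnth_mktuple.
  exact: (comp_mpoly_invariant (G := enum_fset G) (bi_invariant hx) (tnth T a)).
move=> f /(bi_generate hx) [Q ->]; exists (comp_mpoly Y Q).
exact: comp_mpoly_change hY Q.
Qed.
End BasicInvariants.

Theorem theorem7p5 (R : realType) (n' : nat)
  (G : {fset 'M[R[i]]_n'.+1}) (hG : reflection_group G)
  (x : n'.+1.-tuple (mpoly n'.+1 R[i])) (hx : basic_invariants G x)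
  (d : 'I_n'.+1 -> nat)
  (hdeg : forall a, tnth x a \is ishomog1 (d a) (@mdeg n'.+1))
  (hsort : forall a b : 'I_n'.+1, (a <= b)%N -> (d b <= d a)%N)
  (hd : forall a, (1 < d a)%N)
  (Ls : seq 'rV[R[i]]_n'.+1) (hLs : hyperplane_forms G Ls)
  (Delta : mpoly n'.+1 R[i])
  (hDelta : comp_mpoly x Delta = discriminant_V G Ls)
  (hmonic : monic_in_x1 n'.+1 Delta) :
  let M : set 'rV[R[i]]_n'.+1 := setT in
  let Gam := poly_coefs (Gamma_poly x Delta) in
  let K := poly_coefs (C_poly x Delta) in
  let e := @coord_field R n'.+1 ord0 in
  let E := @Euler_field R n' d in
  let r := (d ord0)%:R^-1 in
  [/\ torsion_free M Gam /\ flat M Gam,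
      [/\ mult_commutative M K, mult_associative M K & mult_unit M K e],
      polynomial_saito_structure G x Gam K e E
    & [/\ invertible_locus K E = M0 Delta,
          natural_almost_saito x d Delta
            (dual_conn r Gam K E) (dual_mult K E) e
        & regular (M0 Delta) (dual_conn r Gam K E) e]].
Proof.
move=> M Gam K e E r.
have G_uniq : uniq (enum_fset G) by exact: fset_uniq.
have G1 : 1%:M \in enum_fset G by exact: rg_1 hG.
have GM : forall g h, g \in enum_fset G -> h \in enum_fset G -> g *m h \in enum_fset G by exact: rg_mul hG.
have GU : forall g, g \in enum_fset G -> g \in unitmx by exact: rg_unit hG.
have GV : forall g, g \in enum_fset G -> invmx g \in enum_fset G by exact: rg_inv hG.
have x_inv : forall a, grp_invariant (enum_fset G) (tnth x a) by exact: bi_invariant hx.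
have x_gen : forall f, grp_invariant (enum_fset G) f -> exists P, f = comp_mpoly x P by exact: bi_generate hx.
have x_inj := comp_mpoly_inj G1 GM GU GV x_gen.
have x_euler a := euler_homog (hdeg a).
have delta_div l : l != 0 -> (1 < size (stab (enum_fset G) l))%N ->
    exists q, comp_mpoly x Delta = lin l ^+ size (stab (enum_fset G) l) * q.
  by move=> l0 hl; rewrite hDelta; exact: disc_div G1 Ls hLs l l0 hl.
have [w0 D_euler] : exists w0 : nat, euler (comp_mpoly x Delta) = w0%:R *: comp_mpoly x Delta.
  by rewrite hDelta; exact: euler_prod_lin Ls (stabilizer_order G).
have [D_supp D_top] := hmonic.
have D_monic : cf n'.+1 Delta = 1 by rewrite /cf coef_psi.
have D0 := D_neq0 D_monic.
have [P hP] : exists P : 'I_n'.+1 -> 'I_n'.+1 -> 'I_n'.+1 -> mpoly n'.+1 R[i],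
    forall a b c, tofrac (comp_mpoly x Delta) * Omega_V x a b c = tofrac (comp_mpoly x (P a b c)).
  have h (abc : 'I_n'.+1 * 'I_n'.+1 * 'I_n'.+1) : exists p : mpoly n'.+1 R[i],
      tofrac (comp_mpoly x Delta) * Omega_V x abc.1.1 abc.1.2 abc.2 = tofrac (comp_mpoly x p).
    have [p hp] := xP_exists G_uniq G1 GM GU GV x_inv x_gen (@tofrac_inj _) delta_div abc.1.1 abc.1.2 abc.2.
    exists p; rewrite -Omega_V_OmegaV; exact: hp.
  have [p hp] := fin_all_exists h.
  by exists (fun a b c => p (a, b, c)) => a b c; exact: hp (a, b, c).
have hP' a b c : tofrac (comp_mpoly x Delta) * OmegaV x (@tofrac _) a b c = tofrac (comp_mpoly x (P a b c)).
  by rewrite Omega_V_OmegaV; exact: hP.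
have [Gm [Cm [N [U sp]]]] := saito_polys_exist G_uniq G1 GM GU GV x_inv x_gen (@tofrac_inj _) delta_div
  x_euler hsort hd D_euler D_supp D_monic hP'.
have hgam a b c : Gamma_poly x Delta a b c = Gm a c b.
  by rewrite (Gamma_polyE x_inj D0 hP) (sp_Gm sp).
have hcc a b c : C_poly x Delta a b c = Cm a c b := C_polyE x_inj D0 hP sp a b c.
have oT : @open (Cn R n'.+1) setT by exact: openT.
have hss := saito_gen sp hgam hcc oT.
(* An almost Saito structure asks for a point of M_0 where e is nonzero, so M_0 must be nonempty. *)
have [p0 Mp0] : exists p, M0 Delta p.
  apply/not_existsP => h; move/eqP: D0; apply; apply: ev_eq0 => p.
  by apply/eqP/negPn/negP => hp; exact: (h p).
split.
- by split; [exact: ss_torsion_free hss | exact: ss_flat hss].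
- by split; [exact: ss_commutative hss | exact: ss_associative hss | exact: ss_unit hss].
- split; first exact: hss.
  have [t ht] := fin_all_exists (sp_flat_coordinate sp).
  pose T := [tuple t a | a < n'.+1].
  have T1 c b : (d c <= d b)%N -> mderiv b (tnth T c) = (b == c)%:R.
    by rewrite tnth_mktuple; have [_ _ h] := ht c; exact: h.
  have T2 c a b : mderiv a (mderiv b (tnth T c)) = \sum_e Gm a e b * mderiv e (tnth T c).
    by rewrite tnth_mktuple; have [_ h _] := ht c; exact: h.
  have T3 c : weuler d (tnth T c) = (d c)%:R *: tnth T c.
    by rewrite -weulerE -mpoly_natZ tnth_mktuple; have [h _ _] := ht c; exact: h.
  have [Y hY] := triangular_inverse T1.
  have dJ : \det (Defs.jacobian T) = 1 := det_triangular_jac T1 hsort.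
  exists T; split.
  + exact: basic_invariants_comp hx x_euler T3 hY.
  + exact: flat_coordinatesP hgam dJ T2.
  + exact: (polynomial_multP (cc := C_poly x Delta) hcc dJ hY).
have ass := almost_saito_dual sp hgam hcc (ex_intro _ p0 Mp0).
split.
- exact: (invertible_locus_M0 sp (cc := C_poly x Delta) hcc).
- split; [exact: ass | | exact: e_poly_field].
  move=> a b c p Mp; rewrite (frac_evalE x_inj D0 hP) // -(Omm_P sp a b c Mp).
  have /matrixP/(_ b c) := kmx_dual_conn sp hgam hcc a p.
  by rewrite [LHS]mxE [RHS]mxE.
exact: (dual_regular sp (gam := Gamma_poly x Delta) (cc := C_poly x Delta) hgam hcc).
Qed.
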